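(* Let $Y$ be a Haar system Hardy space, and let $\Gamma,\delta,\varepsilon>0$. Let $n,\widetilde N\in\mathbb{N}_0$ be chosen such that $$\widetilde N\ \ge\ 2N\Bigl\lceil\frac{N}{\varepsilon}+1\Bigr\rceil 2^N,$$ where $N=N_{\min}(2(1+\varepsilon)\Gamma,\delta,\varepsilon,n)$, or where $N=N_{\min}^K(2(1+\varepsilon)\Gamma,\delta,\varepsilon,n)$ if the Haar system is $K$-unconditional in $Y$ (for some $K\ge1$). Then for every linear operator $\widetilde T\colon Y_{\widetilde N}\to Y_{\widetilde N}$ with $\|\widetilde T\|\le\Gamma$ and with $\delta$-large diagonal with respect to the Haar basis, the identity $I_{Y_n}$ factors through $\widetilde T$ with constant $\frac{2(1+\varepsilon)^2}{\delta}$.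
   Context: All Banach spaces are real; $\mathbb{N}_0=\mathbb{N}\cup\{0\}$. **The numbers $N_{\min}$ and $N_{\min}^K$.** For $\Gamma,\delta,\varepsilon>0$, $n\in\mathbb{N}_0$, $K\ge1$ and $\eta=\frac{\varepsilon}{6(1+\varepsilon)}$, $$N_{\min}(\Gamma,\delta,\varepsilon,n)=42\,n(n+1)\Bigl\lceil \frac{\Gamma}{\eta\delta}\Bigr\rceil+42+\Bigl\lfloor 4\log_2\Bigl(\frac{\Gamma}{\eta\delta}\Bigr)\Bigr\rfloor,$$ $$N_{\min}^K(\Gamma,\delta,\varepsilon,n)=42\,n\Bigl\lceil \frac{K\Gamma}{\eta\delta}\Bigr\rceil+42+\Bigl\lfloor 4\log_2\Bigl(\frac{\Gamma}{\eta\delta}\Bigr)\Bigr\rfloor.$$ **Haar system.** $\mathcal{D}=\{[\frac{i-1}{2^j},\frac{i}{2^j}) : j\in\mathbb{N}_0,\ 1\le i\le 2^j\}$ is the collection of dyadic intervals in $[0,1)$, $\mathcal{D}_n=\{I\in\mathcal{D}: |I|=2^{-n}\}$, $\mathcal{D}_{\le n}=\bigcup_{k=0}^n\mathcal{D}_k$. For $I\in\mathcal{D}$, $I^+$ and $I^-$ are the left and right halves of $I$, and $h_I=\chi_{I^+}-\chi_{I^-}$. Put $h_\varnothing=\chi_{[0,1)}$ and $\mathcal{D}^+=\mathcal{D}\cup\{\varnothing\}$. Let $\iota\colon\mathcal{D}^+\to\mathbb{N}_0$ be the bijection given by $\iota(\varnothing)=0$ and $\iota([\frac{i}{2^j},\frac{i+1}{2^j}))=2^j+i$.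 Let $H=\operatorname{span}\{h_I: I\in\mathcal{D}^+\}$ and $H_0=\operatorname{span}\{h_I: I\in\mathcal{D}\}$. For $f,g\in H$, $\langle f,g\rangle=\int_0^1 fg$. **Haar system space.** A Haar system space $X$ is the completion of $H$ under a norm $\|\cdot\|_X$ such that (1) if $f,g\in H$ and $|f|,|g|$ have the same distribution, then $\|f\|_X=\|g\|_X$; (2) $\|\chi_{[0,1)}\|_X=1$. **Haar system Hardy space.** Let $r_n=\sum_{I\in\mathcal{D}_n}h_I$, $n\in\mathbb{N}_0$ (Rademacher functions), and let $\mathbf{r}=(r_I)_{I\in\mathcal{D}^+}$ be one of the two families $(r_{\iota(I)})_{I\in\mathcal{D}^+}$ (independent) or $(r_0)_{I\in\mathcal{D}^+}$ (constant). Given a Haar system space $X$, the space $X(\mathbf{r})$ is the completion of $H$ under $$\Bigl\|\sum_{I\in\mathcal{D}^+}a_Ih_I\Bigr\|_{X(\mathbf{r})}=\Bigl\|s\mapsto\int_0^1\Bigl|\sum_{I\in\mathcal{D}^+}r_I(u)a_Ih_I(s)\Bigr|\,du\Bigr\|_X,$$ and $X_0(\mathbf{r})$ is the closure of $H_0$ in $X(\mathbf{r})$. Throughout, a Haar system Hardy space $Y$ means a space $Y=X_0(\mathbf{r})$ of this form, and $Y_n=\operatorname{span}\{h_I: I\in\mathcal{D}_{\le n}\}\subset Y$ with the norm of $Y$; its Haar basis is $(h_I)_{I\in\mathcal{D}_{\le n}}$. **Unconditionality.** The Haar system is $K$-unconditional in $Y$ if $\|\sum_I\epsilon_Ia_Ih_I\|_Y\le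 K\|\sum_Ia_Ih_I\|_Y$ for all finitely supported real families $(a_I)_{I\in\mathcal{D}}$ and all signs $\epsilon_I\in\{\pm1\}$. **Diagonal.** A linear operator $T\colon Y_m\to Y_m$ has $\delta$-large diagonal (with respect to the Haar basis) if $|\langle h_I,Th_I\rangle|\ge\delta|I|$ for all $I\in\mathcal{D}_{\le m}$. **Factorization.** For linear operators $S\colon Y_n\to Y_n$ and $T\colon Y_m\to Y_m$, $S$ factors through $T$ with constant $C$ if there are linear operators $B\colon Y_n\to Y_m$ and $A\colon Y_m\to Y_n$ with $\|A\|\|B\|\le C$ and $S=ATB$. *)

(* Defs.v *)
From HB Require Import structures.
From mathcomp Require Import all_boot all_order all_algebra.
From mathcomp Require Import all_classical all_reals all_analysis.

Set Implicit Arguments.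
Unset Strict Implicit.
Unset Printing Implicit Defensive.

Import Order.TTheory GRing.Theory Num.Theory.

Local Open Scope classical_set_scope.
Local Open Scope ring_scope.

(* The pair (j, i) with i < 2 ^ j stands for [i / 2 ^ j, (i + 1) / 2 ^ j[.    *)
Definition dyadic : Type := {j : nat & 'I_(2 ^ j)}.

(* None is the extra index "emptyset" of D^+ *)
Definition haar_index : Type := option dyadic.

Definition level (I : dyadic) : nat := tag I.

Definition iota_index (I : haar_index) : nat :=
  if I is Some J then (2 ^ level J + tagged J)%N else 0%N.

Section HaarSystem.
Context (R : realType).

Definition dyadic_length (I : dyadic) : R := (2 ^+ level I)^-1.

Definition left_end (I : dyadic) : R := (tagged I)%:R * dyadic_length I.

Definition left_half (I : dyadic) : set R :=
  `[left_end I, left_end I + dyadic_length I / 2[.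

Definition right_half (I : dyadic) : set R :=
  `[left_end I + dyadic_length I / 2, left_end I + dyadic_length I[.

(* Functions on [0, 1[ are extended by 0 to R. *)
Definition haar (I : haar_index) : R -> R :=
  if I is Some J then \1_(left_half J) - \1_(right_half J) else \1_(`[0, 1[).

Definition haar_span (A : pred haar_index) : set (R -> R) :=
  [set f | exists2 l : seq (R * haar_index),
     all (fun p => A p.2) l & f = \sum_(p <- l) p.1 *: haar p.2].

Definition H : set (R -> R) := haar_span predT.

Definition inner (f g : R -> R) : R :=
  \int[lebesgue_measure]_(t in `[0, 1[) (f t * g t).

Definition abs_equidistributed (f g : R -> R) : Prop :=
  forall B : set R, measurable B ->
    lebesgue_measure (`[0, 1[ `&` [set t | B `|f t|]) =
    lebesgue_measure (`[0, 1[ `&` [set t | B `|g t|]).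

(* A Haar system space is determined by its norm on the dense subspace H, and *)
(* the completion is not recorded here. The values of hs_norm outside H are   *)
(* irrelevant.                                                                *)
Record haar_system_space := HaarSystemSpace {
  hs_norm : (R -> R) -> R ;
  hs_normD : forall f g, H f -> H g -> hs_norm (f + g) <= hs_norm f + hs_norm g ;
  hs_normZ : forall (c : R) f, H f -> hs_norm (c *: f) = `|c| * hs_norm f ;
  hs_norm_eq0 : forall f, H f -> hs_norm f = 0 -> f = 0 ;
  hs_norm_distr : forall f g, H f -> H g -> abs_equidistributed f g ->
    hs_norm f = hs_norm g ;
  hs_norm1 : hs_norm (\1_(`[0, 1[)) = 1 }.

Definition rademacher (n : nat) : R -> R :=
  \sum_(i < 2 ^ n) haar (Some (Tagged (fun j => 'I_(2 ^ j)) i)).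

Variant rademacher_kind := Independent | Constant.

Definition rademacher_family (k : rademacher_kind) (I : haar_index) : R -> R :=
  match k with
  | Independent => rademacher (iota_index I)
  | Constant => rademacher 0
  end.

(* Y = X_0(r), again represented by its norm on the dense subspace spanned by *)
(* Haar functions. As the Haar system is linearly independent, hardy_normE    *)
(* determines hardy_norm on H; the values outside H are irrelevant.           *)
Record haar_hardy_space := HaarHardySpace {
  hardy_base : haar_system_space ;
  hardy_kind : rademacher_kind ;
  hardy_norm : (R -> R) -> R ;
  hardy_normE : forall (s : seq haar_index) (a : haar_index -> R), uniq s ->
    hardy_norm (\sum_(I <- s) a I *: haar I) =
    hs_norm hardy_base (fun t =>
      \int[lebesgue_measure]_(u in `[0, 1[)
        `|\sum_(I <- s) rademacher_family hardy_kind I u * a I * haar I t|) }.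

Definition level_le (n : nat) (I : haar_index) : bool :=
  if I is Some J then (level J <= n)%N else false.

Definition haar_spanp (A : pred haar_index) : {pred R -> R} :=
  [pred f | f \in haar_span A].

(* hsection Y n is Y_n; the parameter Y only serves to select the norm. *)
Record hsection (Y : haar_hardy_space) (n : nat) := HSection {
  hsval :> R -> R ;
  hsvalP : hsval \in haar_spanp (level_le n) }.

HB.instance Definition _ (Y : haar_hardy_space) (n : nat) :=
  [isSub for @hsval Y n].
HB.instance Definition _ (Y : haar_hardy_space) (n : nat) :=
  [Choice of hsection Y n by <:].

Lemma haar_span_submod_closed (A : pred haar_index) :
  submod_closed (haar_spanp A).
Proof.
split.
  by apply: mem_set; exists [::] => //; rewrite big_nil.
move=> c f g /set_mem [l1 A1 ->] /set_mem [l2 A2 ->]; apply: mem_set.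
exists ([seq (c * p.1, p.2) | p <- l1] ++ l2).
  by rewrite all_cat A2 all_map andbT; apply: sub_all A1.
rewrite big_cat big_map /= scaler_sumr; congr (_ + _).
by apply: eq_bigr => p _; rewrite scalerA.
Qed.

HB.instance Definition _ (A : pred haar_index) :=
  GRing.isSubmodClosed.Build R (R -> R) (haar_spanp A)
    (@haar_span_submod_closed A).
HB.instance Definition _ (Y : haar_hardy_space) (n : nat) :=
  [SubChoice_isSubLmodule of hsection Y n by <:].

Lemma haar_in_span (A : pred haar_index) (I : haar_index) :
  A I -> haar I \in haar_spanp A.
Proof.
move=> AI; apply: mem_set; exists [:: (1, I)]; first by rewrite /= AI.
by rewrite big_seq1 scale1r.
Qed.

Definition hsection_haar (Y : haar_hardy_space) (n : nat) (I : dyadic)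
    (In : (level I <= n)%N) : hsection Y n :=
  @HSection Y n (haar (Some I)) (@haar_in_span (level_le n) (Some I) In).

Definition haar_unconditional (Y : haar_hardy_space) (K : R) : Prop :=
  forall (s : seq dyadic) (a : dyadic -> R) (e : dyadic -> bool), uniq s ->
    hardy_norm Y (\sum_(I <- s) ((-1) ^+ e I * a I) *: haar (Some I)) <=
    K * hardy_norm Y (\sum_(I <- s) a I *: haar (Some I)).

(* Operator norm; extended-real valued so that no boundedness is presupposed. *)
Definition opnorm (Y : haar_hardy_space) (n m : nat)
    (T : hsection Y n -> hsection Y m) : \bar R :=
  ereal_sup [set (hardy_norm Y (T f))%:E |
               f in [set f : hsection Y n | hardy_norm Y f <= 1]].

Definition large_diagonal (Y : haar_hardy_space) (m : nat) (delta : R)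
    (T : {linear hsection Y m -> hsection Y m}) : Prop :=
  forall (I : dyadic) (Im : (level I <= m)%N),
    delta * dyadic_length I <=
    `|inner (haar (Some I)) (T (hsection_haar Y Im))|.

Definition factors_through (Y : haar_hardy_space) (n m : nat)
    (S : {linear hsection Y n -> hsection Y n})
    (T : {linear hsection Y m -> hsection Y m}) (C : R) : Prop :=
  exists (B : {linear hsection Y n -> hsection Y m})
         (A : {linear hsection Y m -> hsection Y n}),
    (opnorm A * opnorm B <= C%:E)%E /\ forall f, S f = A (T (B f)).

Definition eta (eps : R) : R := eps / (6 * (1 + eps)).

Definition log2 (x : R) : R := ln x / ln 2.

(* These are integers: the term with the logarithm may be negative. *)
Definition Nmin (Gamma delta eps : R) (n : nat) : int :=
  42 * n%:Z * (n%:Z + 1) * Num.ceil (Gamma / (eta eps * delta)) + 42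
  + Num.floor (4 * log2 (Gamma / (eta eps * delta))).

Definition NminK (K Gamma delta eps : R) (n : nat) : int :=
  42 * n%:Z * Num.ceil (K * Gamma / (eta eps * delta)) + 42
  + Num.floor (4 * log2 (Gamma / (eta eps * delta))).

End HaarSystem.

(* Main.v *)
Require Import Defs.
From HB Require Import structures.
From mathcomp Require Import all_boot all_order all_algebra.
From mathcomp Require Import all_classical all_reals all_analysis.
From mathcomp Require Import measurable_realfun lra ring zify.

Set Implicit Arguments.
Unset Strict Implicit.
Unset Printing Implicit Defensive.

Import Order.TTheory GRing.Theory Num.Theory.

Local Open Scope ring_scope.

(** Why the theorem holds. Write [d_K = <h_K, T h_K> / |K|]; all [|d_K|] are at
    least [delta]. Every point of the unit interval lies in one dyadic interval
    of each level, so for one of the two signs the intervals [K] with [d_K] of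
    that sign cover an average point at half of the levels or more. Replacing
    [T] by [- T] if necessary, the first [m] generations of intervals with
    [d_K > 0] all cover a common set whose measure falls short of [1 / 2] by
    little, provided that [m] is small compared with the number of levels
    ([reach_half], [selection]).

    A subfamily of [n + 1] generations carries a block Haar system
    [b_I = \sum_K theta_K h_K]. Its geometry is a coin tossing game: a point
    [s] in an interval [K] of the selected generation [a] tosses the coin
    [theta_K h_K (s)], and a point that lies in no such interval tosses a fresh
    fair coin. The coins of all generations are jointly uniform
    ([equifib_toss]), and [b_I] is the conditional expectation given [s] of the
    function [h_I] of the coins. Hence the map [B] that sends [h_I] to [b_I] is
    an isometry followed by a conditional expectation, and its adjoint
    (normalised in the Haar bases) is again an isometry followed by a conditional
    expectation. Both are contractions on every rearrangement-invariant norm,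
    and after a change of the Rademacher signs on the Hardy norms as well
    ([hnorm_block_op], [hnorm_block_adj]), although the selected generations
    may leave about half of the unit interval uncovered.

    The signs [theta] are chosen at random. In the Walsh basis of the section
    the matrix of [B^* T B] then concentrates around the diagonal matrix whose
    entries are the sums [\sum_K d_K |K|] over single generations
    ([second_moment]). The variance is controlled by the squared sum of the
    entries [<h_K, T h_L>] over two antichains of short intervals, and this sum
    is small for the following reason: the bilinear form [<f, T g>] is bounded
    on unimodular combinations of the Haar functions of an antichain, and for
    short intervals either [h_K] is small in the space or it is small in the
    dual space, because the product of the two norms is at most [|K|]
    ([entry_sqr_sum]). The generation sums lie between [delta] times the covered
    measure and the norm of [T], so the pigeonhole principle provides [n + 1]
    generations whose sums nearly agree. Thus [B^* T B] is a small perturbation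
    of [c] times the identity, with [c] close to [delta / 2] or larger; it is
    invertible, and its inverse turns [B^* T B] into a factorization of the
    identity ([coef_factorization], [identity_factors]).

    Everything takes place on finitely many levels, and the number of levels
    used is at most [2 ^ (2 b + 4 n + 10)] for any [b] with
    [12 (1 + eps)^2 Gamma / (eps delta) <= 2 ^ b]. Since
    [2 ^ N <= Nt], and since both choices of [N] are at least [42 n + 38 + 4 b]
    for a suitable such [b], there is enough room ([Nmin_large]). *)

(** * Averages over finite sets and random signs *)

(** A map with fibres of equal size transports the uniform distribution to the
    uniform distribution; it is the finite form of a measure-preserving map. *)
Definition equifib (W W' : finType) (h : W -> W') : Prop :=
  forall a b, #|[pred w | h w == a]| = #|[pred w | h w == b]|.

Lemma equifib_transport (W W' : finType) (h : W -> W') :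
  (forall a b, exists2 g : W -> W, injective g &
     forall w, h w = a -> h (g w) = b) ->
  equifib h.
Proof.
move=> tr.
have le a b : (#|[pred w | h w == a]| <= #|[pred w | h w == b]|)%N.
  have [g ginj gP] := tr a b.
  rewrite -(fintype.card_image ginj); apply: subset_leq_card; apply/fintype.subsetP => w /fintype.imageP[v].
  by rewrite !inE => /eqP hv ->; rewrite (gP _ hv).
by move=> a b; apply/eqP; rewrite eqn_leq !le.
Qed.

Lemma card_fst_fibre (W J : finType) (w : W) :
  #|[pred v : W * J | v.1 == w]| = #|J|.
Proof.
have w_inj : injective (pair w : J -> _) by move=> j j' [].
rewrite -[RHS](fintype.card_image w_inj); apply: eq_card => -[v j]; rewrite !inE /=; apply/eqP/fintype.imageP.
  by move=> ->; exists j.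
by move=> [j' _ []].
Qed.

Lemma equifib_fst (W J : finType) : equifib (@fst W J).
Proof. by move=> w w'; rewrite !card_fst_fibre. Qed.

Section Averages.
Context (R : realType).
Implicit Types W J : finType.

Definition avg W (f : W -> R) : R := (\sum_w f w) / #|W|%:R.

Lemma eq_avg W (f g : W -> R) : f =1 g -> avg f = avg g.
Proof. by move=> fg; rewrite /avg; under eq_bigr do rewrite fg. Qed.

Lemma avgD W (f g : W -> R) : avg (fun w => f w + g w) = avg f + avg g.
Proof. by rewrite /avg big_split /= mulrDl. Qed.

Lemma avgZ W c (f : W -> R) : avg (fun w => c * f w) = c * avg f.
Proof. by rewrite /avg -mulr_sumr mulrA. Qed.

Lemma avgZr W c (f : W -> R) : avg (fun w => f w * c) = avg f * c.
Proof. by rewrite mulrC -avgZ; apply: eq_avg => w; rewrite mulrC. Qed.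

Lemma avgN W (f : W -> R) : avg (fun w => - f w) = - avg f.
Proof. by rewrite /avg sumrN mulNr. Qed.

Lemma avg_sum W (I : Type) (r : seq I) (P : pred I) (f : I -> W -> R) :
  avg (fun w => \sum_(i <- r | P i) f i w) = \sum_(i <- r | P i) avg (f i).
Proof. by rewrite /avg exchange_big /= mulr_suml. Qed.

Lemma avg_cst W c : (0 < #|W|)%N -> avg (fun _ : W => c) = c.
Proof.
move=> W0; rewrite /avg sumr_const -[c *+ _]mulr_natr mulfK //.
by rewrite pnatr_eq0 -lt0n.
Qed.

Lemma ler_avg W (f g : W -> R) : (forall w, f w <= g w) -> avg f <= avg g.
Proof. by move=> fg; rewrite ler_wpM2r ?invr_ge0 // ler_sum. Qed.

Lemma normr_avg W (f : W -> R) : `|avg f| <= avg (fun w => `|f w|).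
Proof.
rewrite /avg normrM [X in _ * X]ger0_norm ?invr_ge0 //.
by rewrite ler_wpM2r ?invr_ge0 // ler_norm_sum.
Qed.

(** The probabilistic method: some value is at most the mean. *)
Lemma avg_exists W (f : W -> R) : (0 < #|W|)%N -> exists w, f w <= avg f.
Proof.
move=> W0; apply: contrapT => /forallNP lt.
have : \sum_(w : W) avg f < \sum_w f w.
  have [w0 _] : exists w : W, true by move/card_gt0P : W0 => [w _]; exists w.
  apply: ltr_sum => [|w _]; first by apply/hasP; exists w0; rewrite ?mem_index_enum.
  by rewrite ltNge; apply/negP/lt.
rewrite sumr_const -[_ *+ _]mulr_natr /avg mulfVK ?ltxx //.
by rewrite pnatr_eq0 -lt0n.
Qed.

Lemma avg_reindex W (h : W -> W) (f : W -> R) :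
  injective h -> avg (fun w => f (h w)) = avg f.
Proof. by move=> hinj; rewrite /avg -(reindex_inj hinj (F := f) (P := predT)). Qed.

(** All cancellations below come from a bijection that changes the sign. *)
Lemma avg_odd W (h : W -> W) (f : W -> R) :
  injective h -> (forall w, f (h w) = - f w) -> avg f = 0.
Proof.
move=> hinj odd; have := avg_reindex f hinj.
by under eq_avg do rewrite odd; rewrite avgN; lra.
Qed.

Lemma avg_pair W J (f : W * J -> R) :
  avg f = avg (fun w => avg (fun j => f (w, j))).
Proof.
rewrite /avg -mulr_suml card_prod natrM invfM [_^-1 * _]mulrC mulrA.
congr (_ / _ / _); rewrite pair_bigA /=.
by apply: eq_bigr => -[].
Qed.

Lemma avg_exchange W J (f : W -> J -> R) :
  avg (fun w => avg (f w)) = avg (fun j => avg (f^~ j)).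
Proof.
rewrite /avg -!mulr_suml exchange_big /= mulrAC //.
Qed.

Lemma card_equifib W W' (h : W -> W') (b : W') : equifib h ->
  #|W| = (#|W'| * #|[pred w | h w == b]|)%N.
Proof.
move=> hE; rewrite -sum1_card (partition_big h predT) //=.
under eq_bigr => a _ do rewrite sum1_card (hE a b).
by rewrite sum_nat_const.
Qed.

(** The conditional expectation of [f] given [h]. *)
Definition cavg W W' (h : W -> W') (f : W -> R) (b : W') : R :=
  (\sum_(w | h w == b) f w) / #|[pred w | h w == b]|%:R.

Lemma normr_cavg W W' (h : W -> W') (f : W -> R) b :
  `|cavg h f b| <= cavg h (fun w => `|f w|) b.
Proof.
rewrite /cavg normrM [X in _ * X]ger0_norm ?invr_ge0 //.
by rewrite ler_wpM2r ?invr_ge0 // ler_norm_sum.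
Qed.

Lemma avg_cavg W W' J (h : W -> W') (f : J -> W -> R) b :
  avg (fun j => cavg h (f j) b) = cavg h (fun w => avg (f^~ w)) b.
Proof.
by rewrite /avg /cavg -!mulr_suml exchange_big /= mulrAC.
Qed.

Lemma avg_cavgM W W' (h : W -> W') (f : W -> R) (g : W' -> R) :
  equifib h -> (0 < #|W|)%N ->
  avg (fun b => cavg h f b * g b) = avg (fun w => f w * g (h w)).
Proof.
move=> hE W0; rewrite /avg [in RHS](partition_big h predT) //= !mulr_suml.
apply: eq_bigr => b _; rewrite (card_equifib b hE) natrM invfM.
under [in RHS]eq_bigr => w /eqP -> do [].
by rewrite -mulr_suml /cavg; ring.
Qed.

Lemma avg_equifib W W' (h : W -> W') (g : W' -> R) :
  equifib h -> (0 < #|W|)%N -> avg (fun w => g (h w)) = avg g.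
Proof.
move=> hE W0; have := avg_cavgM (fun=> 1) g hE W0.
under eq_avg => b.
  rewrite /cavg sumr_const divff ?mul1r; last first.
    rewrite pnatr_eq0 -lt0n; move: W0; rewrite (card_equifib b hE).
    by rewrite muln_gt0 => /andP[].
  over.
by move=> ->; apply: eq_avg => w; rewrite mul1r.
Qed.

Lemma cavg_fst W J (f : W * J -> R) w : cavg fst f w = avg (fun j => f (w, j)).
Proof.
rewrite /cavg /avg card_fst_fibre; congr (_ / _).
transitivity (\sum_(v | (v.1 == w) && true) f (v.1, v.2)).
  by apply: eq_big => [v|[]]; rewrite ?andbT.
by rewrite -(pair_big_dep (pred1 w) (fun _ => predT) (fun v j => f (v, j))) /=
  big_pred1_eq.
Qed.

Definition sg (b : bool) : R := (-1) ^+ b.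

Lemma sgbM b c : sg b * sg c = sg (b (+) c).
Proof. by rewrite /sg signr_addb. Qed.

Lemma sg_sqr b : sg b * sg b = 1.
Proof. by rewrite sgbM addbb. Qed.

Lemma normr_sgb b : `|sg b| = 1.
Proof. by rewrite /sg normr_sign. Qed.

Lemma sgbN b : sg (~~ b) = - sg b.
Proof. by rewrite /sg signrN. Qed.

Lemma card_signs J : (0 < #|{ffun J -> bool}|)%N.
Proof. by apply/card_gt0P; exists [ffun=> false]. Qed.

Definition flip J (j : J) (z : {ffun J -> bool}) : {ffun J -> bool} :=
  [ffun i => z i (+) (i == j)].

Lemma flipK J (j : J) : involutive (flip j).
Proof. by move=> z; apply/ffunP => i; rewrite !ffunE -addbA addbb addbF. Qed.

Lemma flip_inj J (j : J) : injective (flip j).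
Proof. exact: inv_inj (flipK j). Qed.

Lemma sg_flip J (i j : J) (z : {ffun J -> bool}) :
  sg (flip j z i) = (if i == j then -1 else 1) * sg (z i).
Proof. by rewrite ffunE -sgbM mulrC; congr (_ * _); case: eqP. Qed.

Lemma avg_sg2 J (i j : J) :
  avg (fun z : {ffun J -> bool} => sg (z i) * sg (z j)) = (i == j)%:R.
Proof.
case: eqVneq => [<-|ij].
  by under eq_avg do rewrite sg_sqr; rewrite avg_cst // card_signs.
apply: (avg_odd (@flip_inj _ j)) => z.
by rewrite !sg_flip eqxx (negPf ij); ring.
Qed.

(** Random signs are orthonormal. *)
Lemma avg_sg_sum J (m : J -> R) :
  avg (fun z : {ffun J -> bool} => (\sum_j sg (z j) * m j) ^+ 2) =
  \sum_j m j ^+ 2.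
Proof.
under eq_avg => z.
  rewrite expr2 big_distrl /=.
  under eq_bigr do rewrite mulr_sumr.
  over.
rewrite avg_sum; apply: eq_bigr => i _; rewrite avg_sum (bigD1 i) //=.
rewrite big1 ?addr0 => [|j ji].
  under eq_avg => z do rewrite mulrACA sg_sqr mul1r.
  by rewrite avg_cst ?card_signs.
under eq_avg => z do rewrite mulrACA.
by rewrite avgZr avg_sg2 eq_sym (negPf ji) mul0r.
Qed.

Definition restr (I J : finType) (s : I -> J) (z : {ffun J -> bool}) : {ffun I -> bool} :=
  [ffun i => z (s i)].

(** Reading random signs through an injection gives random signs again: fibres
    are carried to each other by flipping the signs in the image of [s]. *)
Lemma equifib_restr (I J : finType) (s : I -> J) :
  injective s -> equifib (restr s).
Proof.
move=> sinj; apply: equifib_transport => a b.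
pose d j := if [pick i | s i == j] is Some i then a i (+) b i else false.
exists (fun z : {ffun J -> bool} => [ffun j => z j (+) d j]).
  move=> z1 z2 /ffunP eqz; apply/ffunP => j; have := eqz j.
  by rewrite !ffunE => /addIb.
move=> z /ffunP za; apply/ffunP => i; rewrite !ffunE /d.
have := za i; rewrite ffunE => ->; case: pickP => [i'|/(_ i)]; last by rewrite eqxx.
by move=> /eqP /sinj ->; rewrite addKb.
Qed.

Lemma avg_restr (I J : finType) (s : I -> J) (F : {ffun I -> bool} -> R) :
  injective s -> avg (fun z => F (restr s z)) = avg F.
Proof. by move=> sinj; apply: avg_equifib (card_signs J); apply: equifib_restr. Qed.

End Averages.

(** * Rearrangement-invariant norms on finite sets *)

Section Steps.
Local Open Scope classical_set_scope.
Context (R : realType).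

Definition cell (P x : nat) : set R :=
  `[x%:R / 2 ^+ P, x.+1%:R / 2 ^+ P[.

Let exp2_gt0 P : 0 < (2 : R) ^+ P. Proof. exact: exprn_gt0. Qed.

Lemma cellE P x t :
  cell P x t = (x%:R <= t * 2 ^+ P < x.+1%:R :> Prop).
Proof. by rewrite /cell /= in_itv /= ler_pdivrMr ?ltr_pdivlMr. Qed.

Lemma cell_uniq P x y t : cell P x t -> cell P y t -> x = y.
Proof.
rewrite !cellE => /andP[xt tx] /andP[yt ty].
apply/eqP; rewrite eqn_leq; apply/andP; split; rewrite -ltnS -(ltr_nat R).
  exact: le_lt_trans xt ty.
exact: le_lt_trans yt tx.
Qed.

Lemma cell_unit P x t : (x < 2 ^ P)%N -> cell P x t -> `[0, 1[%classic t.
Proof.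
rewrite cellE -(ler_nat R) natrX => xP /andP[xt tx]; rewrite /= in_itv /=.
rewrite -(ler_pM2r (exp2_gt0 P)) mul0r (le_trans _ xt) //=.
by rewrite -(ltr_pM2r (exp2_gt0 P)) mul1r (lt_le_trans tx).
Qed.

Lemma cell_cover P t : `[0, 1[%classic t -> exists2 x, (x < 2 ^ P)%N & cell P x t.
Proof.
rewrite /= in_itv /= => /andP[t0 t1].
have /truncn_itv/andP[h1 h2] : 0 <= t * 2 ^+ P by rewrite mulr_ge0 // ltW.
exists (Num.trunc (t * 2 ^+ P)); last by rewrite cellE h1.
rewrite -(ltr_nat R) natrX (le_lt_trans h1) //.
by rewrite gtr_pMl.
Qed.

Lemma measurable_cell P x : measurable (cell P x).
Proof. exact: measurable_itv. Qed.

Lemma lebesgue_cell P x :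
  lebesgue_measure (cell P x) = ((2 ^+ P)^-1 : R)%:E.
Proof.
rewrite lebesgue_measure_itv /= lte_fin ltr_pM2r ?invr_gt0 // ltr_nat ltnSn.
by rewrite -EFinD -mulrBl -natrB // subSnn mul1r.
Qed.

(** The cells of level [P] are numbered by [W], so that functions on [W] become
    step functions on the unit interval. *)
Record enumerates (W : finType) (P : nat) (e : W -> nat) : Prop := Enumerates {
  enum_inj : injective e ;
  enum_lt : forall w, (e w < 2 ^ P)%N ;
  enum_card : #|W| = (2 ^ P)%N }.

Definition step (W : finType) (P : nat) (e : W -> nat) (f : W -> R) : R -> R :=
  \sum_w f w *: (\1_(cell P (e w)) : R -> R).

Lemma step_sum (W : finType) P (e : W -> nat) f t :
  step P e f t = \sum_w f w * \1_(cell P (e w)) t.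
Proof. by rewrite /step fct_sumE. Qed.

Lemma enum_surj (W : finType) P (e : W -> nat) : enumerates P e ->
  forall x, (x < 2 ^ P)%N -> exists w, e w = x.
Proof.
move=> [ei elt ec] x xP.
pose g w : 'I_(2 ^ P) := Ordinal (elt w).
have gi : injective g by move=> w w' /(congr1 val) /ei.
have : Ordinal xP \in codom g by apply: inj_card_onto => //; rewrite card_ord ec.
by move=> /codomP[w /(congr1 val) /= ->]; exists w.
Qed.

Lemma stepE (W : finType) P (e : W -> nat) f w t : enumerates P e ->
  cell P (e w) t -> step P e f t = f w.
Proof.
move=> [ei _ _] tw; rewrite step_sum (bigD1 w) //= big1 => [|v vw].
  by rewrite addr0 indicE mem_set // mulr1.
rewrite indicE memNset ?mulr0 // => tv.
by move: vw; rewrite (ei _ _ (cell_uniq tv tw)) eqxx.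
Qed.

Lemma step_out (W : finType) P (e : W -> nat) f t : enumerates P e ->
  ~ `[0, 1[%classic t -> step P e f t = 0.
Proof.
move=> [_ elt _] tN; rewrite step_sum big1 // => v _.
by rewrite indicE memNset ?mulr0 // => /(cell_unit (elt v)).
Qed.

Lemma step_cover (W : finType) P (e : W -> nat) t : enumerates P e ->
  `[0, 1[%classic t -> exists w, cell P (e w) t.
Proof.
move=> eP /(cell_cover P)[x xP xt].
by have [w wx] := enum_surj eP xP; exists w; rewrite wx.
Qed.

Lemma measure_step (W : finType) P (e : W -> nat) f (B : set R) :
  enumerates P e ->
  lebesgue_measure (`[0, 1[ `&` [set t | B `|step P e f t|]) =
  (#|[pred w | `[< B `|f w| >]]|%:R / 2 ^+ P)%:E :> \bar R.
Proof.
move=> eP; set p := [pred w | _].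
have -> : `[0, 1[ `&` [set t | B `|step P e f t|] =
    \bigcup_(w in [set` enum p]) cell P (e w).
  apply/seteqP; split=> t /=.
    move=> [/(step_cover eP)[w wt]]; rewrite (stepE _ eP wt) => Bw.
    by exists w => //=; rewrite mem_enum inE.
  move=> [w /=]; rewrite mem_enum inE => Bw wt.
  by rewrite (stepE _ eP wt); split=> //; apply: (cell_unit (enum_lt eP w) wt).
rewrite measure_fin_bigcup //=; last 2 first.
- move=> v w _ _ [t [tv tw]]; apply: (enum_inj eP); exact: cell_uniq tv tw.
- by move=> w _; apply: measurable_cell.
rewrite -fsbig_seq ?enum_uniq //.
under eq_bigr do rewrite lebesgue_cell.
rewrite sumEFin big_const_seq count_predT -cardE iter_addr_0.
by rewrite mulr_natl.
Qed.

(** Equidistribution of step functions is a matter of counting. *)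
Lemma step_equidistributed (W W' : finType) P P' (e : W -> nat) (e' : W' -> nat)
    (h : W -> W') f g :
  enumerates P e -> enumerates P' e' -> equifib h ->
  (forall w, `|f w| = `|g (h w)|) ->
  abs_equidistributed (step P e f) (step P' e' g).
Proof.
move=> eP eP' hE fg B _.
have W0 : (0 < #|W|)%N by rewrite (enum_card eP) expn_gt0.
rewrite !measure_step //; congr (_%:E).
pose q w : R := `[< B `|g w| >]%:R.
have := avg_equifib q hE W0; rewrite /avg -!natr_sum.
rewrite (enum_card eP) (enum_card eP') !natrX => avgE.
rewrite -!sum1_card [in LHS]big_mkcond [in RHS]big_mkcond /=.
transitivity ((\sum_w `[< B `|g (h w)|%R >])%N%:R / 2 ^+ P : R).
  by congr (_%:R / _); apply: eq_bigr => w _; rewrite inE fg; case: asbool.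
by rewrite avgE.
Qed.

Lemma measurable_step (W : finType) P (e : W -> nat) f D :
  measurable_fun D (step P e f).
Proof.
have -> : step P e f = fun t => \sum_w f w * \1_(cell P (e w)) t.
  by apply/funext => t; rewrite step_sum.
apply: measurable_sum => w; apply: measurable_funM => //.
by apply: measurable_indic; apply: measurable_cell.
Qed.

Lemma Rintegral_step (W : finType) P (e : W -> nat) f :
  enumerates P e ->
  \int[lebesgue_measure]_(t in `[0, 1[) step P e f t = avg f.
Proof.
move=> eP; rewrite /Rintegral.
have DE : `[0, 1[%classic = \big[setU/set0]_(w <- enum W) cell P (e w).
  rewrite -bigcup_seq; apply/seteqP; split=> t.
    by move=> /(step_cover eP)[w wt]; exists w => //=; rewrite mem_enum.
  by move=> [w _ wt]; apply: cell_unit (enum_lt eP w) wt.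
rewrite DE integral_bigsetU_EFin //=; last 4 first.
- by move=> w; apply: measurable_cell.
- exact: enum_uniq.
- move=> v w _ _ [t [tv tw]]; apply: (enum_inj eP); exact: cell_uniq tv tw.
- by apply/measurable_EFinP; apply: measurable_step.
have intw w : (\int[lebesgue_measure]_(t in cell P (e w)) (step P e f t)%:E =
    (f w / 2 ^+ P)%:E)%E.
  under eq_integral => t /set_mem wt do rewrite (stepE _ eP wt).
  have := integral_cst lebesgue_measure (@measurable_cell P (e w)) (f w)%:E.
  move=> /= ->; rewrite EFinM; congr (_ * _)%E; exact: lebesgue_cell.
under eq_bigr do rewrite intw.
by rewrite sumEFin /= -mulr_suml big_enum /avg (enum_card eP) natrX.
Qed.


Let natr_double x : x.*2%:R = 2 * x%:R :> R.
Proof. by rewrite -mul2n natrM. Qed.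

Let natr_doubleS x : x.*2.+1%:R = 2 * x%:R + 1 :> R.
Proof. by rewrite -natr1 natr_double. Qed.

Let natr_doubleSS x : x.*2.+2%:R = 2 * x%:R + 2 :> R.
Proof. by rewrite -natr1 natr_doubleS; lra. Qed.

Lemma left_halfE (I : dyadic) : @left_half R I = cell (level I).+1 (tagged I).*2.
Proof.
rewrite /left_half /left_end /dyadic_length /cell exprS invfM.
set q := (2 ^+ _)^-1.
suff [-> ->] : (tagged I)%:R * q = (tagged I).*2%:R * (2^-1 * q) /\
  (tagged I)%:R * q + q / 2 = (tagged I).*2.+1%:R * (2^-1 * q) by [].
by rewrite natr_doubleS natr_double; split; lra.
Qed.

Lemma right_halfE (I : dyadic) :
  @right_half R I = cell (level I).+1 (tagged I).*2.+1.
Proof.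
rewrite /right_half /left_end /dyadic_length /cell exprS invfM.
set q := (2 ^+ _)^-1.
suff [-> ->] : (tagged I)%:R * q + q / 2 = (tagged I).*2.+1%:R * (2^-1 * q) /\
  (tagged I)%:R * q + q = (tagged I).*2.+2%:R * (2^-1 * q) by [].
by rewrite natr_doubleSS natr_doubleS; split; lra.
Qed.

Lemma cell_halve P x t :
  cell P x t <-> cell P.+1 x.*2 t \/ cell P.+1 x.*2.+1 t.
Proof.
rewrite !cellE exprS [2 * _]mulrC mulrA.
set y := t * 2 ^+ P; rewrite natr_doubleSS natr_doubleS natr_double -[x.+1%:R]natr1.
split.
  move=> /andP[h1 h2]; case: (ltP (y * 2) (x%:R * 2 + 1)) => h3.
    by left; apply/andP; split; lra.
  by right; apply/andP; split; lra.
by case=> /andP[h1 h2]; apply/andP; split; lra.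
Qed.

Lemma indic_cell_halve P x : (\1_(cell P x) : R -> R) =
  (\1_(cell P.+1 x.*2) : R -> R) + (\1_(cell P.+1 x.*2.+1) : R -> R).
Proof.
apply/funext => t; rewrite fctE !indicE -natrD; congr (_%:R).
have [|] := pselect (cell P x t) => xt; last first.
  rewrite !memNset // => tx; apply: xt; apply/cell_halve; first by right.
  by left.
rewrite (mem_set xt); case/cell_halve : xt => xt.
  by rewrite (mem_set xt) memNset // => /(cell_uniq xt)/eqP; rewrite ltn_eqF.
by rewrite (mem_set xt) memNset // => /(cell_uniq xt)/eqP; rewrite gtn_eqF.
Qed.

Lemma haar_unit : haar None = \1_(cell 0 0) :> (R -> R).
Proof. by rewrite /haar /cell expr0 !divr1. Qed.

(** Halving an interval [I] writes the indicator of each half as half the sum or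
    half the difference of the indicator of [I] and the Haar function of [I]. *)
Lemma H_indic_cell P x : (x < 2 ^ P)%N -> H (\1_(cell P x) : R -> R).
Proof.
move=> xP; rewrite /H; apply: set_mem.
change ((\1_(cell P x) : R -> R) \in @haar_spanp R predT).
elim: P x xP => [|P IHP] x xP.
  have -> : x = 0%N by move: xP; rewrite expn0 ltnS leqn0 => /eqP.
  by rewrite -haar_unit; apply: haar_in_span.
have yP : (x./2 < 2 ^ P)%N by rewrite ltn_half_double -mul2n -expnS.
have h1 := IHP _ yP.
pose I : dyadic := Tagged (fun j => 'I_(2 ^ j)) (Ordinal yP).
have h2 : haar (Some I) \in @haar_spanp R predT by apply: haar_in_span.
rewrite -[x]odd_double_half; case: (odd x); rewrite ?add1n ?add0n.
  have -> : (\1_(cell P.+1 x./2.*2.+1) : R -> R) =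
      2^-1 *: ((\1_(cell P x./2) : R -> R) - haar (Some I)).
    rewrite (indic_cell_halve P) /haar left_halfE right_halfE /= /level /=.
    apply/funext => t; rewrite !fctE /GRing.scale /=.
    set a := \1_(cell P.+1 x./2.*2) t; set b := \1_(cell P.+1 x./2.*2.+1) t.
    lra.
  by apply: rpredZ; apply: rpredB.
have -> : (\1_(cell P.+1 x./2.*2) : R -> R) =
      2^-1 *: ((\1_(cell P x./2) : R -> R) + haar (Some I)).
    rewrite (indic_cell_halve P) /haar left_halfE right_halfE /= /level /=.
    apply/funext => t; rewrite !fctE /GRing.scale /=.
    set a := \1_(cell P.+1 x./2.*2) t; set b := \1_(cell P.+1 x./2.*2.+1) t.
    lra.
by apply: rpredZ; apply: rpredD.
Qed.

Lemma H_step (W : finType) P (e : W -> nat) f :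
  enumerates P e -> H (step P e f).
Proof.
move=> eP; apply: set_mem; change (step P e f \in @haar_spanp R predT).
apply: rpred_sum => w _; apply: rpredZ; apply: mem_set.
exact: H_indic_cell (enum_lt eP w).
Qed.

End Steps.

(** Uniform distributions on sets of this kind are realised by dyadic cells. *)
Definition pow2 (W : finType) : Prop := #|W| = (2 ^ trunc_log 2 #|W|)%N.

Lemma pow2_gt0 (W : finType) : pow2 W -> (0 < #|W|)%N.
Proof. by rewrite /pow2 => ->; rewrite expn_gt0. Qed.

Lemma pow2_card (W : finType) P : #|W| = (2 ^ P)%N -> pow2 W.
Proof. by rewrite /pow2 => ->; rewrite trunc_expnK. Qed.

Lemma enumerates_rank (W : finType) : pow2 W ->
  enumerates (trunc_log 2 #|W|) (fun w : W => enum_rank w : nat).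
Proof.
move=> W2; split=> //; first by move=> v w /val_inj /enum_rank_inj.
by move=> w; rewrite -W2.
Qed.

Lemma equifib_inj (W : finType) (h : W -> W) : injective h -> equifib h.
Proof.
move=> hinj a b.
suff H c : #|[pred w | h w == c]| = 1%N by rewrite !H.
rewrite -(card1 (invF hinj c)); apply: eq_card => w; rewrite !inE.
by rewrite -[c in LHS](f_invF hinj) (inj_eq hinj).
Qed.

Section FiniteNorm.
Context (R : realType) (X : haar_system_space R).
Implicit Types W : finType.

(** The norm of the step function with values [f] on equal cells. By
    equidistribution neither the order of the cells nor their number matters. *)
Definition rinorm W (f : W -> R) : R :=
  hs_norm X (step (trunc_log 2 #|W|) (fun w : W => enum_rank w : nat) f).

Lemma rinormE W P (e : W -> nat) f : enumerates P e -> hs_norm X (step P e f) = rinorm f.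
Proof.
move=> eP; have W2 : pow2 W by apply: pow2_card (enum_card eP).
have eP' := enumerates_rank W2.
apply: hs_norm_distr; try exact: H_step.
exact: (step_equidistributed eP eP' (equifib_inj (@inj_id W))).
Qed.

(** This is where rearrangement invariance enters; all later estimates in the
    base space are deduced from it and from the axioms of a norm. *)
Lemma rinorm_equidistributed W W' (h : W -> W') f g : pow2 W -> pow2 W' ->
  equifib h -> (forall w, `|f w| = `|g (h w)|) -> rinorm f = rinorm g.
Proof.
move=> /enumerates_rank eP /enumerates_rank eP' hE fg.
apply: hs_norm_distr; try exact: H_step.
exact: (step_equidistributed eP eP' hE fg).
Qed.

Lemma rinorm_pullback W W' (h : W -> W') g : pow2 W -> pow2 W' ->
  equifib h -> rinorm (fun w => g (h w)) = rinorm g.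
Proof. by move=> W2 W2' hE; apply: (rinorm_equidistributed W2 W2' hE). Qed.

Lemma eq_rinorm W (f g : W -> R) : f =1 g -> rinorm f = rinorm g.
Proof. by move=> /funext ->. Qed.

Lemma rinorm_abs W (f g : W -> R) : pow2 W -> (forall w, `|f w| = `|g w|) ->
  rinorm f = rinorm g.
Proof. by move=> W2; apply: (rinorm_equidistributed W2 W2 (equifib_inj (@inj_id W))). Qed.

Lemma rinormD W (f g : W -> R) : pow2 W -> rinorm (fun w => f w + g w) <= rinorm f + rinorm g.
Proof.
move=> /enumerates_rank eP.
have -> : rinorm (fun w => f w + g w) = hs_norm X
    (step (trunc_log 2 #|W|) (fun w : W => enum_rank w : nat) f +
     step (trunc_log 2 #|W|) (fun w : W => enum_rank w : nat) g).
  congr hs_norm; rewrite /step -big_split /=; apply: eq_bigr => w _.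
  by rewrite scalerDl.
by apply: hs_normD; exact: H_step.
Qed.

Lemma rinormZ W c (f : W -> R) : pow2 W -> rinorm (fun w => c * f w) = `|c| * rinorm f.
Proof.
move=> /enumerates_rank eP.
have -> : rinorm (fun w => c * f w) = hs_norm X
    (c *: step (trunc_log 2 #|W|) (fun w : W => enum_rank w : nat) f).
  congr hs_norm; rewrite /step scaler_sumr; apply: eq_bigr => w _.
  by rewrite scalerA.
by rewrite hs_normZ //; exact: H_step.
Qed.

Lemma rinorm0 W : pow2 W -> rinorm (fun _ : W => 0) = 0.
Proof.
by move=> W2; have := rinormZ 0 (fun=> 0) W2; under eq_rinorm do rewrite mul0r; rewrite normr0 mul0r.
Qed.

Lemma rinorm_ge0 W (f : W -> R) : pow2 W -> 0 <= rinorm f.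
Proof.
move=> W2; have := rinormD f (fun w => -1 * f w) W2.
rewrite rinormZ // normrN1 mul1r.
under [X in rinorm X <= _]eq_fun do rewrite mulN1r subrr.
by rewrite rinorm0 //; lra.
Qed.

Lemma rinorm_sum W (I : Type) (r : seq I) (F : I -> W -> R) : pow2 W ->
  rinorm (fun w => \sum_(i <- r) F i w) <= \sum_(i <- r) rinorm (F i).
Proof.
move=> W2; elim: r => [|i r IHr].
  by under eq_rinorm do rewrite big_nil; rewrite big_nil rinorm0.
under eq_rinorm do rewrite big_cons; rewrite big_cons.
by apply: le_trans (rinormD _ _ W2) _; rewrite lerD2l.
Qed.

Lemma rinorm_avg W (I : finType) (F : I -> W -> R) : pow2 W ->
  rinorm (fun w => avg (F^~ w)) <= avg (fun i => rinorm (F i)).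
Proof.
move=> W2; rewrite /avg; under eq_rinorm do rewrite mulrC.
rewrite rinormZ // ger0_norm ?invr_ge0 // mulrC ler_wpM2r ?invr_ge0 //.
exact: rinorm_sum.
Qed.

(** Shrinking [f] at a single point writes it as a convex combination of two
    functions with the same absolute value; hence the norm is monotone in the
    absolute value. *)
Lemma ler_rinorm W (f g : W -> R) : pow2 W -> (forall w, `|f w| <= `|g w|) ->
  rinorm f <= rinorm g.
Proof.
move=> W2 fg.
pose mix (s : seq W) w := if w \in s then f w else g w.
suff mono s : rinorm (mix s) <= rinorm g.
  have -> : f = mix (enum W) by apply/funext => w; rewrite /mix mem_enum.
  exact: mono.
elim: s => [|v s IHs]; first exact: lexx.
apply: le_trans IHs.
pose c : R := f v / g v.
have c1 : `|c| <= 1.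
  rewrite normrM normfV; case: (eqVneq (g v) 0) => [->|gv].
    by rewrite normr0 invr0 mulr0.
  by rewrite ler_pdivrMr ?normr_gt0 // mul1r.
have fc : f v = c * g v.
  rewrite /c; case: (eqVneq (g v) 0) => [gv|gv]; last by rewrite mulfVK.
  have := fg v; rewrite gv normr0 normr_le0 => /eqP ->.
  by rewrite mul0r mulr0.
case: (boolP (v \in s)) => vs.
  rewrite le_eqVlt (eq_rinorm (g := mix s)) ?eqxx // => w; rewrite /mix in_cons.
  by case: eqVneq => [->|//]; rewrite vs.
pose m' w := if w == v then - mix s w else mix s w.
have -> : rinorm (mix (v :: s)) =
    rinorm (fun w => (1 + c) / 2 * mix s w + (1 - c) / 2 * m' w).
  apply: eq_rinorm => w; rewrite /m' /mix in_cons.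
  case: eqVneq => [->|_] /=; last by case: (w \in s); field.
  by rewrite (negPf vs) fc; field.
apply: le_trans (rinormD _ _ W2) _; rewrite !rinormZ //.
have -> : rinorm m' = rinorm (mix s).
  by apply: rinorm_abs => // w; rewrite /m'; case: ifP; rewrite ?normrN.
move: c1; rewrite ler_norml => /andP[c1 c2].
by rewrite !ger0_norm ?divr_ge0 //; lra.
Qed.

Lemma rinorm1 W : pow2 W -> rinorm (fun _ : W => 1) = 1.
Proof.
move=> W2; pose one (_ : W) := tt.
have U2 : pow2 unit by apply: (@pow2_card _ 0); rewrite card_unit.
have oneE : equifib one by move=> [] [].
rewrite (rinorm_pullback (fun=> 1) W2 U2 oneE).
have uP : enumerates 0 (fun _ : unit => 0%N).
  by split; rewrite ?card_unit // => -[] [].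
rewrite -(rinormE _ uP) -[RHS](hs_norm1 X); congr hs_norm.
rewrite /step (big_pred1 tt) => [|[] //]. rewrite scale1r.
by rewrite /cell expr0 !divr1.
Qed.

(** Conditional expectation is an average of rearrangements: cyclically shifting
    all fibres of [h] simultaneously permutes [W], and the mean over the shifts
    is the mean over the fibre. *)
Lemma rinorm_cavg W W' (h : W -> W') (f : W -> R) : pow2 W -> pow2 W' ->
  equifib h -> rinorm (cavg h f) <= rinorm f.
Proof.
move=> W2 W2' hE.
rewrite -(rinorm_pullback _ W2 W2' hE).
have [w0 _] := card_gt0P (pow2_gt0 W2).
pose F b := enum [pred w | h w == b].
pose m := size (F (h w0)).
have Fm b : size (F b) = m by rewrite /m -!cardE; apply: hE.
have m0 : (0 < m)%N.
  by rewrite /m -cardE; apply/card_gt0P; exists w0; rewrite inE.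
have FP w : w \in F (h w) by rewrite mem_enum inE.
(* Every fibre is enumerated by [F], and [sh j] moves each point [j] places on. *)
pose sh (j : 'I_m) w := nth w (F (h w)) ((index w (F (h w)) + j) %% m).
have hsh j w : h (sh j w) = h w.
  have : sh j w \in F (h w) by rewrite mem_nth // Fm ltn_pmod.
  by rewrite mem_enum inE => /eqP.
have sh_inj j : injective (sh j).
  move=> v w eqvw; have hvw : h v = h w by rewrite -(hsh j) eqvw hsh.
  move: eqvw; rewrite /sh hvw (set_nth_default w) ?Fm ?ltn_pmod // => /eqP.
  rewrite nth_uniq ?enum_uniq ?Fm ?ltn_pmod // eqn_modDr.
  rewrite !modn_small -?(Fm (h w)) ?index_mem ?FP -?hvw ?FP // => /eqP eqi.
  by have := nth_index w (FP v); rewrite eqi nth_index // hvw FP.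
have -> : rinorm (fun w => cavg h f (h w)) = rinorm (fun w => avg (fun j => f (sh j w))).
  apply: eq_rinorm => w; rewrite /cavg /avg card_ord cardE -/(F _) Fm.
  congr (_ / _); rewrite -big_enum -/(F _) (big_nth w) Fm big_mkord.
  pose s (j : 'I_m) : 'I_m := Ordinal (ltn_pmod (index w (F (h w)) + j) m0).
  have s_inj : injective s.
    move=> i j /(congr1 val) /= /eqP; rewrite eqn_modDl !modn_small //.
    by move=> /eqP /val_inj.
  by rewrite (reindex_inj s_inj) /=.
apply: le_trans (rinorm_avg _ W2) _.
rewrite (@eq_avg _ _ _ (fun=> rinorm f)) ?avg_cst ?card_ord // => j.
exact: (rinorm_equidistributed W2 W2 (equifib_inj (sh_inj j))).
Qed.

End FiniteNorm.

(** * Dyadic intervals and finite Haar expansions *)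

(** A point of the unit interval, known up to its first [n] binary digits. *)
Notation point n := {ffun 'I_n -> bool}.

Lemma card_point n : #|{: point n}| = (2 ^ n)%N.
Proof. by rewrite card_ffun card_bool card_ord. Qed.

Lemma pow2_point n : pow2 {ffun 'I_n -> bool}.
Proof. exact: pow2_card (card_point n). Qed.

(** Digits are indexed by natural numbers, with zeros beyond the end, so that
    prefixes of different lengths can be compared without casts. *)
Definition bits n (p : point n) (l : nat) : bool :=
  if insub l is Some i then p i else false.

Lemma bits_ord n (p : point n) (i : 'I_n) : bits p i = p i.
Proof. by rewrite /bits valK. Qed.

Lemma bits_out n (p : point n) l : (n <= l)%N -> bits p l = false.
Proof. by move=> nl; rewrite /bits insubF // ltnNge nl. Qed.

Definition of_bits n (b : nat -> bool) : point n := [ffun i : 'I_n => b i].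

Lemma bits_flip n (i : 'I_n) (p : point n) l :
  bits (flip i p) l = bits p l (+) (l == i).
Proof.
case: (ltnP l n) => ln.
  by rewrite -[l]/(val (Ordinal ln)) !bits_ord ffunE.
by rewrite !bits_out // gtn_eqF // (leq_trans (ltn_ord i)).
Qed.

(** The number written by the first [k] digits, most significant first; it is
    the position at level [k] of the dyadic interval around the point. *)
Fixpoint num (b : nat -> bool) (k : nat) : nat :=
  if k is k'.+1 then (b k' + (num b k').*2)%N else 0%N.

Lemma num_lt b k : (num b k < 2 ^ k)%N.
Proof. by elim: k => //= k; rewrite expnS; case: (b k); lia. Qed.

Lemma eq_num b c k : (forall l, (l < k)%N -> b l = c l) <-> num b k = num c k.
Proof.
split; elim: k => //= k IHk.
  by move=> eqbc; rewrite eqbc // IHk // => l lk; apply: eqbc; apply: ltnW.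
move=> eqn l; have : b k = c k.
  by move: (congr1 odd eqn); rewrite !oddD !odd_double !addbF; case: (b k) (c k) => -[].
move=> eqk; rewrite ltnS leq_eqVlt => /predU1P[-> //|]; apply: IHk.
by move: eqn; rewrite eqk => /eqP; rewrite eqn_add2l => /eqP /double_inj.
Qed.

Definition digits (x k l : nat) : bool := odd (x %/ 2 ^ (k.-1 - l)).

Lemma num_digits x k : (x < 2 ^ k)%N -> num (digits x k) k = x.
Proof.
elim: k x => [|k IHk] x; first by rewrite expn0 ltnS leqn0 => /eqP ->.
rewrite expnS => xk /=; rewrite {1}/digits /= subnn expn0 divn1.
rewrite -[RHS]odd_double_half; congr (_ + _.*2)%N.
rewrite -[RHS]IHk; last by rewrite -divn2 ltn_divLR // mulnC.
apply/eq_num => l lk; rewrite /digits /= -divn2 -divnMA -expnS.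
by congr (odd (_ %/ 2 ^ _)); lia.
Qed.

(** The dyadic intervals of level at most [n], as a finite type. *)
Definition interval n : finType := {k : 'I_n.+1 & 'I_(2 ^ k)}.

Section Intervals.
Context (n : nat).
Implicit Types (K L : interval n) (k : 'I_n.+1) (b c : nat -> bool).

Definition lev K : 'I_n.+1 := tag K.

(** The interval of level [k] that contains the point with digits [b]. *)
Definition branch k b : interval n :=
  Tagged (fun k : 'I_n.+1 => 'I_(2 ^ k)) (Ordinal (num_lt b k)).

(** The digits of the left end point of [K], a canonical point of [K]. *)
Definition leftmost K : nat -> bool :=
  fun l => (l < lev K)%N && digits (tagged K) (lev K) l.

Lemma lev_branch k b : lev (branch k b) = k. Proof. by []. Qed.

Lemma eq_branch k b c : (forall l, (l < k)%N -> b l = c l) <-> branch k b = branch k c.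
Proof.
split=> [/eq_num eqn|eqa].
  by congr Tagged; apply: val_inj.
by apply/eq_num; move: (congr1 (fun K : interval n => nat_of_ord (tagged K)) eqa).
Qed.

Lemma branch_leftmost K : branch (lev K) (leftmost K) = K.
Proof.
case: K => k i; rewrite /branch /lev /=; congr Tagged; apply: val_inj => /=.
rewrite -[RHS](num_digits (ltn_ord i)).
by apply/eq_num => l lk; rewrite /leftmost /lev /= lk.
Qed.

Lemma leftmost_branch k b l : (l < k)%N -> leftmost (branch k b) l = b l.
Proof. exact: (eq_branch k (leftmost (branch k b)) b).2 (branch_leftmost (branch k b)) l. Qed.

Lemma leftmost_out K l : (lev K <= l)%N -> leftmost K l = false.
Proof. by move=> Kl; rewrite /leftmost ltnNge Kl. Qed.

Lemma branch_flip k (p : point n.+1) (i : 'I_n.+1) : (k <= i)%N ->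
  branch k (bits (flip i p)) = branch k (bits p).
Proof.
move=> ki; apply/eq_branch => l lk; rewrite bits_flip.
by rewrite ltn_eqF ?addbF // (leq_trans lk).
Qed.

End Intervals.

Lemma equifib_prefix N k (kN : (k <= N)%N) :
  equifib (restr (widen_ord kN)).
Proof. by apply: equifib_restr => i j /(congr1 val) /= /val_inj. Qed.

Section HaarExpansion.
Context (R : realType) (n : nat).
Implicit Types (x y : interval n -> R) (b : nat -> bool) (K L : interval n).

Definition haar_at K b : R := (branch (lev K) b == K)%:R * sg R (b (lev K)).

(** The Haar series with coefficients [x] at the point [b]; a point lies in a
    single interval of each level. *)
Definition haar_sum x b : R := \sum_(k < n.+1) x (branch k b) * sg R (b k).

Lemma sum_branch (F : interval n -> R) b :
  \sum_K F K * (branch (lev K) b == K)%:R = \sum_(k < n.+1) F (branch k b).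
Proof.
rewrite (partition_big (@lev n) predT) //=; apply: eq_bigr => k _.
rewrite (bigD1 (branch k b)) ?lev_branch //= eqxx mulr1 big1 ?addr0 //.
move=> K /andP[/eqP <- Kk]; case: eqP => [eqK|_]; last by rewrite mulr0.
by rewrite {1}eqK eqxx in Kk.
Qed.

Lemma haar_sumE x b : haar_sum x b = \sum_K x K * haar_at K b.
Proof.
rewrite /haar_sum -(sum_branch (fun K => x K * sg R (b (lev K)))).
by apply: eq_bigr => K _; rewrite /haar_at; ring.
Qed.

Lemma haar_at_flip_lev K (p : point n.+1) :
  haar_at K (bits (flip (lev K) p)) = - haar_at K (bits p).
Proof.
by rewrite /haar_at branch_flip // bits_flip eqxx addbT sgbN mulrN.
Qed.

Lemma haar_at_flip_gt K (i : 'I_n.+1) (p : point n.+1) : (lev K < i)%N ->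
  haar_at K (bits (flip i p)) = haar_at K (bits p).
Proof.
by move=> Ki; rewrite /haar_at branch_flip 1?ltnW // bits_flip ltn_eqF ?addbF.
Qed.

Lemma avg_branch K : avg (fun p : point n.+1 => (branch (lev K) (bits p) == K)%:R : R)
  = 2^-1 ^+ lev K.
Proof.
set k := lev K; have kn : (k <= n.+1)%N := ltnW (ltn_ord k).
have -> : avg (fun p : point n.+1 => (branch k (bits p) == K)%:R : R) =
    avg (fun p : point n.+1 => (restr (widen_ord kn) p == of_bits k (leftmost K))%:R).
  apply: eq_avg => p; congr (nat_of_bool _)%:R.
  rewrite -[K in LHS]branch_leftmost -/k; apply/eqP/eqP => [/eq_branch eqa|/ffunP eqp].
    apply/ffunP => i; rewrite !ffunE -eqa // -bits_ord //.
  apply/eq_branch => l lk; have := eqp (Ordinal lk).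
  by rewrite !ffunE => <-; rewrite -bits_ord.
rewrite (avg_equifib (fun q => (q == of_bits k (leftmost K))%:R : R)
  (equifib_prefix kn)) ?card_point ?expn_gt0 //.
rewrite /avg (bigD1 (of_bits k (leftmost K))) //= eqxx big1 => [|q /negPf -> //].
by rewrite addr0 mul1r card_point natrX exprVn.
Qed.

Lemma haar_at_ortho K L : avg (fun p : point n.+1 => haar_at K (bits p) * haar_at L (bits p))
  = (K == L)%:R * 2^-1 ^+ lev K.
Proof.
case: (eqVneq K L) => [<-|KL].
  rewrite mul1r -avg_branch; apply: eq_avg => p.
  by rewrite /haar_at mulrACA sg_sqr mulr1 -natrM; case: eqP.
rewrite mul0r; case: (ltngtP (lev K) (lev L)) => [lt|gt|eq].
- apply: (avg_odd (@flip_inj _ (lev L))) => p.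
  by rewrite haar_at_flip_lev haar_at_flip_gt // mulrN.
- apply: (avg_odd (@flip_inj _ (lev K))) => p.
  by rewrite haar_at_flip_lev haar_at_flip_gt // mulNr.
have {}eq : lev K = lev L := val_inj eq.
rewrite (@eq_avg _ _ _ (fun=> 0)) ?avg_cst ?card_point ?expn_gt0 // => p.
rewrite /haar_at eq; case: eqP => [eK|_]; last by rewrite !mul0r.
by rewrite eK (negPf KL) !mul0r mulr0.
Qed.

Definition coef (g : point n.+1 -> R) K : R :=
  2 ^+ lev K * avg (fun p => g p * haar_at K (bits p)).

(** The telescoping sum of the martingale of conditional expectations of [g] on
    the levels [0, ..., n + 1], evaluated at [p]. *)
Lemma haar_sum_coef g (p : point n.+1) : g p = avg g + haar_sum (coef g) (bits p).
Proof.
pose agree k (q : point n.+1) := (num (bits p) k == num (bits q) k)%:R : R.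
(* [S k] is the mean of [g] over the interval of level [k] around [p]. *)
pose S k := 2 ^+ k * avg (fun q : point n.+1 => g q * agree k q).
have S0 : S 0%N = avg g.
  by rewrite /S mul1r; apply: eq_avg => q; rewrite /agree eqxx mulr1.
have Sn : S n.+1 = g p.
  rewrite /S /avg card_point natrX mulrC mulfVK ?expf_neq0 ?pnatr_eq0 //.
  rewrite (bigD1 p) //= {1}/agree eqxx mulr1 big1 ?addr0 // => q qp.
  rewrite /agree; case: eqP => [/eq_num eqn|_]; last by rewrite mulr0.
  case/eqP : qp; apply/ffunP => i; rewrite -!bits_ord; exact/esym/eqn.
rewrite -Sn -S0 -[LHS](subrK (S 0%N)) addrC; congr (_ + _).
rewrite -(telescope_sumr _ (leq0n n.+1)) big_mkord.
apply: eq_bigr => k _; rewrite /coef lev_branch /S exprS.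
rewrite -mulrA [2 * (_ * _)]mulrCA -mulrBr -[RHS]mulrA; congr (_ * _).
rewrite -avgZ -avgN -avgD -avgZr; apply: eq_avg => q.
have -> : agree k.+1 q = agree k q * (bits p k == bits q k)%:R.
  rewrite /agree -natrM mulnb; congr (nat_of_bool _)%:R.
  apply/eqP/andP => [/eq_num eqn|[/eqP/eq_num eqn /eqP eqk]].
    by split; apply/eqP; [apply/eq_num => l lk; apply/eqn/ltnW | apply: eqn].
  by apply/eq_num => l; rewrite ltnS leq_eqVlt => /predU1P[->//|]; apply: eqn.
have -> : haar_at (branch k (bits p)) (bits q) = agree k q * sg R (bits q k).
  rewrite /haar_at /agree lev_branch; congr ((nat_of_bool _)%:R * _).
  by apply/eqP/eqP => [/eq_branch/eq_num //|/eq_num/eq_branch].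
by case: (bits p k) (bits q k) => -[]; rewrite /sg /=; ring.
Qed.

Lemma avg_haar_sum x : avg (fun p : point n.+1 => haar_sum x (bits p)) = 0.
Proof.
rewrite avg_sum big1 // => k _; apply: (avg_odd (@flip_inj _ k)) => p.
by rewrite branch_flip // bits_flip eqxx addbT sgbN mulrN.
Qed.

Lemma avg_haar_sumM x y :
  avg (fun p : point n.+1 => haar_sum x (bits p) * haar_sum y (bits p)) =
  \sum_K 2^-1 ^+ lev K * (x K * y K).
Proof.
under eq_avg => p do rewrite !haar_sumE big_distrl /=.
rewrite avg_sum; apply: eq_bigr => K _.
under eq_avg => p do rewrite mulr_sumr.
rewrite avg_sum (bigD1 K) //= big1 => [|L LK].
  under eq_avg => p do rewrite mulrACA.
  by rewrite avgZ haar_at_ortho eqxx mul1r addr0 mulrC.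
under eq_avg => p do rewrite mulrACA.
by rewrite avgZ haar_at_ortho eq_sym (negPf LK) mul0r mulr0.
Qed.

Lemma avg_haar_sum_at x K :
  avg (fun p : point n.+1 => haar_sum x (bits p) * haar_at K (bits p)) =
  2^-1 ^+ lev K * x K.
Proof.
under eq_avg => p do rewrite haar_sumE big_distrl /=.
rewrite avg_sum (bigD1 K) //= big1 => [|L LK].
  under eq_avg => p do rewrite -mulrA.
  by rewrite avgZ haar_at_ortho eqxx mul1r addr0 mulrC.
under eq_avg => p do rewrite -mulrA.
by rewrite avgZ haar_at_ortho (negPf LK) mul0r mulr0.
Qed.

Lemma coef_haar_sum x : coef (fun p => haar_sum x (bits p)) = x.
Proof.
apply/funext => K; rewrite /coef avg_haar_sum_at mulrA -exprMn divff ?pnatr_eq0 //.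
by rewrite expr1n mul1r.
Qed.

End HaarExpansion.

(** * The Hardy norm of a family of Haar coefficients *)

Section RademacherMean.
Context (R : realType) (kind : rademacher_kind).
Implicit Types J : finType.

(** The mean over the Rademacher signs for both kinds of families. A constant
    family multiplies the whole series by one sign, which the absolute value
    ignores; so evaluation at trivial signs replaces the mean. *)
Definition rmean J (F : {ffun J -> bool} -> R) : R :=
  match kind with
  | Independent => avg F
  | Constant => F [ffun=> false]
  end.

Lemma eq_rmean J (F G : {ffun J -> bool} -> R) : F =1 G -> rmean F = rmean G.
Proof. by move=> /funext ->. Qed.

Lemma ler_rmean J (F G : {ffun J -> bool} -> R) :
  (forall z, F z <= G z) -> rmean F <= rmean G.
Proof. by rewrite /rmean => FG; case: kind => //; apply: ler_avg. Qed.

Lemma rmean_cst J c : rmean (fun _ : {ffun J -> bool} => c) = c.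
Proof. by rewrite /rmean; case: kind => //; rewrite avg_cst ?card_signs. Qed.

Lemma rmean_ge0 J (F : {ffun J -> bool} -> R) :
  (forall z, 0 <= F z) -> 0 <= rmean F.
Proof. by move=> F0; rewrite -(rmean_cst J 0); apply: ler_rmean. Qed.

Lemma rmeanD J (F G : {ffun J -> bool} -> R) :
  rmean (fun z => F z + G z) = rmean F + rmean G.
Proof. by rewrite /rmean; case: kind => //; apply: avgD. Qed.

Lemma rmeanZ J c (F : {ffun J -> bool} -> R) :
  rmean (fun z => c * F z) = c * rmean F.
Proof. by rewrite /rmean; case: kind => //; apply: avgZ. Qed.

Lemma rmean_avg J (W : finType) (F : W -> {ffun J -> bool} -> R) :
  rmean (fun z => avg (F^~ z)) = avg (fun w => rmean (F w)).
Proof. by rewrite /rmean; case: kind => //; apply: avg_exchange. Qed.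

Lemma rmean_cavg J (W W' : finType) (h : W -> W') b
    (F : {ffun J -> bool} -> W -> R) :
  rmean (fun z => cavg h (F z) b) = cavg h (fun w => rmean (F^~ w)) b.
Proof. by rewrite /rmean; case: kind => //; apply: avg_cavg. Qed.

(** Independent signs may be renamed along any injection. This allows the signs
    to be indexed by levels, or by whatever else separates the intervals of each
    branch. *)
Lemma rmean_restr (I J : finType) (s : I -> J) (F : {ffun I -> bool} -> R) :
  injective s -> rmean (fun z => F (restr s z)) = rmean F.
Proof.
move=> s_inj; rewrite /rmean; case: kind; first exact: avg_restr.
by congr F; apply/ffunP => i; rewrite !ffunE.
Qed.

End RademacherMean.

Section SectionNorm.
Context (R : realType) (X : haar_system_space R) (kind : rademacher_kind).
Context (n : nat).
Implicit Types (x y : interval n -> R) (z : {ffun 'I_n.+1 -> bool}).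

(** One sign for each level suffices, because a branch meets every level once. *)
Definition twist z x : interval n -> R := fun K => sg R (z (lev K)) * x K.

Definition rmodulus x (p : point n.+1) : R :=
  rmean kind (fun z => `|haar_sum (twist z x) (bits p)|).

Definition hnorm x : R := rinorm X (rmodulus x).

Lemma haar_sumD x y b : haar_sum (fun K => x K + y K) b = haar_sum x b + haar_sum y b.
Proof. by rewrite -big_split /=; apply: eq_bigr => k _; rewrite mulrDl. Qed.

Lemma haar_sumZ c x b : haar_sum (fun K => c * x K) b = c * haar_sum x b.
Proof. by rewrite mulr_sumr; apply: eq_bigr => k _; rewrite mulrA. Qed.

Lemma rmodulus_ge0 x p : 0 <= rmodulus x p.
Proof. exact: rmean_ge0. Qed.

Lemma hnormD x y : hnorm (fun K => x K + y K) <= hnorm x + hnorm y.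
Proof.
apply: le_trans (rinormD _ _ _ (pow2_point _)).
apply: (ler_rinorm X (pow2_point _)) => p.
rewrite !ger0_norm ?addr_ge0 ?rmodulus_ge0 // -rmeanD; apply: ler_rmean => z.
apply: le_trans (ler_normD _ _); rewrite -haar_sumD le_eqVlt; apply/orP; left.
apply/eqP; congr `|_|; apply: eq_bigr => k _.
by rewrite /twist mulrDr.
Qed.

Lemma rmodulusZ c x p : rmodulus (fun K => c * x K) p = `|c| * rmodulus x p.
Proof.
rewrite -rmeanZ; apply: eq_rmean => z; rewrite -normrM -haar_sumZ; congr `|_|.
by apply: eq_bigr => k _; rewrite /twist mulrCA.
Qed.

Lemma hnormZ c x : hnorm (fun K => c * x K) = `|c| * hnorm x.
Proof.
rewrite -(rinormZ _ _ _ (pow2_point _)); apply: (rinorm_abs X (pow2_point _)) => p.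
by rewrite rmodulusZ !normrM normr_id.
Qed.

Lemma hnorm_ge0 x : 0 <= hnorm x.
Proof. exact: rinorm_ge0 (pow2_point _). Qed.

Lemma hnorm0 : hnorm (fun=> 0) = 0.
Proof.
rewrite -[RHS](mul0r (hnorm (fun=> 0))) -{2}(normr0 R) -hnormZ.
by congr hnorm; apply/funext => K; rewrite mul0r.
Qed.

Lemma hnorm_sum (I : Type) (r : seq I) (F : I -> interval n -> R) :
  hnorm (fun K => \sum_(i <- r) F i K) <= \sum_(i <- r) hnorm (F i).
Proof.
elim: r => [|i r IHr].
  by under eq_fun do rewrite big_nil; rewrite big_nil hnorm0.
under [X in hnorm X]eq_fun do rewrite big_cons; rewrite big_cons.
by apply: le_trans (hnormD _ _) _; rewrite lerD2l.
Qed.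

(** Coefficients bounded by one of pairwise disjoint intervals inside the dyadic
    interval [q] of level [k]. The modulus of such a series is at most the
    indicator of [q]; this bounds its norm and its pairings with other series. *)
Record flat (k : nat) (q : point k) x : Prop := Flat {
  flat_le1 : forall K, `|x K| <= 1 ;
  flat_lev : forall K, x K != 0 -> (k <= lev K)%N ;
  flat_in : forall K, x K != 0 -> of_bits k (leftmost K) = q ;
  flat_disj : forall b i j, x (branch i b) != 0 -> x (branch j b) != 0 -> i = j }.

Lemma flat_twist k (q : point k) x z : flat q x -> flat q (twist z x).
Proof.
have sg0 b : sg R b != 0 by rewrite /sg signr_eq0.
move=> [x1 xl xi xd]; split.
- by move=> K; rewrite /twist normrM normr_sgb mul1r.
- by move=> K; rewrite /twist mulf_eq0 (negPf (sg0 _)); apply: xl.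
- by move=> K; rewrite /twist mulf_eq0 (negPf (sg0 _)); apply: xi.
by move=> b i j; rewrite /twist !mulf_eq0 !(negPf (sg0 _)); apply: xd.
Qed.

Lemma normr_haar_sum_flat k (q : point k) x b : flat q x ->
  `|haar_sum x b| <= (of_bits k b == q)%:R.
Proof.
move=> [x1 xl xi xd].
case: (pickP (fun i : 'I_n.+1 => x (branch i b) != 0)) => [i xi0|x0]; last first.
  rewrite /haar_sum big1 ?normr0 ?ler0n // => i _.
  by have /negbFE/eqP -> := x0 i; rewrite mul0r.
have -> : of_bits k b = q.
  rewrite -(xi _ xi0); apply/ffunP => l; rewrite !ffunE leftmost_branch //.
  by apply: leq_trans (ltn_ord l) _; rewrite -[X in (_ <= X)%N]/(lev (branch i b) : nat) xl.
rewrite eqxx /haar_sum (bigD1 i) //= big1 ?addr0 => [|j ji].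
  by rewrite normrM normr_sgb mulr1.
have [/eqP -> |xj] := boolP (x (branch j b) == 0); first by rewrite mul0r.
by rewrite (xd _ _ _ xj xi0) eqxx in ji.
Qed.

(** The fundamental function of the base space at [2 ^ - k]. *)
Definition phi k : R := rinorm X (fun q : point k => (q == [ffun=> false])%:R).

(** All dyadic intervals of level [k] have the same norm: translate by [q0]. *)
Lemma phiE k (q0 : point k) : rinorm X (fun q : point k => (q == q0)%:R) = phi k.
Proof.
pose h (q : point k) : point k := [ffun i => q i (+) q0 i].
have h_inj : injective h.
  move=> q1 q2 /ffunP eqh; apply/ffunP => i; have := eqh i.
  by rewrite !ffunE => /addIb.
apply: (rinorm_equidistributed X (pow2_point _) (pow2_point _) (equifib_inj h_inj)).
move=> q; congr `|(nat_of_bool _)%:R|; apply/eqP/eqP => [->|/ffunP eqh].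
  by apply/ffunP => i; rewrite !ffunE addbb.
by apply/ffunP => i; have := eqh i; rewrite !ffunE => /eqP; rewrite addbC -negb_eqb;
  case: (q i) (q0 i) => -[].
Qed.

Lemma phi_ge0 k : 0 <= phi k. Proof. exact: rinorm_ge0 (pow2_point _). Qed.

Lemma phi0 : phi 0 = 1.
Proof.
rewrite -(rinorm1 X (pow2_point 0)); apply: eq_rinorm => q.
by case: eqP => // -[]; apply/ffunP => -[].
Qed.

Let pre k (kn : (k <= n.+1)%N) : point n.+1 -> point k := restr (widen_ord kn).

Let preE k (kn : (k <= n.+1)%N) p : pre kn p = of_bits k (bits p).
Proof. by apply/ffunP => i; rewrite !ffunE -bits_ord. Qed.

Let pre_equi k (kn : (k <= n.+1)%N) : equifib (pre kn).
Proof. exact: equifib_prefix. Qed.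

Lemma hnorm_flat k (q : point k) x : (k <= n.+1)%N -> flat q x -> hnorm x <= phi k.
Proof.
move=> kn xF; rewrite -(phiE q).
rewrite -(rinorm_pullback X _ (pow2_point _) (pow2_point _) (pre_equi kn)).
apply: (ler_rinorm X (pow2_point _)) => p.
rewrite ger0_norm ?rmodulus_ge0 // ger0_norm ?ler0n //.
rewrite -(rmean_cst kind 'I_n.+1 (pre kn p == q)%:R); apply: ler_rmean => z.
by rewrite preE; apply: normr_haar_sum_flat; apply: flat_twist.
Qed.

Lemma avg_twist x y z :
  avg (fun p : point n.+1 => haar_sum (twist z x) (bits p) * haar_sum (twist z y) (bits p)) =
  \sum_K 2^-1 ^+ lev K * (x K * y K).
Proof.
rewrite avg_haar_sumM; apply: eq_bigr => K _; congr (_ * _).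
by rewrite /twist mulrACA sg_sqr mul1r.
Qed.

(** Averaging over the dyadic interval [q] turns a pairing supported there into
    a constant multiple of its indicator. *)
Lemma flat_dual k (q : point k) x y : (k <= n.+1)%N -> flat q x ->
  2 ^+ k * `|\sum_K 2^-1 ^+ lev K * (x K * y K)| * phi k <= hnorm y.
Proof.
move=> kn xF; set c := `|_|; have c0 : 0 <= c by apply: normr_ge0.
have c_le : c <= avg (fun p : point n.+1 => (pre kn p == q)%:R * rmodulus y p).
  under eq_avg => p do rewrite -rmeanZ.
  rewrite -rmean_avg -(rmean_cst kind 'I_n.+1 c); apply: ler_rmean => z.
  rewrite /c -(avg_twist x y z); apply: le_trans (normr_avg _) _.
  apply: ler_avg => p; rewrite normrM ler_wpM2r // preE.
  by apply: normr_haar_sum_flat; apply: flat_twist.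
apply: le_trans (rinorm_cavg X (rmodulus y) (pow2_point _) (pow2_point _) (pre_equi kn)).
rewrite -(phiE q) -[2 ^+ k * c]ger0_norm ?mulr_ge0 //.
rewrite -(rinormZ _ _ _ (pow2_point _)); apply: (ler_rinorm X (pow2_point _)) => r.
have cavg0 : 0 <= cavg (pre kn) (rmodulus y) r.
  by rewrite /cavg mulr_ge0 ?invr_ge0 // sumr_ge0 // => p _; apply: rmodulus_ge0.
rewrite normrM (ger0_norm cavg0) !ger0_norm ?mulr_ge0 //.
case: eqP => [->|_]; last by rewrite mulr0.
rewrite mulr1 mulrC -ler_pdivlMr ?exprn_gt0 //.
apply: le_trans c_le _; rewrite le_eqVlt; apply/orP; left; apply/eqP.
rewrite -(@eq_avg _ _ (fun p => rmodulus y p * (pre kn p == q)%:R)); last first.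
  by move=> p; rewrite mulrC.
rewrite -(avg_cavgM _ (fun r => (r == q)%:R) (pre_equi kn)) ?card_point ?expn_gt0 //.
rewrite /avg (bigD1 q) //= eqxx mulr1 big1 => [|r' /negPf ->]; last by rewrite mulr0.
by rewrite addr0 card_point natrX.
Qed.

Let q0 : point 0 := [ffun=> false].

Lemma hnorm_flat_le1 x : flat q0 x -> hnorm x <= 1.
Proof. by rewrite -phi0; apply: hnorm_flat. Qed.

Lemma flat_dual_le x y : flat q0 x ->
  `|\sum_K 2^-1 ^+ lev K * (x K * y K)| <= hnorm y.
Proof. by move=> /(flat_dual y (leq0n _)); rewrite phi0 mulr1 mul1r. Qed.

End SectionNorm.

(** * Entries of a bounded operator *)

(** By orthonormality of signs the squares of a row add up to the mean square of
    its random sum, which is at most [s] times the mean modulus; and the mean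
    moduli of all rows add up to at most [C]. *)
Lemma sum_sqr_le (R : realType) (I J : finType) (m : I -> J -> R) (C s : R) :
  (forall (e : {ffun I -> bool}) (z : {ffun J -> bool}),
     \sum_i sg R (e i) * \sum_j sg R (z j) * m i j <= C) ->
  (forall i (z : {ffun J -> bool}), `|\sum_j sg R (z j) * m i j| <= s) ->
  0 <= s ->
  \sum_i \sum_j m i j ^+ 2 <= s * C.
Proof.
move=> mC ms s0; under eq_bigr do rewrite -avg_sg_sum.
rewrite -avg_sum -[leRHS](avg_cst (s * C) (card_signs J)).
apply: ler_avg => z.
(* The signs [e] are those that make all row sums [X i] nonnegative. *)
pose X i := \sum_j sg R (z j) * m i j.
apply: le_trans (_ : \sum_i s * `|X i| <= _).
  apply: ler_sum => i _; rewrite -real_normK ?num_real // expr2.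
  by rewrite ler_wpM2r // ms.
rewrite -mulr_sumr ler_wpM2l //.
have := mC [ffun i => X i < 0] z; apply: le_trans.
rewrite le_eqVlt; apply/orP; left; apply/eqP; apply: eq_bigr => i _.
rewrite ffunE -/(X i) /sg; case: ltP => X0.
  by rewrite expr1 mulN1r ltr0_norm.
by rewrite expr0 mul1r ger0_norm.
Qed.

Section BilinearForm.
Context (R : realType) (X : haar_system_space R) (kind : rademacher_kind).
Context (M : nat) (t : interval M -> interval M -> R) (Gam : R).
Implicit Types (x y : interval M -> R) (K L : interval M) (G : pred (interval M)).

Notation hnorm := (hnorm X kind).
Notation phi := (phi X).
Notation flat := (@flat R M).

(** The operator with matrix [t] in the Haar basis. *)
Definition mxact y K : R := \sum_L t K L * y L.
(** The bilinear form [<x, T y>] in Haar coefficients. *)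
Definition form x y : R := \sum_K 2^-1 ^+ lev K * (x K * mxact y K).
(** This is [<h_K, T h_L>], as [t K L] is the coefficient of [h_K] in [T h_L]. *)
Definition entry K L : R := 2^-1 ^+ lev K * t K L.

Hypothesis Gam0 : 0 <= Gam.
Hypothesis mxact_bounded : forall y, hnorm (mxact y) <= Gam * hnorm y.

Lemma form_entries x y : form x y = \sum_K \sum_L x K * entry K L * y L.
Proof.
apply: eq_bigr => K _; rewrite /mxact !mulr_sumr; apply: eq_bigr => L _.
by rewrite /entry; ring.
Qed.

Let q0 : point 0 := [ffun=> false].

Lemma phi_gt0 k : 0 < phi k.
Proof.
rewrite lt_neqAle phi_ge0 andbT; apply/eqP => phi0.
have := rinorm1 X (pow2_point k).
rewrite (@eq_rinorm _ _ _ _ (fun p => \sum_(q : point k) (p == q)%:R)) => [eq1|p]; last first.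
  by rewrite (bigD1 p) //= eqxx big1 ?addr0 // => q; rewrite eq_sym => /negPf ->.
have := rinorm_sum X (index_enum {ffun 'I_k -> bool})
  (fun q p : point k => (p == q)%:R) (pow2_point k).
rewrite eq1 big1 => [|q _]; first by rewrite ler10.
by rewrite phiE.
Qed.

Lemma form_flat x y : flat q0 x -> flat q0 y -> `|form x y| <= Gam.
Proof.
move=> xF yF; apply: le_trans (flat_dual_le X kind (mxact y) xF) _.
apply: le_trans (mxact_bounded y) _; rewrite -[leRHS]mulr1 ler_wpM2l //.
exact: hnorm_flat_le1.
Qed.

(** On short intervals the right argument gains the norm [phi k], and in the next
    lemma the left argument gains the dual norm [(2 ^ k * phi k)^-1]. *)
Lemma form_flat_r k (q : point k) x y : (k <= M.+1)%N -> flat q0 x -> flat q y ->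
  `|form x y| <= Gam * phi k.
Proof.
move=> kM xF yF; apply: le_trans (flat_dual_le X kind (mxact y) xF) _.
apply: le_trans (mxact_bounded y) _; rewrite ler_wpM2l //.
exact: (hnorm_flat X kind kM yF).
Qed.

Lemma form_flat_l k (q : point k) x y : (k <= M.+1)%N -> flat q x -> flat q0 y ->
  2 ^+ k * `|form x y| * phi k <= Gam.
Proof.
move=> kM xF yF; apply: le_trans (flat_dual X kind (mxact y) kM xF) _.
apply: le_trans (mxact_bounded y) _; rewrite -[leRHS]mulr1 ler_wpM2l //.
exact: hnorm_flat_le1.
Qed.

Lemma form_flat_lr k (q q' : point k) x y : (k <= M.+1)%N ->
  flat q x -> flat q' y -> 2 ^+ k * `|form x y| <= Gam.
Proof.
move=> kM xF yF; rewrite -(ler_pM2r (phi_gt0 k)).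
apply: le_trans (flat_dual X kind (mxact y) kM xF) _.
apply: le_trans (mxact_bounded y) _; rewrite ler_wpM2l //.
exact: (hnorm_flat X kind kM yF).
Qed.

(** Pairwise disjoint intervals of level at least [k]: every branch meets at most
    one of them. *)
Record antichain (k : nat) G : Prop := Antichain {
  anti_lev : forall K, G K -> (k <= lev K)%N ;
  anti_disj : forall b i j, G (branch i b) -> G (branch j b) -> i = j }.

Lemma flat_antichain k G x : antichain k G -> (forall K, `|x K| <= (G K)%:R) ->
  flat q0 x.
Proof.
move=> [_ Gd] xG.
have x0 K : x K != 0 -> G K.
  by apply: contraNT => /negPf GK; rewrite -normr_le0 -[leRHS]/(0%:R) -[0%N]/(nat_of_bool false) -GK.
split=> //.
- by move=> K; apply: le_trans (xG K) _; case: (G K).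
- by move=> K _; apply/ffunP => -[].
- by move=> b i j /x0 Gi /x0 Gj; apply: Gd Gi Gj.
Qed.

Lemma flat_antichain_in k (q : point k) G x : antichain k G ->
  (forall K, `|x K| <= (G K && (of_bits k (leftmost K) == q))%:R) ->
  flat q x.
Proof.
move=> [Gl Gd] xG.
have x0 K : x K != 0 -> G K && (of_bits k (leftmost K) == q).
  apply: contraNT => /negPf GK.
  by rewrite -normr_le0 -[leRHS]/(0%:R) -[0%N]/(nat_of_bool false) -GK.
split=> //.
- by move=> K; apply: le_trans (xG K) _; case: (_ && _).
- by move=> K /x0 /andP[/Gl].
- by move=> K /x0 /andP[_ /eqP].
- by move=> b i j /x0 /andP[Gi _] /x0 /andP[Gj _]; apply: Gd Gi Gj.
Qed.

(** The rows or the columns of the matrix of entries have absolute sums at most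
    [Gam * 2 ^ - r]: of the two gains [phi (2 r)] and
    [(2 ^ (2 r) * phi (2 r))^-1], whose product is [2 ^ - (2 r)], one is at most
    [2 ^ - r]. *)
Lemma entry_sqr_sum r G G' : ((2 * r) <= M.+1)%N ->
  antichain (2 * r) G -> antichain (2 * r) G' ->
  \sum_(K | G K) \sum_(L | G' L) entry K L ^+ 2 <= Gam ^+ 2 * 2^-1 ^+ r.
Proof.
move=> rM Ga Ga'.
pose m K L := (G K)%:R * entry K L * (G' L)%:R.
pose sgn H (z : {ffun interval M -> bool}) K : R := (H K)%:R * sg R (z K).
have sgnF H z : antichain (2 * r) H -> flat q0 (sgn H z).
  move=> Ha; apply: (flat_antichain Ha) => K.
  by rewrite normrM normr_sgb mulr1 normr_nat.
have one_in H z K : antichain (2 * r) H ->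
    flat (of_bits (2 * r) (leftmost K)) (fun L => (H L && (L == K))%:R * sg R (z L)).
  move=> Ha; apply: (flat_antichain_in Ha) => L.
  rewrite normrM normr_sgb mulr1 normr_nat.
  by case: eqP => [->|_]; rewrite ?eqxx // !andbF.
have sumE : \sum_(K | G K) \sum_(L | G' L) entry K L ^+ 2 =
    \sum_K \sum_L m K L ^+ 2.
  rewrite big_mkcond; apply: eq_bigr => K _; rewrite /m; case: ifP => GK.
    rewrite big_mkcond; apply: eq_bigr => L _; case: ifP => GL.
      by rewrite mul1r mulr1.
    by rewrite mulr0 expr0n.
  by rewrite big1 // => L _; rewrite !mul0r expr0n.
have mC (e z : {ffun interval M -> bool}) :
    \sum_K sg R (e K) * \sum_L sg R (z L) * m K L <= Gam.
  apply: le_trans (form_flat (sgnF G e Ga) (sgnF G' z Ga')).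
  apply: le_trans (ler_norm _).
  rewrite form_entries le_eqVlt; apply/orP; left; apply/eqP; apply: eq_bigr => K _.
  rewrite mulr_sumr; apply: eq_bigr => L _; rewrite /m /sgn; ring.
have two_r : (2 : R) ^+ (2 * r) * 2^-1 ^+ r = 2 ^+ r.
  by rewrite mul2n -addnn exprD -mulrA -exprMn divff ?pnatr_eq0 // expr1n mulr1.
case: (leP (phi (2 * r)) (2^-1 ^+ r)) => [phi_le|phi_gt].
  rewrite sumE exchange_big /=.
  rewrite [leRHS](_ : _ = (Gam * 2^-1 ^+ r) * Gam); last by ring.
  apply: sum_sqr_le => [e z|L z|]; last by rewrite mulr_ge0 ?exprn_ge0.
    apply: le_trans (mC z e).
    rewrite le_eqVlt; apply/orP; left; apply/eqP.
    under eq_bigr do rewrite mulr_sumr.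
    rewrite exchange_big /=; apply: eq_bigr => K _; rewrite mulr_sumr.
    by apply: eq_bigr => L _; ring.
  apply: le_trans (_ : Gam * phi (2 * r) <= _); last by rewrite ler_wpM2l.
  pose f : {ffun interval M -> bool} := [ffun=> false].
  apply: le_trans (form_flat_r rM (sgnF G z Ga) (one_in G' f L Ga')).
  rewrite le_eqVlt; apply/orP; left; apply/eqP; congr `|_|.
  rewrite form_entries; apply: eq_bigr => K _; rewrite (bigD1 L) //= big1 ?addr0.
    by rewrite eqxx andbT ffunE /m /sgn /sg expr0; ring.
  by move=> L' /negPf ->; rewrite andbF mul0r mulr0.
rewrite sumE [leRHS](_ : _ = (Gam * 2^-1 ^+ r) * Gam); last by ring.
apply: sum_sqr_le => [//|K z|]; last by rewrite mulr_ge0 ?exprn_ge0.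
pose f : {ffun interval M -> bool} := [ffun=> false].
have := form_flat_l rM (one_in G f K Ga) (sgnF G' z Ga').
rewrite (_ : form _ _ = \sum_L sg R (z L) * m K L); last first.
  rewrite form_entries (bigD1 K) //= [X in _ + X]big1 ?addr0.
    apply: eq_bigr => L _.
    by rewrite eqxx andbT ffunE /m /sgn /sg expr0; ring.
  move=> K' /negPf ->; rewrite big1 // => L _.
  by rewrite andbF !mul0r.
set a := `|_| => le_a.
have a0 : 0 <= a := normr_ge0 _.
rewrite exprVn ler_pdivlMr ?exprn_gt0 // mulrC -two_r mulrAC.
by apply: le_trans le_a; rewrite ler_wpM2l ?mulr_ge0 ?exprn_ge0 // ltW.
Qed.

(** Random signs isolate the diagonal of the form, and so the diagonal entries
    inherit every bound of the form on sign vectors. *)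
Lemma diag_signed G (x : interval M -> R) :
  \sum_(K | G K) x K * entry K K = avg (fun z : {ffun interval M -> bool} =>
    form (fun K => (G K)%:R * x K * sg R (z K)) (fun K => (G K)%:R * sg R (z K))).
Proof.
under [RHS]eq_avg => z do rewrite form_entries.
rewrite avg_sum big_mkcond; apply: eq_bigr => K _.
rewrite avg_sum (bigD1 K) //= big1 ?addr0 => [|L LK].
  under eq_avg => z.
    rewrite (_ : _ * _ * _ = (G K)%:R * (G K)%:R * (x K * entry K K) *
      (sg R (z K) * sg R (z K))); last by ring.
    rewrite sg_sqr mulr1; over.
  rewrite avg_cst ?card_signs //.
  by case: (G K); rewrite ?mul1r ?mul0r.
under eq_avg => z.
  rewrite (_ : _ * _ * _ = (G K)%:R * (G L)%:R * (x K * entry K L) *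
    (sg R (z K) * sg R (z L))); last by ring.
  over.
by rewrite avgZ avg_sg2 eq_sym (negPf LK) mulr0.
Qed.

Lemma diag_abs_sum k G : (k <= M.+1)%N -> antichain k G ->
  \sum_(K | G K) `|entry K K| <= Gam.
Proof.
move=> kM Ga; pose x K := sg R (entry K K < 0).
have -> : \sum_(K | G K) `|entry K K| = \sum_(K | G K) x K * entry K K.
  apply: eq_bigr => K _; rewrite /x /sg; case: ltP => m0.
    by rewrite expr1 mulN1r ltr0_norm.
  by rewrite expr0 mul1r ger0_norm.
rewrite diag_signed -[leRHS](avg_cst Gam (card_signs (interval M))).
apply: ler_avg => z; apply: le_trans (ler_norm _) (form_flat _ _);
  apply: (flat_antichain Ga) => K.
  by rewrite !normrM !normr_sgb !mulr1 normr_nat.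
by rewrite normrM normr_sgb mulr1 normr_nat.
Qed.

Lemma diag_abs_sum_in k (q : point k) G : (k <= M.+1)%N -> antichain k G ->
  \sum_(K | G K && (of_bits k (leftmost K) == q)) `|entry K K| <= Gam * 2^-1 ^+ k.
Proof.
move=> kM Ga; pose x K := sg R (entry K K < 0).
pose G' : pred (interval M) := fun K => G K && (of_bits k (leftmost K) == q).
have -> : \sum_(K | G K && (of_bits k (leftmost K) == q)) `|entry K K| =
    \sum_(K | G' K) x K * entry K K.
  apply: eq_bigr => K _; rewrite /x /sg; case: ltP => m0.
    by rewrite expr1 mulN1r ltr0_norm.
  by rewrite expr0 mul1r ger0_norm.
rewrite diag_signed -[leRHS](avg_cst _ (card_signs (interval M))).
apply: ler_avg => z; apply: le_trans (ler_norm _) _.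
rewrite exprVn ler_pdivlMr ?exprn_gt0 // mulrC.
apply: (@form_flat_lr k q q) => //; apply: (flat_antichain_in Ga) => K.
  by rewrite !normrM !normr_sgb !mulr1 normr_nat.
by rewrite normrM normr_sgb mulr1 normr_nat.
Qed.

End BilinearForm.

(** * Block Haar systems driven by coins *)

(** A labelling of intervals by the levels of a Haar system of height [n]: along
    each branch the labels increase strictly, and an interval with label [a']
    is contained in intervals of all smaller labels. *)
Record tower (M n : nat) (lab : interval M -> option 'I_n.+1) : Prop := Tower {
  tower_mono : forall b i j a a', lab (branch i b) = Some a ->
    lab (branch j b) = Some a' -> (i < j)%N = (a < a')%N ;
  tower_nested : forall b j (a a' : 'I_n.+1), lab (branch j b) = Some a' -> (a < a')%N ->
    exists i, lab (branch i b) = Some a }.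

Section Coins.
Context (M n : nat) (lab : interval M -> option 'I_n.+1) (theta : interval M -> bool).
Hypothesis labT : tower lab.
Implicit Types (b : nat -> bool) (c : point n.+1) (a : 'I_n.+1) (i : 'I_M.+1).

Definition selected b a : option 'I_M.+1 := [pick i | lab (branch i b) == Some a].

Lemma lab_uniq b i j a : lab (branch i b) = Some a -> lab (branch j b) = Some a -> i = j.
Proof.
move=> li lj; apply: val_inj => /=.
have := tower_mono labT lj li; have := tower_mono labT li lj; rewrite ltnn.
by case: ltngtP.
Qed.

Lemma selected_some b a i : lab (branch i b) = Some a -> selected b a = Some i.
Proof.
move=> li; rewrite /selected; case: pickP => [j /eqP lj|/(_ i)].
  by rewrite (lab_uniq lj li).
by rewrite li eqxx.
Qed.

Lemma selectedP b a i : selected b a = Some i -> lab (branch i b) = Some a.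
Proof. by rewrite /selected; case: pickP => // j /eqP lj [<-]. Qed.

(** The coin of label [a] at the point [b] is the sign of [theta_K h_K] on the
    interval [K] around [b] with this label, or the fresh bit [c a] if there is no
    such interval. *)
Definition coin b c : point n.+1 :=
  [ffun a => if selected b a is Some i then theta (branch i b) (+) b i else c a].

Lemma coin_some b c a i : lab (branch i b) = Some a ->
  coin b c a = theta (branch i b) (+) b i.
Proof. by move=> /selected_some s; rewrite ffunE s. Qed.

Lemma coin_none b c a : selected b a = None -> coin b c a = c a.
Proof. by rewrite ffunE => ->. Qed.

(** By nestedness the intervals of the earlier labels contain [branch i b], so
    their coins are read off the first [i] digits. *)
Lemma coin_prefix b b' c c' i a a' : lab (branch i b) = Some a ->
  (forall l, (l < i)%N -> b l = b' l) -> (a' < a)%N -> coin b c a' = coin b' c' a'.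
Proof.
move=> li bb' aa'; have [j lj] := tower_nested labT li aa'.
have ji : (j < i)%N by rewrite (tower_mono labT lj li).
have ej : branch j b = branch j b' by apply/eq_branch => l lj'; apply/bb'/(ltn_trans lj').
by rewrite (coin_some _ lj) (@coin_some b' c' a' j) -?ej // bb'.
Qed.

Notation omega := (point M.+1 * point n.+1)%type.

Definition toss (w : omega) : point n.+1 := coin (bits w.1) w.2.

(** A measure-preserving move that turns the coin [a] over: it swaps the two
    halves of the labelled interval around the point, or flips the fresh bit. *)
Definition turn a (w : omega) : omega :=
  if selected (bits w.1) a is Some i then (flip i w.1, w.2) else (w.1, flip a w.2).

Lemma selected_flip (p : point M.+1) a i : selected (bits p) a = Some i ->
  selected (bits (flip i p)) a = Some i.
Proof. by move=> /selectedP li; apply: selected_some; rewrite branch_flip. Qed.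

Lemma turnK a : involutive (turn a).
Proof.
move=> [p c]; rewrite {2}/turn /=; case E: (selected (bits p) a) => [i|].
  by rewrite /turn /= (selected_flip E) flipK.
by rewrite /turn /= E flipK.
Qed.

Lemma turn_inj a : injective (turn a).
Proof. exact: inv_inj (turnK a). Qed.

Lemma toss_turn a w : toss (turn a w) a = ~~ toss w a.
Proof.
case: w => p c; rewrite /toss /turn /=; case E: (selected (bits p) a) => [i|] /=.
  have li := selectedP E; have li' := selectedP (selected_flip E).
  rewrite (coin_some _ li) (coin_some _ li') branch_flip // bits_flip eqxx addbT.
  by rewrite addbN.
by rewrite !coin_none // ffunE eqxx addbT.
Qed.

Lemma toss_turn_lt a a' w : (a' < a)%N -> toss (turn a w) a' = toss w a'.
Proof.
case: w => p c aa'; rewrite /toss /turn /=; case E: (selected (bits p) a) => [i|] /=.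
  apply/esym; apply: (coin_prefix _ _ (selectedP E)) aa' => l li.
  by rewrite bits_flip ltn_eqF ?addbF.
rewrite !ffunE; case: (selected _ _) => //.
by rewrite -(inj_eq val_inj) ltn_eqF ?addbF.
Qed.

Lemma card_omega : #|{: omega}| = (2 ^ (M.+1 + n.+1))%N.
Proof. by rewrite card_prod !card_point expnD. Qed.

Lemma pow2_omega : pow2 (point M.+1 * point n.+1)%type.
Proof. exact: pow2_card card_omega. Qed.

End Coins.

Section TossUniform.
Context (R : realType) (M n : nat) (lab : interval M -> option 'I_n.+1)
  (theta : interval M -> bool).
Hypothesis labT : tower lab.
Notation toss := (toss lab theta).

(** The move [turn a] keeps the coins before [a] and turns the coin [a]; so each
    further coin halves the probability, and the coins are uniform. *)
Lemma equifib_toss : equifib toss.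
Proof.
pose E k (c : point n.+1) (w : point M.+1 * point n.+1) :=
  [forall a : 'I_n.+1, (a < k)%N ==> (toss w a == c a)].
have avgE k c : (k <= n.+1)%N -> avg (fun w => (E k c w)%:R : R) = 2^-1 ^+ k.
  elim: k => [_|k IHk kn].
    rewrite (@eq_avg _ _ _ (fun=> 1)) ?avg_cst ?card_omega ?expn_gt0 // => w.
    by rewrite /E (_ : [forall _, _] = true) //; apply/forallP.
  pose a0 : 'I_n.+1 := Ordinal kn.
  have ES w : E k.+1 c w = E k c w && (toss w a0 == c a0).
    apply/forallP/andP => [H|[/forallP H /eqP H0] a].
      split; last by have := H a0; rewrite ltnSn.
      by apply/forallP => a; apply/implyP => ak; have := H a; rewrite ltnS ltnW.
    rewrite ltnS leq_eqVlt; apply/implyP => /predU1P[ak|ak].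
      by rewrite (_ : a = a0) ?H0 //; apply: val_inj.
    by have := H a; rewrite ak.
  have Eturn w : E k c (turn lab a0 w) = E k c w.
    apply/eq_forallb => a; case: (ltnP a k) => //= ak.
    by rewrite toss_turn_lt.
  have sumE : avg (fun w => (E k.+1 c w)%:R : R) +
      avg (fun w => (E k.+1 c (turn lab a0 w))%:R : R) = avg (fun w => (E k c w)%:R).
    rewrite -avgD; apply: eq_avg => w; rewrite !ES Eturn toss_turn //.
    by rewrite -natrD; congr (_%:R); case: (E k c w) (toss w a0) (c a0) => -[] [].
  rewrite (avg_reindex (fun w => (E k.+1 c w)%:R : R) (turn_inj labT (a := a0))) in sumE.
  rewrite exprS -(IHk (ltnW kn)) -sumE; set u := avg _.
  by rewrite -[u + u]mulr2n -[u *+ 2]mulr_natl mulKf ?pnatr_eq0.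
have EE c w : E n.+1 c w = (toss w == c).
  apply/forallP/eqP => [H|-> a]; last by rewrite eqxx implybT.
  by apply/ffunP => a; have := H a; rewrite ltn_ord => /eqP.
have card_fib c : #|[pred w | toss w == c]|%:R / #|{: point M.+1 * point n.+1}|%:R
    = 2^-1 ^+ n.+1 :> R.
  rewrite -(avgE n.+1 c (leqnn _)) /avg -natr_sum; congr (_%:R / _).
  rewrite -sum1_card big_mkcond; apply: eq_bigr => w _.
  by rewrite inE -EE; case: (E _ _ _).
move=> c c'; apply/eqP; rewrite -(eqr_nat R).
have W0 : (#|{: point M.+1 * point n.+1}|%:R)^-1 != 0 :> R.
  by rewrite invr_eq0 pnatr_eq0 card_omega expn_eq0.
by apply/eqP/(mulIf W0); rewrite !card_fib.
Qed.

End TossUniform.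

Section Operators.
Context (R : realType) (M n : nat) (lab : interval M -> option 'I_n.+1)
  (theta : interval M -> bool).
Hypothesis labT : tower lab.
Implicit Types (x y : interval n -> R) (f : interval M -> R) (I : interval n)
  (K : interval M).
Notation coin := (coin lab theta).
Notation toss := (toss lab theta).
Notation omega := (point M.+1 * point n.+1)%type.

Definition delta (m : nat) (I : interval m) : interval m -> R :=
  fun J => (J == I)%:R.

(** On an interval [K] with label [a] the coefficient is that of the interval [I]
    of level [a] which the coins before [a] determine; these are decided at any
    point of [K], in particular at its left end point. *)
Definition block_op x : interval M -> R := fun K =>
  if lab K is Some a then
    sg R (theta K) * x (branch a (bits (coin (leftmost K) [ffun=> false])))
  else 0.

(** The adjoint of [block_op] for the inner product of the Haar series. *)
Definition block_adj f : interval n -> R := fun I =>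
  2 ^+ lev I * \sum_K 2^-1 ^+ lev K * (f K * block_op (delta I) K).

Lemma haar_sum_delta (m : nat) (I : interval m) b : haar_sum (delta I) b = haar_at R I b.
Proof.
rewrite haar_sumE (bigD1 I) //= /delta eqxx mul1r big1 ?addr0 // => K /negPf ->.
by rewrite mul0r.
Qed.

(** [block_op] is the conditional expectation, given the point, of a function of
    the coins: a fresh coin averages out the corresponding term. *)
Lemma haar_sum_block_op x b :
  haar_sum (block_op x) b = avg (fun c : point n.+1 => haar_sum x (bits (coin b c))).
Proof.
rewrite avg_sum /haar_sum.
transitivity (\sum_(a < n.+1) \sum_(i < M.+1 | lab (branch i b) == Some a)
    block_op x (branch i b) * sg R (b i)).
  rewrite (exchange_big_dep predT) //=; apply: eq_bigr => i _.
  case E: (lab (branch i b)) => [a|]; last first.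
    by rewrite /block_op E mul0r big_pred0.
  by rewrite (big_pred1 a) // => a'; rewrite eq_sym.
apply: eq_bigr => a _.
case E: (selected lab b a) => [i|]; last first.
  rewrite big_pred0 => [|i]; last first.
    by apply/negP => /eqP /(selected_some labT); rewrite E.
  apply/esym; apply: (avg_odd (@flip_inj _ a)) => c.
  rewrite bits_ord coin_none // bits_ord coin_none // ffunE eqxx addbT sgbN mulrN.
  congr (- (x _ * _)); apply/eq_branch => l la.
  have ln : (l < n.+1)%N := ltn_trans la (ltn_ord a).
  rewrite -[l]/(val (Ordinal ln)) !bits_ord !ffunE; case: (selected _ _ _) => //.
  by rewrite (_ : Ordinal ln == a = false) ?addbF //; apply: ltn_eqF.
have li := selectedP E.
rewrite (big_pred1 i) => [|j]; last first.
  apply/eqP/eqP => [lj|->//]; exact: (lab_uniq labT lj li).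
rewrite -[LHS](@avg_cst _ (point n.+1)) ?card_point ?expn_gt0 //.
apply: eq_avg => c; rewrite /block_op li bits_ord (coin_some theta labT _ li) -sgbM.
rewrite [RHS]mulrA [x _ * _]mulrC; congr (_ * x _ * _); apply/eq_branch => l la.
have ln : (l < n.+1)%N := ltn_trans la (ltn_ord a).
rewrite -[l]/(val (Ordinal ln)) !bits_ord; apply/esym.
by apply: (coin_prefix theta labT _ _ li) => // l' l'i; rewrite leftmost_branch.
Qed.

(** Both sides have the same Haar coefficients, by the previous lemma. *)
Lemma haar_sum_block_adj f c : haar_sum (block_adj f) (bits c) =
  cavg toss (fun w : omega => haar_sum f (bits w.1)) c.
Proof.
have W0 : (0 < #|{: omega}|)%N by rewrite card_omega expn_gt0.
have tE := equifib_toss R theta labT.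
rewrite [RHS](haar_sum_coef (cavg toss (fun w : omega => haar_sum f (bits w.1)))).
have -> : avg (cavg toss (fun w : omega => haar_sum f (bits w.1))) = 0.
  have := avg_cavgM (fun w : omega => haar_sum f (bits w.1)) (fun=> 1) tE W0.
  under eq_avg do rewrite mulr1; move=> ->.
  rewrite avg_pair -[RHS](avg_haar_sum f); apply: eq_avg => p /=.
  by rewrite mulr1 avg_cst ?card_point ?expn_gt0.
rewrite add0r; congr (haar_sum _ _); apply/funext => I.
rewrite /coef avg_cavgM // avg_pair /block_adj -avg_haar_sumM; congr (_ * _).
apply: eq_avg => p /=; rewrite avgZ haar_sum_block_op; congr (_ * _).
by apply: eq_avg => c'; rewrite haar_sum_delta.
Qed.

Lemma block_op_sum x K : block_op x K = \sum_I x I * block_op (delta I) K.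
Proof.
rewrite /block_op; case: (lab K) => [a|]; last first.
  by rewrite big1 // => I _; rewrite mulr0.
set J := branch a _; rewrite (bigD1 J) //= /delta eqxx mulr1 big1 ?addr0 1?mulrC //.
by move=> I; rewrite eq_sym => /negPf ->; rewrite !mulr0.
Qed.

Lemma block_adj_pairing f y :
  \sum_I 2^-1 ^+ lev I * (y I * block_adj f I) =
  \sum_K 2^-1 ^+ lev K * (block_op y K * f K).
Proof.
transitivity (\sum_I \sum_K 2^-1 ^+ lev K * (f K * (y I * block_op (delta I) K))).
  apply: eq_bigr => I _; rewrite /block_adj mulrCA [2^-1 ^+ lev I * _]mulrA -exprMn mulVf ?pnatr_eq0 //.
  rewrite expr1n mul1r mulr_sumr; apply: eq_bigr => K _.
  by rewrite mulrCA; congr (_ * _); rewrite mulrCA.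
rewrite exchange_big /=; apply: eq_bigr => K _; rewrite (block_op_sum y) mulr_suml mulr_sumr.
by apply: eq_bigr => I _; congr (_ * _); rewrite mulrC.
Qed.

Context (X : haar_system_space R) (kind : rademacher_kind).

Notation signs := {ffun ('I_n.+1 + 'I_M.+1) -> bool}.

(** The fine sign of [K] is the coarse sign of its label, if it has one. Every
    branch still sees independent signs, and [block_op] and [block_adj]
    intertwine the two sign changes. *)
Let slot K : 'I_n.+1 + 'I_M.+1 := if lab K is Some a then inl a else inr (lev K).

Let ftwist (z : signs) f : interval M -> R := fun K => sg R (z (slot K)) * f K.

Let ctwist (z : signs) x : interval n -> R := twist (restr inl z) x.

Let inl_inj : injective (@inl 'I_n.+1 'I_M.+1). Proof. by move=> a a' []. Qed.

Let rmodulus_fine f (p : point M.+1) : rmodulus kind f p =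
  rmean kind (fun z : signs => `|haar_sum (ftwist z f) (bits p)|).
Proof.
pose s (k : 'I_M.+1) := slot (branch k (bits p)).
have s_inj : injective s.
  move=> i j; rewrite /s /slot.
  case Ei: (lab _) => [a|]; case Ej: (lab _) => [a'|] // [].
    by move=> eqa; apply: (lab_uniq labT Ei); rewrite Ej eqa.
  by move=> eqij; exact: eqij.
rewrite /rmodulus -(rmean_restr kind _ s_inj); apply: eq_rmean => z.
by congr `|_|; apply: eq_bigr => k _; rewrite /twist /ftwist lev_branch ffunE.
Qed.

Let rmodulus_coarse x (c : point n.+1) : rmodulus kind x c =
  rmean kind (fun z : signs => `|haar_sum (ctwist z x) (bits c)|).
Proof. by rewrite /rmodulus -(rmean_restr kind _ inl_inj). Qed.

Let ftwist_block_op z x : ftwist z (block_op x) = block_op (ctwist z x).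
Proof.
apply/funext => K; rewrite /ftwist /block_op /slot.
case: (lab K) => [a|]; last by rewrite mulr0.
by rewrite /ctwist /twist lev_branch ffunE mulrCA.
Qed.

Let ctwist_block_adj z f : ctwist z (block_adj f) = block_adj (ftwist z f).
Proof.
apply/funext => I; rewrite /ctwist /twist /block_adj mulrCA; congr (_ * _).
rewrite mulr_sumr; apply: eq_bigr => K _; rewrite mulrCA; congr (_ * _).
rewrite /ftwist /block_op /slot; case: (lab K) => [a|]; last by rewrite !mulr0.
rewrite /delta; case: eqP => [<-|_]; last by rewrite !mulr0.
by rewrite ffunE; exact: mulrA.
Qed.

(** For each choice of the signs the modulus on the fine side is at most the mean
    over the fresh coins of the modulus on the coarse side. *)
Lemma hnorm_block_op x : hnorm X kind (block_op x) <= hnorm X kind x.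
Proof.
rewrite {2}/hnorm -(rinorm_pullback X (rmodulus kind x) (pow2_omega M n) (pow2_point n.+1)
  (equifib_toss R theta labT)).
apply: (le_trans _ (rinorm_cavg X _ (pow2_omega M n) (pow2_point M.+1) (@equifib_fst _ _))).
apply: (ler_rinorm X (pow2_point _)) => p; rewrite ger0_norm ?rmodulus_ge0 //.
apply: (le_trans _ (ler_norm _)).
rewrite cavg_fst rmodulus_fine.
under [leRHS]eq_avg => c do rewrite rmodulus_coarse.
rewrite -rmean_avg; apply: ler_rmean => z.
by rewrite ftwist_block_op haar_sum_block_op normr_avg.
Qed.

Lemma hnorm_block_adj f : hnorm X kind (block_adj f) <= hnorm X kind f.
Proof.
rewrite {2}/hnorm -(rinorm_pullback X (rmodulus kind f) (pow2_omega M n) (pow2_point M.+1)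
  (@equifib_fst _ _)).
apply: (le_trans _ (rinorm_cavg X _ (pow2_omega M n) (pow2_point n.+1)
  (equifib_toss R theta labT))).
apply: (ler_rinorm X (pow2_point _)) => c; rewrite ger0_norm ?rmodulus_ge0 //.
apply: (le_trans _ (ler_norm _)); rewrite rmodulus_coarse.
rewrite [leRHS](_ : _ = cavg toss (fun w : omega =>
  rmean kind (fun z : signs => `|haar_sum (ftwist z f) (bits w.1)|)) c); last first.
  by congr cavg; apply/funext => w; rewrite rmodulus_fine.
rewrite -rmean_cavg; apply: ler_rmean => z.
by rewrite ctwist_block_adj haar_sum_block_adj normr_cavg.
Qed.

End Operators.

(** * Walsh functions of the coins *)

Section Walsh.
Context (R : realType) (n : nat).
Implicit Types (A : {set 'I_n.+1}) (c : point n.+1) (x y : interval n -> R).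

(** In the Walsh basis the compressed operator is nearly diagonal, because the
    blocks of Walsh functions have products of random signs as coefficients. *)
Definition walsh A c : R := \prod_(a in A) sg R (c a).

Definition top A (a : 'I_n.+1) : bool :=
  (a \in A) && [forall b in A, (b <= a)%N].

Lemma top_in A a : top A a -> a \in A.
Proof. by case/andP. Qed.

Lemma top_le A a b : top A a -> b \in A -> (b <= a)%N.
Proof. by move=> /andP[_ /forall_inP]; apply. Qed.

Lemma top_uniq A a b : top A a -> top A b -> a = b.
Proof.
move=> ta tb; apply: val_inj; apply/eqP; rewrite eqn_leq.
by rewrite (top_le tb (top_in ta)) (top_le ta (top_in tb)).
Qed.

Lemma top_exists A : A != finset.set0 -> exists a, top A a.
Proof.
move=> /finset.set0Pn[a0 a0A]; pose f (a : 'I_n.+1) : nat := a.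
case: (@arg_maxnP _ a0 (mem A) f a0A) => a aA am; exists a.
by apply/andP; split => //; apply/forall_inP => b /am.
Qed.

Lemma normr_walsh A c : `|walsh A c| = 1.
Proof.
by rewrite normr_prod big1 // => a _; rewrite normr_sgb.
Qed.

(** The product of the factors [1 + w_a (c') w_a (c)] vanishes unless [c' = c]. *)
Lemma walsh_complete (g : point n.+1 -> R) c :
  g c = \sum_A avg (fun c' => g c' * walsh A c') * walsh A c.
Proof.
have kernelE c' : \sum_A walsh A c' * walsh A c = 2 ^+ n.+1 * (c' == c)%:R.
  transitivity (\prod_(a < n.+1) (sg R (c' a) * sg R (c a) + 1)).
    rewrite bigA_distr; apply: eq_bigr => A _.
    rewrite /walsh -big_split /= big_mkcond; apply: eq_bigr => a _.
    by case: ifP.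
  case: eqP => [->|/eqP cc'].
    under eq_bigr do rewrite sg_sqr.
    by rewrite prodr_const card_ord mulr1.
  have [a ca] : exists a, c' a != c a.
    apply/existsP; apply: contraR cc'; rewrite negb_exists => /forallP H.
    by apply/eqP/ffunP => a; apply/eqP; have := H a; rewrite negbK.
  rewrite (bigD1 a) //= mulr0; move: ca.
  by case: (c' a) (c a) => -[] // _; rewrite /sg expr0 expr1 ?mulN1r ?mulrN1 ?mul1r addNr mul0r.
under eq_bigr do rewrite -avgZr.
rewrite -avg_sum; under eq_avg => c'.
  under eq_bigr do rewrite -mulrA.
  rewrite -mulr_sumr kernelE; over.
rewrite /avg (bigD1 c) //= eqxx mulr1 big1 => [|c' /negPf ->]; last by rewrite !mulr0.
by rewrite addr0 card_point natrX mulfK // expf_neq0 ?pnatr_eq0.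
Qed.

(** The Haar coefficients of a Walsh function live on the level of the largest
    element of [A]. *)
Definition walsh_coef A : interval n -> R := fun I =>
  (top A (lev I))%:R * walsh A (of_bits n.+1 (leftmost I)).

Lemma haar_sum_walsh A c : A != finset.set0 -> haar_sum (walsh_coef A) (bits c) = walsh A c.
Proof.
move=> /top_exists[a ta]; rewrite /haar_sum (bigD1 a) //= big1 => [|b ba]; last first.
  rewrite /walsh_coef lev_branch (_ : top A b = false) ?mul0r //.
  by apply: contraNF ba => tb; rewrite (top_uniq ta tb).
rewrite addr0 /walsh_coef lev_branch ta mul1r /walsh (bigD1 a) ?(top_in ta) //=.
rewrite ffunE leftmost_out // mul1r [RHS](bigD1 a) ?(top_in ta) //= mulrC bits_ord.
congr (_ * _); apply: eq_bigr => b /andP[bA ba]; congr sg.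
rewrite ffunE leftmost_branch ?bits_ord // ltn_neqAle (top_le ta bA) andbT.
exact: ba.
Qed.

Definition walsh_hat x A : R := \sum_I 2^-1 ^+ lev I * (x I * walsh_coef A I).

Lemma walsh_expansion x I : x I = \sum_(A | A != finset.set0) walsh_hat x A * walsh_coef A I.
Proof.
rewrite -{1}(coef_haar_sum x).
have -> : (fun c : point n.+1 => haar_sum x (bits c)) =
    fun c => haar_sum (fun I => \sum_(A | A != finset.set0) walsh_hat x A * walsh_coef A I) (bits c).
  apply/funext => c; rewrite (walsh_complete (fun c => haar_sum x (bits c))) (bigD1 finset.set0) //=.
  under eq_avg => c' do rewrite /walsh finset.big_set0 mulr1.
  rewrite avg_haar_sum mul0r add0r.
  transitivity (\sum_(A | A != finset.set0) walsh_hat x A * haar_sum (walsh_coef A) (bits c)).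
    apply: eq_bigr => A A0; rewrite haar_sum_walsh // /walsh_hat -avg_haar_sumM.
    by congr (_ * _); apply: eq_avg => c'; rewrite haar_sum_walsh.
  rewrite /haar_sum; under [RHS]eq_bigr do rewrite mulr_suml.
  rewrite exchange_big /=; apply: eq_bigr => A _.
  by rewrite mulr_sumr; apply: eq_bigr => k _; rewrite mulrA.
by rewrite coef_haar_sum.
Qed.

Lemma flat_walsh A : flat ([ffun=> false] : point 0) (walsh_coef A).
Proof.
have cw0 I : walsh_coef A I != 0 -> top A (lev I).
  by rewrite /walsh_coef; case: (top A _) => //; rewrite mul0r eqxx.
split=> //.
- by move=> I; rewrite normrM normr_walsh mulr1 normr_nat; case: (top _ _).
- by move=> I _; apply/ffunP => -[].
- by move=> b i j /cw0 ti /cw0 tj; apply: (top_uniq ti tj).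
Qed.

End Walsh.

(** Only the diagonal of the expanded square survives. *)
Lemma avg_sqr_ortho (R : realType) (W P : finType) (m : P -> R) (s : P -> W -> R)
    (D : pred P) :
  (forall p w, D p -> `|s p w| <= 1) ->
  (forall p q, D p -> D q -> p != q -> avg (fun w => s p w * s q w) = 0) ->
  (0 < #|W|)%N ->
  avg (fun w => (\sum_(p | D p) m p * s p w) ^+ 2) <= \sum_(p | D p) m p ^+ 2.
Proof.
move=> s1 so W0; under eq_avg => w.
  rewrite expr2 big_distrl /=; under eq_bigr do rewrite mulr_sumr; over.
rewrite avg_sum; apply: ler_sum => p Dp.
rewrite avg_sum (bigD1 p) //= big1 ?addr0 => [|q /andP[Dq qp]].
  under eq_avg => w do rewrite mulrACA.
  rewrite avgZ -expr2 -[leRHS]mulr1 ler_wpM2l ?sqr_ge0 //.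
  rewrite -(avg_cst 1 W0); apply: ler_avg => w.
  rewrite -expr2 -real_normK ?num_real //.
  by rewrite expr_le1 // s1.
under eq_avg => w do rewrite mulrACA.
by rewrite avgZ so ?mulr0 // eq_sym.
Qed.

Section RandomSigns.
Context (R : realType) (M n : nat) (lab : interval M -> option 'I_n.+1).
Hypothesis labT : tower lab.
Implicit Types (A B : {set 'I_n.+1}) (K L : interval M)
  (z : {ffun interval M -> bool}).

Definition labtop A K : bool := if lab K is Some a then top A a else false.

(** The fine Haar coefficients of the block Walsh function of [A]. *)
Definition block_walsh z A K : R :=
  (labtop A K)%:R * walsh R A (coin lab z (leftmost K) [ffun=> false]).

Lemma block_op_walsh z A K : block_op lab z (walsh_coef R A) K = block_walsh z A K.
Proof.
rewrite /block_op /block_walsh /labtop; case E: (lab K) => [a|]; last by rewrite mul0r.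
rewrite /walsh_coef lev_branch; case ta: (top A a); last by rewrite !mul0r mulr0.
rewrite !mul1r /walsh (bigD1 a) ?(top_in ta) //= ffunE leftmost_out // mul1r.
rewrite [RHS](bigD1 a) ?(top_in ta) //=.
have lK : lab (branch (lev K) (leftmost K)) = Some a by rewrite branch_leftmost.
rewrite (coin_some _ labT _ lK) branch_leftmost leftmost_out // addbF.
congr (_ * _); apply: eq_bigr => b /andP[bA ba]; congr sg.
rewrite ffunE leftmost_branch ?bits_ord // ltn_neqAle (top_le ta bA) andbT.
exact: ba.
Qed.

(** For [L] of level at most that of [K] this says that [L] contains [K]. *)
Definition on_leftmost L K : bool := branch (lev L) (leftmost K) == L.

Lemma on_leftmost_refl K : on_leftmost K K. Proof. by rewrite /on_leftmost branch_leftmost. Qed.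

Lemma on_leftmost_same L K a : lab L = Some a -> lab K = Some a -> on_leftmost L K -> L = K.
Proof.
move=> lL lK /eqP hL.
have e1 : lab (branch (lev L) (leftmost K)) = Some a by rewrite hL.
have e2 : lab (branch (lev K) (leftmost K)) = Some a by rewrite branch_leftmost.
by rewrite -hL (lab_uniq labT e1 e2) branch_leftmost.
Qed.

(** The effect on the coefficient at [K] of changing the random sign of [L]. *)
Definition flip_sign A L K : R :=
  if lab L is Some l then (if (l \in A) && on_leftmost L K then -1 else 1) else 1.

Lemma block_walsh_flip z A L K : lab L -> block_walsh (flip L z) A K = flip_sign A L K * block_walsh z A K.
Proof.
rewrite /flip_sign; case E: (lab L) => [l|] // _.
rewrite /block_walsh mulrCA; congr (_ * _).
set c0 := [ffun=> false].
have coinE a : coin lab (flip L z) (leftmost K) c0 a =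
    coin lab z (leftmost K) c0 a (+) ((a == l) && on_leftmost L K).
  case S: (selected lab (leftmost K) a) => [i|].
    have li := selectedP S; rewrite !(coin_some _ labT _ li) ffunE addbAC; congr (_ (+) _).
    apply/eqP/andP => [eqL|[/eqP al /eqP hL]].
      split; last by rewrite /on_leftmost -eqL lev_branch.
      by move: li; rewrite eqL E => -[->].
    rewrite al in li; rewrite -[RHS]hL (lab_uniq labT li (j := lev L)) //.
    by rewrite hL.
  rewrite !coin_none //; case: eqP => [al|_]; last by rewrite addbF.
  rewrite ffunE; apply/esym/negP => /eqP hL.
  have : lab (branch (lev L) (leftmost K)) = Some a by rewrite hL al.
  by move=> /(selected_some labT); rewrite S.
rewrite /walsh; case: (boolP ((l \in A) && on_leftmost L K)) => [/andP[lA hL]|/negbTE H].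
  rewrite (bigD1 l) //= [X in _ = _ * X](bigD1 l) //= coinE eqxx hL addbT sgbN mulN1r mulNr.
  congr (- (_ * _)); apply: eq_bigr => a /andP[_ /negPf al].
  by rewrite coinE al addbF.
rewrite mul1r; apply: eq_bigr => a aA; rewrite coinE.
by case: eqP => [al|_]; rewrite ?addbF // -al aA in H *; rewrite H addbF.
Qed.

Lemma normr_block_walsh z A K : `|block_walsh z A K| <= 1.
Proof.
by rewrite normrM normr_walsh mulr1 normr_nat; case: (labtop _ _).
Qed.

(** Flipping the sign of one interval [T] multiplies the product of four Walsh
    coefficients by the product of their individual sign changes. *)
Lemma avg_block_walsh4 T A B A' B' K L K' L' : lab T ->
  flip_sign A T K * flip_sign B T L * (flip_sign A' T K' * flip_sign B' T L') = -1 ->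
  avg (fun z => block_walsh z A K * block_walsh z B L * (block_walsh z A' K' * block_walsh z B' L')) = 0.
Proof.
move=> lT sE; apply: (avg_odd (@flip_inj _ T)) => z.
rewrite !block_walsh_flip // -[RHS]mulN1r -sE; ring.
Qed.

(** A sign whose label is at least the largest element of [A] affects no
    coefficient of the block Walsh function but its own. *)
Lemma flip_sign_top A T K a t : top A a -> lab K = Some a -> lab T = Some t ->
  (a <= t)%N -> flip_sign A T K = if T == K then -1 else 1.
Proof.
move=> ta lK lT at'; rewrite /flip_sign lT; case: eqP => [TK|TK].
  by rewrite -TK on_leftmost_refl andbT; move: lK; rewrite -TK lT => -[->]; rewrite top_in.
case: ifP => // /andP[tA hT]; case: TK.
have tE : t = a by apply: val_inj; apply/eqP; rewrite eqn_leq at' (top_le ta tA).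
by apply: (on_leftmost_same lT _ hT); rewrite lK tE.
Qed.

Lemma labtopP A K : reflect (exists2 a, lab K = Some a & top A a) (labtop A K).
Proof.
rewrite /labtop; apply: (iffP idP) => [|[a -> //]].
by case: (lab K) => // a ta; exists a.
Qed.

Lemma flip_sign_sqr A T K : flip_sign A T K * flip_sign A T K = 1.
Proof.
by rewrite /flip_sign; case: (lab T) => [l|]; rewrite ?mul1r //; case: ifP; rewrite ?mul1r ?mulrNN ?mul1r.
Qed.

(** For labels [a < b], the sign of [L] occurs once if [L] and [L'] differ, and
    otherwise the sign of [K] does, the factors from [L = L'] being squares. *)
Lemma ortho_distinct A B a b K L K' L' : top A a -> top B b -> (a < b)%N ->
  lab K = Some a -> lab L = Some b -> lab K' = Some a -> lab L' = Some b ->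
  (K, L) != (K', L') ->
  avg (fun z => block_walsh z A K * block_walsh z B L * (block_walsh z A K' * block_walsh z B L')) = 0.
Proof.
move=> ta tb ab lK lL lK' lL' neq.
case: (eqVneq L L') => [LL|LL].
  have KK : K != K' by apply: contraNneq neq => ->; rewrite LL.
  apply: (@avg_block_walsh4 K); rewrite ?lK // -LL mulrACA flip_sign_sqr mulr1.
  rewrite !(flip_sign_top ta _ lK) // eqxx (negPf KK); ring.
apply: (@avg_block_walsh4 L); rewrite ?lL //.
rewrite !(flip_sign_top tb _ lL) // !(flip_sign_top ta _ lL) ?(ltnW ab) //.
have ne U : lab U = Some a -> (L == U) = false.
  by move=> lU; apply/eqP => LU; move: lL; rewrite LU lU => -[eqab]; rewrite eqab ltnn in ab.
by rewrite (ne K) // (ne K') // eqxx (negPf LL); ring.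
Qed.

(** On one generation only the pairs [(K, L)] and [(L, K)] are correlated;
    ordering the intervals by [rk] separates them. *)
Lemma ortho_same (rk : interval M -> nat) A B a K L K' L' : injective rk ->
  top A a -> top B a ->
  lab K = Some a -> lab L = Some a -> lab K' = Some a -> lab L' = Some a ->
  (rk K < rk L)%N -> (rk K' < rk L')%N ->
  (K, L) != (K', L') ->
  avg (fun z => block_walsh z A K * block_walsh z B L * (block_walsh z A K' * block_walsh z B L')) = 0.
Proof.
move=> rk_inj ta tb lK lL lK' lL' KL KL' neq.
have use T : lab T = Some a ->
  (if T == K then -1 else 1) * (if T == L then -1 else 1) *
  ((if T == K' then -1 else 1) * (if T == L' then -1 else 1)) = -1 :> R ->
  avg (fun z => block_walsh z A K * block_walsh z B L * (block_walsh z A K' * block_walsh z B L')) = 0.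
  move=> lT sE; apply: (@avg_block_walsh4 T); first by rewrite lT.
  by rewrite !(flip_sign_top ta _ lT) // !(flip_sign_top tb _ lT).
have rkE U V : (U == V) = (rk U == rk V) by rewrite (inj_eq rk_inj).
case: (eqVneq K K') => [KK|KK].
  have LL : L != L' by apply: contraNneq neq => ->; rewrite KK.
  apply: (use L) => //; rewrite -KK eqxx (negPf LL) !rkE (gtn_eqF KL); ring.
case: (eqVneq K L') => [KLe|KLe].
  apply: (use K') => //; rewrite eqxx eq_sym (negPf KK) !rkE (ltn_eqF KL').
  by rewrite (@ltn_eqF (rk K') (rk L)) ?(ltn_trans KL') // -?KLe //; ring.
apply: (use K) => //; rewrite eqxx (negPf KK) (negPf KLe) rkE (ltn_eqF KL); ring.
Qed.

End RandomSigns.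

(** * Second moments over random signs *)

Lemma card_sets (T : finType) : #|{: {set T}}| = (2 ^ #|T|)%N.
Proof. by rewrite -[in RHS]cardsT -card_powerset powersetT cardsT. Qed.

Section SecondMoment.
Context (R : realType) (X : haar_system_space R) (kind : rademacher_kind).
Context (M n r : nat) (t : interval M -> interval M -> R) (Gam : R).
Context (lab : interval M -> option 'I_n.+1).
Implicit Types (A B : {set 'I_n.+1}) (K L : interval M) (a b : 'I_n.+1)
  (z : {ffun interval M -> bool}).

Hypothesis Gam0 : 0 <= Gam.
Hypothesis mxact_bounded : forall y, hnorm X kind (mxact t y) <= Gam * hnorm X kind y.
Hypothesis rM : (2 * r <= M.+1)%N.
Hypothesis labT : tower lab.
Hypothesis lab_lev : forall K, lab K -> (2 * r <= lev K)%N.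

Notation entry := (entry t).
Notation form := (form t).
Notation bw := (block_walsh R lab).

Let G a : pred (interval M) := fun K => lab K == Some a.

Let G_anti a : antichain (2 * r) (G a).
Proof.
split=> [K /eqP lK|b i j /eqP li /eqP lj]; first by apply: lab_lev; rewrite lK.
exact: (lab_uniq labT li lj).
Qed.

Let block_walsh0 z A a K : top A a -> lab K != Some a -> bw z A K = 0.
Proof.
move=> ta lK; rewrite /block_walsh (_ : labtop lab A K = false) ?mul0r //.
apply: contraNF lK => /labtopP[a' -> ta'].
by rewrite (top_uniq ta ta').
Qed.

Let D a b : pred (interval M * interval M) := fun p => G a p.1 && G b p.2.

Let form_pairs z A B a b : top A a -> top B b ->
  form (bw z A) (bw z B) =
  \sum_(p | D a b p) entry p.1 p.2 * (bw z A p.1 * bw z B p.2).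
Proof.
move=> ta tb; rewrite form_entries pair_bigA /= [RHS]big_mkcond.
apply: eq_bigr => -[K L] _ /=; rewrite /D /G /=.
case: eqP => [_|/eqP lK]; last by rewrite (block_walsh0 z ta lK) !mul0r.
case: eqP => [_|/eqP lL]; last by rewrite (block_walsh0 z tb lL) mulr0.
by rewrite mulrAC mulrC.
Qed.

Let sum_pairs a b : \sum_(p | D a b p) entry p.1 p.2 ^+ 2 <= Gam ^+ 2 * 2^-1 ^+ r.
Proof.
rewrite -(pair_big (G a) (G b) (fun K L => entry K L ^+ 2)) /=.
exact: (entry_sqr_sum Gam0 mxact_bounded rM (G_anti a) (G_anti b)).
Qed.

Let sum_pairs_sub a b (E : pred (interval M * interval M)) :
  \sum_(p | D a b p && E p) entry p.1 p.2 ^+ 2 <= Gam ^+ 2 * 2^-1 ^+ r.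
Proof.
apply: le_trans (sum_pairs a b); rewrite big_mkcondr; apply: ler_sum => p _.
by case: ifP => // _; rewrite sqr_ge0.
Qed.

Let pair_le1 z A B K L : `|bw z A K * bw z B L| <= 1.
Proof. by rewrite normrM mulr_ile1 ?normr_block_walsh. Qed.

Lemma moment_distinct A B a b : top A a -> top B b -> a != b ->
  avg (fun z => form (bw z A) (bw z B) ^+ 2) <= Gam ^+ 2 * 2^-1 ^+ r.
Proof.
move=> ta tb ab; apply: le_trans (sum_pairs a b).
under eq_avg => z do rewrite (form_pairs z ta tb).
apply: (avg_sqr_ortho _ (s := fun p z => bw z A p.1 * bw z B p.2)).
- by move=> p z _; apply: pair_le1.
- move=> [K L] [K' L'] /= /andP[/eqP/= lK /eqP/= lL] /andP[/eqP/= lK' /eqP/= lL'] neq.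
  move: ab; rewrite -(inj_eq val_inj) neq_ltn => /orP[ab|ba].
    exact: (ortho_distinct R labT ta tb ab lK lL lK' lL').
  under eq_avg => z do rewrite mulrC [X in X * _]mulrC [X in _ * X]mulrC mulrC.
  apply: (ortho_distinct R labT tb ta ba lL lK lL' lK').
  by apply: contraNneq neq => -[-> ->].
- exact: card_signs.
Qed.

(** For [l] in exactly one of [A] and [B], the sign of the interval with label [l]
    around [K] decorrelates [K] from all [K'] outside this interval. Its level is
    at least [2 r], so what remains are pairs in one interval of level [2 r],
    where the diagonal sums are small. *)
Lemma moment_diag A B a : top A a -> top B a -> A != B ->
  avg (fun z => (\sum_(K | G a K) entry K K * (bw z A K * bw z B K)) ^+ 2)
  <= Gam ^+ 2 * 2^-1 ^+ r.
Proof.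
move=> ta tb AB.
pose q K := of_bits (2 * r) (leftmost K).
have corr K K' : G a K -> G a K' -> q K' != q K ->
    avg (fun z => bw z A K * bw z B K * (bw z A K' * bw z B K')) = 0.
  move=> /eqP lK /eqP lK' qq.
  have [l lAB] : exists l, (l \in A) != (l \in B).
    apply/existsP; apply: contraR AB; rewrite negb_exists => /forallP H.
    by apply/eqP/setP => l; apply/eqP; have := H l; rewrite negbK.
  have la : (l < a)%N.
    have la : (l <= a)%N.
      by case lA: (l \in A) lAB; [rewrite (top_le ta lA) | move=> /=;
        case lB: (l \in B) => // _; rewrite (top_le tb lB)].
    rewrite ltn_neqAle la andbT; apply: contraNneq lAB => /val_inj ->.
    by rewrite (top_in ta) (top_in tb).
  have lK2 : lab (branch (lev K) (leftmost K)) = Some a by rewrite branch_leftmost.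
  have [i li] := tower_nested labT lK2 la.
  apply: (@avg_block_walsh4 _ _ _ _ labT (branch i (leftmost K))); first by rewrite li.
  have hK : on_leftmost (branch i (leftmost K)) K by rewrite /on_leftmost lev_branch.
  have hK' : on_leftmost (branch i (leftmost K)) K' = false.
    apply/negP => /eqP; rewrite lev_branch => /eq_branch eqr.
    case/eqP : qq; apply/ffunP => j; rewrite !ffunE eqr //.
    apply: leq_trans (ltn_ord j) _.
    by have := lab_lev (K := branch i (leftmost K)); rewrite li lev_branch; apply.
  rewrite /flip_sign li hK hK' !andbT !andbF.
  by move: lAB; case: (l \in A) (l \in B) => -[] //= _; ring.
have corr_le K K' : G a K -> G a K' ->
    `|avg (fun z => bw z A K * bw z B K * (bw z A K' * bw z B K'))|
    <= (q K' == q K)%:R.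
  move=> GK GK'; case: (eqVneq (q K') (q K)) => [_|qq]; last by rewrite corr ?normr0.
  apply: le_trans (normr_avg _) _.
  rewrite -(avg_cst (1 : R) (card_signs (interval M))); apply: ler_avg => z.
  by rewrite normrM mulr_ile1 ?pair_le1.
apply: le_trans (_ : \sum_(K | G a K) `|entry K K| * (Gam * 2^-1 ^+ (2 * r)) <= _).
  under eq_avg => z.
    rewrite expr2 big_distrl /=; under eq_bigr do rewrite mulr_sumr; over.
  rewrite avg_sum; apply: ler_sum => K GK; rewrite avg_sum.
  apply: le_trans (_ : \sum_(K' | G a K')
      `|entry K K| * (`|entry K' K'| * (q K' == q K)%:R) <= _).
    apply: ler_sum => K' GK'.
    under eq_avg => z do rewrite mulrACA.
    rewrite avgZ; apply: le_trans (ler_norm _) _.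
    rewrite [leLHS]normrM [X in X * _]normrM -mulrA !ler_wpM2l //.
    exact: corr_le.
  rewrite -mulr_sumr ler_wpM2l //.
  apply: le_trans (diag_abs_sum_in Gam0 mxact_bounded (q K) rM (G_anti a)).
  rewrite [leRHS]big_mkcondr; apply: ler_sum => K' _.
  by rewrite /q; case: eqP; rewrite ?mulr1 ?mulr0.
rewrite -mulr_suml expr2 -mulrA.
apply: le_trans (_ : Gam * (Gam * 2^-1 ^+ (2 * r)) <= _).
  rewrite ler_wpM2r ?mulr_ge0 ?exprn_ge0 //.
  exact: (diag_abs_sum Gam0 mxact_bounded rM (G_anti a)).
rewrite !ler_wpM2l //; apply: ler_wiXn2l; rewrite ?invr_ge0 ?invf_le1 ?ler1n //.
by rewrite mul2n -addnn leq_addr.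
Qed.

Lemma moment_upper A B a (rk : interval M -> nat) : injective rk ->
  top A a -> top B a ->
  avg (fun z => (\sum_(p | D a a p && (rk p.1 < rk p.2)%N)
    entry p.1 p.2 * (bw z A p.1 * bw z B p.2)) ^+ 2) <= Gam ^+ 2 * 2^-1 ^+ r.
Proof.
move=> rk_inj ta tb; apply: le_trans (sum_pairs_sub a a _).
apply: (avg_sqr_ortho _ (s := fun p z => bw z A p.1 * bw z B p.2)).
- by move=> p z _; apply: pair_le1.
- move=> [K L] [K' L'] /= /andP[/andP[/eqP/= lK /eqP/= lL] KL].
  move=> /andP[/andP[/eqP/= lK' /eqP/= lL'] KL'] neq.
  exact: (ortho_same R labT rk_inj ta tb lK lL lK' lL' KL KL' neq).
- exact: card_signs.
Qed.

Lemma moment_lower A B a (rk : interval M -> nat) : injective rk ->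
  top A a -> top B a ->
  avg (fun z => (\sum_(p | D a a p && (rk p.2 < rk p.1)%N)
    entry p.1 p.2 * (bw z A p.1 * bw z B p.2)) ^+ 2) <= Gam ^+ 2 * 2^-1 ^+ r.
Proof.
move=> rk_inj ta tb; apply: le_trans (sum_pairs_sub a a _).
apply: (avg_sqr_ortho _ (s := fun p z => bw z A p.1 * bw z B p.2)).
- by move=> p z _; apply: pair_le1.
- move=> [K L] [K' L'] /= /andP[/andP[/eqP/= lK /eqP/= lL] KL].
  move=> /andP[/andP[/eqP/= lK' /eqP/= lL'] KL'] neq.
  under eq_avg => z do rewrite mulrC [X in X * _]mulrC [X in _ * X]mulrC mulrC.
  apply: (ortho_same R labT rk_inj tb ta lL lK lL' lK' KL KL').
  by apply: contraNneq neq => -[-> ->].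
- exact: card_signs.
Qed.

Definition dsum A : R := \sum_(K | labtop lab A K) entry K K.

Lemma second_moment A B : A != finset.set0 -> B != finset.set0 ->
  avg (fun z => (form (bw z A) (bw z B) - (A == B)%:R * dsum A) ^+ 2)
  <= 9 * (Gam ^+ 2 * 2^-1 ^+ r).
Proof.
move=> /top_exists[a ta] /top_exists[b tb].
set s := Gam ^+ 2 * 2^-1 ^+ r.
have s0 : 0 <= s by rewrite mulr_ge0 ?sqr_ge0 ?exprn_ge0.
case: (eqVneq a b) => [ab|ab]; last first.
  have -> : (A == B) = false.
    by apply: contraNF ab => /eqP AB; rewrite AB in ta; rewrite (top_uniq ta tb).
  under eq_avg => z do rewrite mul0r subr0.
  by apply: le_trans (moment_distinct ta tb ab) _; rewrite -/s; lra.
rewrite -{}ab in tb.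
(* Any linear order will do: it splits the form into the pairs above the diagonal,
   below the diagonal and on it. *)
pose rk (K : interval M) : nat := enum_rank K.
have rk_inj : injective rk by move=> K L /val_inj /enum_rank_inj.
pose U z := \sum_(p | D a a p && (rk p.1 < rk p.2)%N)
    entry p.1 p.2 * (bw z A p.1 * bw z B p.2).
pose V z := \sum_(p | D a a p && (rk p.2 < rk p.1)%N)
    entry p.1 p.2 * (bw z A p.1 * bw z B p.2).
pose Q z := \sum_(K | G a K) entry K K * (bw z A K * bw z B K).
have formE z : form (bw z A) (bw z B) = U z + V z + Q z.
  rewrite (form_pairs z ta tb) (bigID (fun p => (rk p.1 < rk p.2)%N)) /= -addrA.
  congr (_ + _); rewrite (bigID (fun p => (rk p.2 < rk p.1)%N)) /=; congr (_ + _).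
    apply: eq_bigl => p; case: (D a a p) => //=.
    by case: ltngtP.
  rewrite (eq_bigl (fun p => (G a p.1) && (p.2 == p.1))); last first.
    move=> [K L]; rewrite /D /=.
    have -> : (L == K) = (rk L == rk K) by rewrite (inj_eq rk_inj).
    case: ltngtP => /= [| |eqr]; rewrite ?andbF ?andbT //.
    by rewrite (rk_inj _ _ eqr) andbb.
  rewrite -(pair_big_dep (G a) (fun K L => L == K)
    (fun K L => entry K L * (bw z A K * bw z B L))) /=.
  by apply: eq_bigr => K _; rewrite big_pred1_eq.
pose Q' z := Q z - (A == B)%:R * dsum A.
have Q'_le : avg (fun z => Q' z ^+ 2) <= s.
  case: (eqVneq A B) => [AB|AB]; last first.
    under eq_avg => z do rewrite /Q' (negPf AB) mul0r subr0.
    exact: moment_diag.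
  rewrite (@eq_avg _ _ _ (fun=> 0)) ?avg_cst ?card_signs // => z.
  rewrite /Q' AB eqxx mul1r (_ : Q z = dsum B) ?subrr ?expr0n //.
  rewrite /Q /dsum; apply: eq_big => [K|K /eqP lK].
    rewrite /G; apply/eqP/labtopP => [lK|[a' -> ta']]; first by exists a.
    by rewrite (top_uniq ta' tb).
  rewrite AB /block_walsh (_ : labtop lab B K) ?mul1r; last by apply/labtopP; exists a.
  by rewrite -expr2 -real_normK ?num_real // normr_walsh expr1n mulr1.
apply: le_trans (_ : avg (fun z => 3 * (U z ^+ 2) + (3 * (V z ^+ 2) + 3 * (Q' z ^+ 2))) <= _).
  apply: ler_avg => z; rewrite formE -addrA -/(Q' z).
  have : 0 <= (U z - V z) ^+ 2 + (U z - Q' z) ^+ 2 + (V z - Q' z) ^+ 2.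
    by rewrite !addr_ge0 ?sqr_ge0.
  nra.
have U_le : avg (fun z => U z ^+ 2) <= s := moment_upper rk_inj ta tb.
have V_le : avg (fun z => V z ^+ 2) <= s := moment_lower rk_inj ta tb.
rewrite !avgD !avgZ; lra.
Qed.

Lemma good_signs : exists z, forall A B, A != finset.set0 -> B != finset.set0 ->
  (form (bw z A) (bw z B) - (A == B)%:R * dsum A) ^+ 2 <=
  4 ^+ n.+1 * (9 * (Gam ^+ 2 * 2^-1 ^+ r)).
Proof.
pose F (p : {set 'I_n.+1} * {set 'I_n.+1}) z :=
  (form (bw z p.1) (bw z p.2) - (p.1 == p.2)%:R * dsum p.1) ^+ 2.
pose E (p : {set 'I_n.+1} * {set 'I_n.+1}) :=
  (p.1 != finset.set0) && (p.2 != finset.set0).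
have [z zE] := avg_exists (fun z => \sum_(p | E p) F p z) (card_signs _).
exists z => A B A0 B0.
apply: le_trans (_ : \sum_(p | E p) F p z <= _).
  rewrite (bigD1 (A, B)) /=; last by rewrite /E /= A0 B0.
  by rewrite lerDl sumr_ge0 // => p _; rewrite sqr_ge0.
apply: le_trans zE _; rewrite avg_sum.
apply: le_trans (_ : \sum_(p | E p) 9 * (Gam ^+ 2 * 2^-1 ^+ r) <= _).
  by apply: ler_sum => -[A' B'] /andP[A0' B0']; apply: second_moment.
rewrite sumr_const -[_ *+ _]mulr_natl ler_wpM2r //.
  by rewrite !mulr_ge0 ?sqr_ge0 ?exprn_ge0.
rewrite -(natrX _ 4) ler_nat.
apply: leq_trans (max_card _) _.
by rewrite card_prod card_sets card_ord -expnMn.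
Qed.

End SecondMoment.

(** * Generations of intervals of one sign *)

Section Generations.
Context (M : nat) (pos : pred (interval M)).
Implicit Types (b : nat -> bool) (K : interval M).

Definition npos b (k : nat) : nat := (\sum_(i < M.+1 | (i < k)%N) pos (branch i b))%N.

Lemma nposS b (k : 'I_M.+1) : npos b k.+1 = (npos b k + pos (branch k b))%N.
Proof.
rewrite /npos (bigD1 k) ?ltnSn //= addnC; congr (_ + _)%N.
by apply: eq_bigl => i; rewrite ltnS ltn_neqAle -(inj_eq val_inj) andbC.
Qed.

Lemma leq_npos b k l : (k <= l)%N -> (npos b k <= npos b l)%N.
Proof.
move=> kl; rewrite /npos big_mkcond [leqRHS]big_mkcond; apply: leq_sum => i _.
by case: ifP => // ik; rewrite (leq_trans ik).
Qed.

Lemma ltn_npos b (k : 'I_M.+1) l : pos (branch k b) -> (k < l)%N ->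
  (npos b k < npos b l)%N.
Proof.
move=> pk kl; apply: leq_trans (leq_npos b kl).
by rewrite nposS pk addn1.
Qed.

Lemma npos_hit b l j : (l <= M.+1)%N -> (j < npos b l)%N ->
  exists k : 'I_M.+1, [/\ (k < l)%N, pos (branch k b) & npos b k = j].
Proof.
elim: l => [|l IHl] lM; first by rewrite /npos big_pred0.
pose k := Ordinal lM; rewrite (nposS b k) /=.
case: (ltnP j (npos b l)) => [jl _|lj].
  by have [i [il pi ei]] := IHl (ltnW lM) jl; exists i; split => //; apply: ltnW.
case E: (pos (branch k b)); rewrite ?addn0 ?addn1; last by rewrite ltnNge lj.
by rewrite ltnS => jl; exists k; split => //=; apply/eqP; rewrite eqn_leq lj.
Qed.

Lemma npos_leftmost b (k : 'I_M.+1) : npos (leftmost (branch k b)) k = npos b k.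
Proof.
apply: eq_bigr => i ik; congr (nat_of_bool (pos _)); apply/eq_branch => l li.
by rewrite leftmost_branch // (ltn_trans li).
Qed.

(** Generations count the marked intervals that contain [K] strictly. *)
Definition gen K : nat := npos (leftmost K) (lev K).

Definition generation (j : nat) : pred (interval M) :=
  fun K => pos K && (gen K == j).

Lemma gen_branch b k : gen (branch k b) = npos b k.
Proof. exact: npos_leftmost. Qed.

Section Labels.
Context (n : nat) (js : 'I_n.+1 -> nat).
Hypothesis js_mono : forall a a', (js a < js a')%N = (a < a')%N.

Definition gen_label K : option 'I_n.+1 :=
  if pos K then [pick a | js a == gen K] else None.

Lemma gen_labelE K a : gen_label K = Some a <-> generation (js a) K.
Proof.
have js_inj a1 a2 : js a1 = js a2 -> a1 = a2.
  move=> eqj; apply: val_inj => /=.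
  by have := js_mono a1 a2; have := js_mono a2 a1; rewrite eqj ltnn; case: ltngtP.
rewrite /gen_label /generation; case: (pos K) => //=.
case: pickP => [a' /eqP ja'|no]; split => //.
- by move=> [<-]; rewrite ja'.
- by rewrite -ja' => /eqP /js_inj ->.
- by move=> /eqP ga; have := no a; rewrite ga eqxx.
Qed.

(** An increasing selection of generations is a tower, because on each branch the
    count of marked intervals grows by steps of one. *)
Lemma tower_generations : tower gen_label.
Proof.
split=> [b i j a a' /gen_labelE/andP[pi /eqP gi] /gen_labelE/andP[pj /eqP gj]|
         b j a a' /gen_labelE/andP[pj /eqP gj] aa'].
  rewrite -js_mono -gi -gj !gen_branch; case: (ltnP i j) => ij.
    by rewrite ltn_npos.
  by apply/esym/negbTE; rewrite -leqNgt leq_npos.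
have : (js a < npos b j)%N by rewrite -gen_branch gj js_mono.
move=> /(npos_hit (ltnW (ltn_ord j)))[k [_ pk ek]].
by exists k; apply/gen_labelE; rewrite /generation pk gen_branch ek eqxx.
Qed.

End Labels.
End Generations.

Lemma pigeonhole_fibre (m B n : nat) (f : nat -> nat) :
  (forall j, (j < m)%N -> (f j < B)%N) -> (n * B < m)%N ->
  exists v, (n < size [seq j <- iota 0 m | f j == v])%N.
Proof.
move=> fB nBm; apply: contrapT => /forallNP H.
have {}H v : (count (fun j => f j == v) (iota 0 m) <= n)%N.
  by rewrite -size_filter leqNgt; apply/negP/H.
suff : (m <= n * B)%N by rewrite leqNgt nBm.
have -> : m = (\sum_(v < B) count (fun j => f j == v) (iota 0 m))%N.
  rewrite -[LHS](size_iota 0 m) -sum1_size.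
  under [RHS]eq_bigr do rewrite -sum1_count.
  rewrite (exchange_big_dep predT) //= big_seq [RHS]big_seq; apply: eq_bigr => j.
  rewrite mem_iota add0n => /andP[_ jm].
  by rewrite (big_pred1 (Ordinal (fB j jm))) // => v; rewrite -(inj_eq val_inj) eq_sym.
rewrite mulnC -[B in (B * _)%N](card_ord B) -sum_nat_const; apply: leq_sum => v _; exact: H.
Qed.

Section Selection.
Context (R : realType) (X : haar_system_space R) (kind : rademacher_kind).
Context (M : nat) (t : interval M -> interval M -> R) (Gam del : R).
Hypothesis Gam_gt0 : 0 < Gam.
Hypothesis del_gt0 : 0 < del.
Hypothesis t_bounded : forall y, hnorm X kind (mxact t y) <= Gam * hnorm X kind y.
Hypothesis t_diag : forall K, del <= `|t K K|.
Context (k0 : nat).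
Hypothesis k0M : (k0 < M.+1)%N.

Definition signed (s : bool) : interval M -> interval M -> R :=
  fun K L => sg R s * t K L.

Lemma signed_bounded s y : hnorm X kind (mxact (signed s) y) <= Gam * hnorm X kind y.
Proof.
rewrite (_ : mxact (signed s) y = fun K => sg R s * mxact t y K).
  by rewrite hnormZ normr_sgb mul1r.
apply/funext => K; rewrite /mxact mulr_sumr; apply: eq_bigr => L _.
by rewrite /signed mulrA.
Qed.

Definition pos_part (s : bool) : pred (interval M) :=
  fun K => (k0 <= lev K)%N && (0 < signed s K K).

Lemma pos_partC K : ((pos_part false K + pos_part true K)%N = (k0 <= lev K)%N)%N.
Proof.
rewrite /pos_part /signed /sg expr0 expr1 mul1r mulN1r oppr_gt0.
case: (k0 <= lev K)%N => //=.
have : t K K != 0 by rewrite -normr_gt0 (lt_le_trans del_gt0).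
by case: ltgtP.
Qed.

Notation npos_tot s b := (npos (pos_part s) b M.+1).

Lemma npos_total b : (npos_tot false b + npos_tot true b = M.+1 - k0)%N.
Proof.
rewrite /npos -big_split /=.
under eq_bigr => i _ do rewrite pos_partC lev_branch.
rewrite big_mkcond /=; under eq_bigr => i _ do rewrite ltn_ord.
rewrite -(big_mkord predT (fun i => nat_of_bool (k0 <= i)%N)).
rewrite (@big_cat_nat _ _ _ k0) //= 1?ltnW // big_nat_cond big1 ?add0n.
  rewrite big_nat_cond (eq_bigr (fun=> 1%N)); last by move=> i /andP[/andP[-> ]].
  by rewrite -big_nat_cond sum_nat_const_nat muln1.
by move=> i /andP[/andP[_ ik] _]; rewrite leqNgt ik.
Qed.

Let len : R := (M.+1 - k0)%N%:R.

Let len_gt0 : 0 < len.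
Proof. by rewrite ltr0n subn_gt0. Qed.

(** The measure of the set that each of the first [m] generations covers. *)
Definition reach (s : bool) (m : nat) : R :=
  avg (fun p : point M.+1 => (m <= npos_tot s (bits p))%N%:R).

(** Every branch meets [M + 1 - k0] intervals of level at least [k0], each of one
    of the two signs, so one sign occurs on average at least half of the time. *)
Lemma reach_half m : exists s, 1 / 2 - m%:R / len <= reach s m.
Proof.
pose E s := avg (fun p : point M.+1 => (npos_tot s (bits p))%:R : R).
have EE : E false + E true = len.
  rewrite -avgD -[RHS](@avg_cst _ (point M.+1)) ?card_point ?expn_gt0 //.
  by apply: eq_avg => p; rewrite -natrD npos_total.
have [s Es] : exists s, len / 2 <= E s.
  case: (lerP (len / 2) (E false)) => [h|h]; first by exists false.
  by exists true; lra.
exists s; rewrite lerBlDr -(ler_pM2l len_gt0) mulrDr [len * (m%:R / _)]mulrCA.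
rewrite divff ?gt_eqF // mulr1 mulrA mulr1; apply: le_trans Es _.
rewrite /reach -avgZ -[m%:R](@avg_cst _ (point M.+1)) ?card_point ?expn_gt0 //.
rewrite -avgD; apply: ler_avg => p; rewrite -natrM -natrD ler_nat.
case: (leqP m (npos_tot s (bits p))) => [_|/ltnW]; last by rewrite muln0 add0n.
rewrite muln1; apply: leq_trans (leq_addr _ _); rewrite -(npos_total (bits p)).
by case: s; rewrite ?leq_addl ?leq_addr.
Qed.

Definition gsum s j : R :=
  \sum_(K | generation (pos_part s) j K) entry (signed s) K K.

Lemma anti_generation s j : antichain k0 (generation (pos_part s) j).
Proof.
split=> [K /andP[/andP[]] //|b i i' /andP[pi /eqP gi] /andP[pi' /eqP gi']].
apply: val_inj => /=; case: (ltngtP i i') => // ii.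
  by have := ltn_npos pi ii; rewrite -!gen_branch gi gi' ltnn.
by have := ltn_npos pi' ii; rewrite -!gen_branch gi gi' ltnn.
Qed.

Lemma entry_pos s j K : generation (pos_part s) j K ->
  2^-1 ^+ lev K * del <= entry (signed s) K K.
Proof.
move=> /andP[/andP[_ tK] _]; rewrite /entry ler_wpM2l ?exprn_ge0 //.
rewrite -(ger0_norm (ltW tK)) /signed normrM normr_sgb mul1r.
exact: t_diag.
Qed.

Lemma gsum_le s j : gsum s j <= Gam.
Proof.
apply: le_trans (diag_abs_sum (ltW Gam_gt0) (signed_bounded s) (ltnW k0M)
  (anti_generation s j)).
by apply: ler_sum => K _; apply: ler_norm.
Qed.

Lemma gsum_ge0 s j : 0 <= gsum s j.
Proof.
apply: sumr_ge0 => K /entry_pos; apply: le_trans.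
by rewrite mulr_ge0 ?exprn_ge0 // ltW.
Qed.

Lemma gsum_ge s m j : (j < m)%N -> del * reach s m <= gsum s j.
Proof.
move=> jm; apply: le_trans (_ : \sum_(K | generation (pos_part s) j K)
    2^-1 ^+ lev K * del <= _); last by apply: ler_sum => K; apply: entry_pos.
rewrite -mulr_suml mulrC ler_wpM2r ?(ltW del_gt0) // big_mkcond.
rewrite (eq_bigr (fun K => avg (fun p : point M.+1 =>
    (generation (pos_part s) j K)%:R * (branch (lev K) (bits p) == K)%:R))); last first.
  by move=> K _; rewrite avgZ avg_branch; case: ifP; rewrite ?mul1r ?mul0r.
rewrite -avg_sum; apply: ler_avg => p; rewrite sum_branch.
case: leqP => [mp|_]; last by apply: sumr_ge0.
have [k [_ pk ek]] := npos_hit (leqnn _) (leq_trans jm mp).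
rewrite (bigD1 k) //= /generation pk gen_branch ek eqxx lerDl.
by apply: sumr_ge0.
Qed.

(** The sums over the first [m] generations lie in an interval of length [Gam];
    cutting it into [Q] parts, the pigeonhole principle selects [n + 1]
    generations with sums at distance at most [Gam / Q]. *)
Lemma selection (n m Q : nat) : (0 < Q)%N -> (n * Q.+1 < m)%N ->
  exists (s : bool) (lab : interval M -> option 'I_n.+1) (c : R),
  [/\ tower lab, forall K, lab K -> (k0 <= lev K)%N,
      del * (1 / 2 - m%:R / len) <= c &
      forall A, A != finset.set0 ->
        `|dsum (signed s) lab A - c| <= Gam / Q%:R].
Proof.
move=> Q0 nQm; have [s reach_s] := reach_half m.
have Q0R : 0 < (Q%:R : R) by rewrite ltr0n.
(* The value [gsum s j = Gam] falls into an extra part, hence [Q + 1] parts. *)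
pose bin j := Num.trunc (gsum s j * (Q%:R / Gam)).
have y0 j : 0 <= gsum s j * (Q%:R / Gam).
  by rewrite mulr_ge0 ?gsum_ge0 // divr_ge0 // ltW.
have bin_lt j : (j < m)%N -> (bin j < Q.+1)%N.
  move=> _; rewrite ltnS /bin -(ler_nat R).
  apply: le_trans (_ : gsum s j * (Q%:R / Gam) <= _).
    by have /andP[] := truncn_itv (y0 j).
  by rewrite mulrCA ler_piMr ?(ltW Q0R) // ler_pdivrMr // mul1r gsum_le.
have [v vn] := pigeonhole_fibre bin_lt nQm.
set sq := [seq j <- iota 0 m | bin j == v] in vn.
have sq_sorted : sorted ltn sq by apply: sorted_filter (iota_ltn_sorted _ _); exact: ltn_trans.
pose js (a : 'I_n.+1) := nth 0%N sq a.
have a_lt (a : 'I_n.+1) : (a < size sq)%N by apply: leq_trans (ltn_ord a) vn.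
have js_mono a a' : (js a < js a')%N = (a < a')%N.
  have lt (x y : 'I_n.+1) : (x < y)%N -> (js x < js y)%N.
    by move=> xy; apply: (sorted_ltn_nth ltn_trans); rewrite ?inE ?a_lt.
  case: (ltngtP a a') => [/lt //|/lt|/val_inj ->]; last by rewrite ltnn.
  by move=> h; apply/negbTE; rewrite -leqNgt ltnW.
have js_in a : (js a < m)%N && (bin (js a) == v).
  have : js a \in sq by rewrite mem_nth.
  by rewrite mem_filter mem_iota leq0n add0n andbC.
exists s, (gen_label (pos_part s) js), (gsum s (js ord0)); split.
- exact: tower_generations.
- move=> K; case E: (gen_label _ _ K) => [a|] // _.
  by move/(gen_labelE _ js_mono): E => /andP[/andP[]].
- have /andP[j0 _] := js_in ord0.
  by apply: le_trans (gsum_ge s j0); rewrite ler_wpM2l // ltW.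
- move=> A /top_exists[a ta].
  have -> : dsum (signed s) (gen_label (pos_part s) js) A = gsum s (js a).
    apply: eq_bigl => K; apply/labtopP/idP => [[a' /(gen_labelE _ js_mono) h ta']|h].
      by rewrite (top_uniq ta ta').
    by exists a => //; apply/(gen_labelE _ js_mono).
  have /andP[_ /eqP ba] := js_in a; have /andP[_ /eqP b0] := js_in ord0.
  have /andP[a1 a2] := truncn_itv (y0 (js a)).
  have /andP[c1 c2] := truncn_itv (y0 (js ord0)).
  rewrite -/(bin _) ba in a1 a2; rewrite -/(bin _) b0 in c1 c2.
  rewrite -natr1 in a2; rewrite -natr1 in c2.
  rewrite ler_pdivlMr // -(ler_pM2r (x := Gam^-1)) ?invr_gt0 // divff ?gt_eqF //.
  rewrite -mulrA -[Q%:R / Gam]ger0_norm ?divr_ge0 ?(ltW Gam_gt0) // -normrM mulrBl.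
  by rewrite ler_norml; apply/andP; split; lra.
Qed.

End Selection.

(** * Compression to a nearly scalar operator *)

Section NearScalar.
Context (R : realType) (X : haar_system_space R) (kind : rademacher_kind).
Context (M n : nat) (t : interval M -> interval M -> R).
Context (lab : interval M -> option 'I_n.+1) (z : {ffun interval M -> bool}).
Hypothesis labT : tower lab.
Implicit Types (x : interval n -> R) (A B : {set 'I_n.+1}).

Notation B := (block_op lab z).
Notation Bt := (block_adj lab z).
Notation bw := (block_walsh R lab z).

Lemma block_op_expansion x K :
  B x K = \sum_(A | A != finset.set0) walsh_hat x A * bw A K.
Proof.
under eq_bigr do rewrite -block_op_walsh //.
rewrite /block_op; case: (lab K) => [a|]; last by rewrite big1 // => A _; rewrite mulr0.
by rewrite walsh_expansion mulr_sumr; apply: eq_bigr => A _; rewrite mulrCA.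
Qed.

Lemma form_block_op y x : form t y (B x) =
  \sum_(A | A != finset.set0) walsh_hat x A * form t y (bw A).
Proof.
rewrite form_entries; under [RHS]eq_bigr do rewrite form_entries mulr_sumr.
rewrite [RHS]exchange_big; apply: eq_bigr => K _ /=.
under [RHS]eq_bigr do rewrite mulr_sumr.
rewrite [RHS]exchange_big; apply: eq_bigr => L _ /=.
by rewrite block_op_expansion mulr_sumr; apply: eq_bigr => A _; rewrite mulrCA.
Qed.

Lemma walsh_hat_compression x A : A != finset.set0 ->
  walsh_hat (Bt (mxact t (B x))) A = form t (bw A) (B x).
Proof.
move=> A0; rewrite /walsh_hat; under eq_bigr do rewrite [_ * walsh_coef _ _ _]mulrC.
rewrite block_adj_pairing /form; apply: eq_bigr => K _.
by rewrite block_op_walsh.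
Qed.

Lemma walsh_hat_le x A : `|walsh_hat x A| <= hnorm X kind x.
Proof.
rewrite /walsh_hat; under eq_bigr do rewrite [_ * walsh_coef _ _ _]mulrC.
exact: flat_dual_le (flat_walsh R A).
Qed.

Lemma walsh_hatB (c : R) x y A :
  walsh_hat (fun I => y I - c * x I) A = walsh_hat y A - c * walsh_hat x A.
Proof.
rewrite /walsh_hat mulr_sumr -sumrB; apply: eq_bigr => I _.
by rewrite mulrBl mulrBr; congr (_ - _); ring.
Qed.

(** Walsh functions have norm at most one, in the section and as functionals; so
    a matrix in the Walsh basis is bounded by the sum of its entries. *)
Lemma near_scalar (c k : R) x : 0 <= k ->
  (forall A A', A != finset.set0 -> A' != finset.set0 ->
     `|form t (bw A) (bw A') - (A == A')%:R * c| <= k) ->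
  hnorm X kind (fun I => Bt (mxact t (B x)) I - c * x I) <= 4 ^+ n.+1 * k * hnorm X kind x.
Proof.
move=> k0 near; set y := fun I => _.
have what_y A : A != finset.set0 -> `|walsh_hat y A| <= 2 ^+ n.+1 * k * hnorm X kind x.
  move=> A0; rewrite /y walsh_hatB walsh_hat_compression // form_block_op.
  have -> : c * walsh_hat x A =
      \sum_(A' | A' != finset.set0) walsh_hat x A' * ((A == A')%:R * c).
    rewrite (bigD1 A) //= eqxx mul1r big1 ?addr0 1?mulrC // => A' /andP[_].
    by rewrite eq_sym => /negPf ->; rewrite mul0r mulr0.
  rewrite -sumrB; apply: le_trans (ler_norm_sum _ _ _) _.
  apply: le_trans (_ : \sum_(A' : {set 'I_n.+1} | A' != finset.set0)
      k * hnorm X kind x <= _).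
    apply: ler_sum => A' A'0; rewrite -mulrBr normrM mulrC ler_pM //.
      exact: near.
    exact: walsh_hat_le.
  rewrite sumr_const -[_ *+ _]mulr_natl mulrA ler_wpM2r ?hnorm_ge0 // ler_wpM2r //.
  rewrite -natrX ler_nat; apply: leq_trans (max_card _) _.
  by rewrite card_sets card_ord.
rewrite (_ : hnorm X kind y =
    hnorm X kind (fun I => \sum_(A | A != finset.set0) walsh_hat y A * walsh_coef R A I)); last first.
  by congr hnorm; apply/funext => I; rewrite walsh_expansion.
under [X in hnorm _ _ X]eq_fun do rewrite -big_filter.
apply: le_trans (hnorm_sum _ _ _ _) _; rewrite big_filter.
apply: le_trans (_ : \sum_(A : {set 'I_n.+1} | A != finset.set0)
    2 ^+ n.+1 * k * hnorm X kind x <= _).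
  apply: ler_sum => A A0; rewrite hnormZ -[leRHS]mulr1 ler_pM ?hnorm_ge0 //.
    exact: what_y.
  exact: hnorm_flat_le1 (flat_walsh R A).
rewrite sumr_const -[_ *+ _]mulr_natl !mulrA ler_wpM2r ?hnorm_ge0 // ler_wpM2r //.
have -> : (4 : R) ^+ n.+1 = 2 ^+ n.+1 * 2 ^+ n.+1.
  by rewrite -exprMn; congr (_ ^+ _); ring.
rewrite ler_wpM2r ?exprn_ge0 // -natrX ler_nat; apply: leq_trans (max_card _) _.
by rewrite card_sets card_ord.
Qed.

End NearScalar.

Section CoefficientFactorization.
Context (R : realType) (X : haar_system_space R) (kind : rademacher_kind).
Context (M n b : nat) (t : interval M -> interval M -> R) (Gam del eps : R).
Hypothesis Gam_gt0 : 0 < Gam.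
Hypothesis del_gt0 : 0 < del.
Hypothesis eps_gt0 : 0 < eps.
Hypothesis t_bounded : forall y, hnorm X kind (mxact t y) <= Gam * hnorm X kind y.
Hypothesis t_diag : forall K, del <= `|t K K|.
Hypothesis b_large : 12 * (1 + eps) ^+ 2 * Gam / (eps * del) <= 2 ^+ b.
Hypothesis M_large : (2 ^ (2 * b + 4 * n + 10) <= M)%N.

Lemma diag_le K : `|entry t K K| <= Gam.
Proof.
have anti : antichain 0 (pred1 K).
  by split=> // B i j /eqP <- /eqP /(congr1 (@lev M)); rewrite !lev_branch.
have := diag_abs_sum (ltW Gam_gt0) t_bounded (leq0n _) anti.
by rewrite big_pred1_eq.
Qed.

Lemma del_le_Gam : del <= Gam.
Proof.
have := diag_le (branch ord0 (fun=> false)); rewrite /entry lev_branch expr0 mul1r.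
exact: le_trans (t_diag _).
Qed.

(** [Q] makes [4 ^ (n + 1) * Gam / Q] equal to [Gam / 2 ^ b], where [4 ^ (n + 1)]
    bounds the number of Walsh entries; [m] generations suffice for the pigeonhole
    principle with [Q + 1] parts; and [r] makes the root of the sum of all
    second moments at most [Gam / Q]. *)
Let Q := (2 ^ (b + 2 * n + 2))%N.
Let m := (n * Q.+1).+1.
Let r := (2 * b + 6 * n + 10)%N.

Let room : (2 * r + m * 2 ^ b <= M)%N.
Proof.
apply: leq_trans M_large.
have Q1 : (0 < Q)%N by rewrite expn_gt0.
have nn : (n < 2 ^ n)%N := ltn_expl n (ltnSn 1).
have bn : (2 * b + 4 * n < 2 ^ (2 * b + 4 * n))%N by apply: ltn_expl.
have m_le : (m <= 2 ^ (b + 3 * n + 3))%N.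
  have -> : (2 ^ (b + 3 * n + 3) = 2 ^ n * (2 * Q))%N.
    by rewrite -expnS -expnD; congr (2 ^ _)%N; lia.
  apply: leq_trans (_ : (n.+1 * (2 * Q) <= _)%N); last by rewrite leq_mul2r nn orbT.
  by rewrite /m; nia.
have mb : (m * 2 ^ b <= 2 ^ (2 * b + 4 * n + 3))%N.
  apply: leq_trans (_ : (2 ^ (b + 3 * n + 3) * 2 ^ b <= _)%N).
    by rewrite leq_mul2r m_le orbT.
  by rewrite -expnD leq_exp2l //; lia.
have e3 : (2 ^ (2 * b + 4 * n + 3) = 8 * 2 ^ (2 * b + 4 * n))%N by rewrite expnD mulnC.
have e10 : (2 ^ (2 * b + 4 * n + 10) = 1024 * 2 ^ (2 * b + 4 * n))%N.
  by rewrite expnD mulnC.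
rewrite e3 in mb; rewrite e10 /r.
move: mb bn; set u := (2 ^ (2 * b + 4 * n))%N; set v := (m * 2 ^ b)%N.
lia.
Qed.

(** [Bc] and [Ac] are the block embedding and its adjoint; the lower bound says
    that the compressed operator is invertible with the required constant. *)
Lemma coef_factorization : exists (Bc : (interval n -> R) -> (interval M -> R))
    (Ac : (interval M -> R) -> (interval n -> R)),
  [/\ forall c x y, Bc (fun I => c * x I + y I) = (fun K => c * Bc x K + Bc y K),
      forall c f g, Ac (fun K => c * f K + g K) = (fun I => c * Ac f I + Ac g I),
      forall x, hnorm X kind (Bc x) <= hnorm X kind x,
      forall f, hnorm X kind (Ac f) <= hnorm X kind f &
      forall x, del / (2 * (1 + eps) ^+ 2) * hnorm X kind x <=
                hnorm X kind (Ac (mxact t (Bc x)))].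
Proof.
have kM : (2 * r < M.+1)%N by rewrite ltnS (leq_trans (leq_addr _ _) room).
have Q0 : (0 < Q)%N by rewrite expn_gt0.
have [s [lab [c [labT lab_lev c_ge dsum_c]]]] := selection Gam_gt0 del_gt0
  t_bounded t_diag kM Q0 (leqnn m).
have [z zP] := good_signs (ltW Gam_gt0) (signed_bounded t_bounded s)
  (ltnW kM) labT lab_lev.
(* Both errors are at most [k]: the mean square of the entries gives one of them
   by the choice of [r], and the spread of the generation sums gives the other. *)
pose k := Gam / Q%:R.
have QR : (Q%:R : R) = 2 ^+ b * 4 ^+ n.+1.
  rewrite /Q natrX (_ : (b + 2 * n + 2 = b + 2 * n.+1)%N); last by lia.
  by rewrite exprD exprM; congr (_ * _ ^+ _); ring.
have Q0R : 0 < (Q%:R : R) by rewrite ltr0n.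
have k0 : 0 <= k by rewrite divr_ge0 // ltW.
have near A A' : A != finset.set0 -> A' != finset.set0 ->
    `|form (signed t s) (block_walsh R lab z A) (block_walsh R lab z A') - (A == A')%:R * c|
    <= 2 * k.
  move=> A0 A'0; set v := form _ _ _.
  have -> : v - (A == A')%:R * c = (v - (A == A')%:R * dsum (signed t s) lab A) +
      (A == A')%:R * (dsum (signed t s) lab A - c) by ring.
  apply: le_trans (ler_normD _ _) _.
  have h1 : `|v - (A == A')%:R * dsum (signed t s) lab A| <= k.
    rewrite -(ler_pXn2r (n := 2)) ?nnegrE // real_normK ?num_real //.
    apply: le_trans (zP A A' A0 A'0) _.
    pose u : R := 2 ^+ b; pose w : R := 4 ^+ n.+1.
    have u0 : u != 0 by rewrite expf_neq0 ?pnatr_eq0.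
    have w0 : w != 0 by rewrite expf_neq0 ?pnatr_eq0.
    have -> : (2^-1 : R) ^+ r = (u ^+ 2 * (w ^+ 2 * w) * 16)^-1.
      rewrite exprVn; congr (_^-1).
      have -> : (16 : R) = 2 ^+ 4 by ring.
      have -> : w = 2 ^+ (2 * n.+1) by rewrite exprM; congr (_ ^+ _); ring.
      by rewrite -!exprM -!exprD; congr (_ ^+ _); rewrite /r; lia.
    have -> : w * (9 * (Gam ^+ 2 * (u ^+ 2 * (w ^+ 2 * w) * 16)^-1)) =
        9 / 16 * k ^+ 2.
      by rewrite /k QR -/u -/w; field; rewrite u0 w0.
    by have := sqr_ge0 k; lra.
  have h2 : `|(A == A')%:R * (dsum (signed t s) lab A - c)| <= k.
    rewrite normrM normr_nat; case: (A == A'); last by rewrite mul0r.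
    by rewrite mul1r; apply: dsum_c.
  by lra.
(* The sign [s] of the selected part is absorbed into the embedding. *)
pose Bc (x : interval n -> R) := fun K => sg R s * block_op lab z x K.
exists Bc, (block_adj lab z); split.
- move=> a x y; apply/funext => K; rewrite /Bc /block_op.
  by case: (lab K) => [l|]; ring.
- move=> a f g; apply/funext => I; rewrite /block_adj [a * _]mulrCA -mulrDr; congr (_ * _).
  by rewrite mulr_sumr -big_split; apply: eq_bigr => K _ /=; ring.
- by move=> x; rewrite hnormZ normr_sgb mul1r; apply: hnorm_block_op.
- by move=> f; apply: hnorm_block_adj.
move=> x.
have -> : mxact t (Bc x) = mxact (signed t s) (block_op lab z x).
  apply/funext => K; apply: eq_bigr => L _; rewrite /Bc /signed; ring.
have k2 : 0 <= 2 * k by rewrite mulr_ge0.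
have := near_scalar X kind labT x k2 near; set U := block_adj _ _ _ => nearU.
have tri : c * hnorm X kind x <= hnorm X kind U +
    hnorm X kind (fun I => U I - c * x I).
  apply: le_trans (_ : hnorm X kind (fun I => c * x I) <= _).
    by rewrite hnormZ ler_wpM2r ?hnorm_ge0 // ler_norm.
  rewrite -[hnorm X kind (fun I => U I - c * x I)]mul1r -[1](normrN1 R) -hnormZ.
  apply: le_trans (hnormD _ _ _ _); rewrite le_eqVlt; apply/orP; left; apply/eqP.
  by congr hnorm; apply/funext => I; ring.
suff c_large : del / (2 * (1 + eps) ^+ 2) <= c - 4 ^+ n.+1 * (2 * k).
  have := ler_wpM2r (hnorm_ge0 X kind x) c_large; rewrite mulrBl => h.
  by apply: le_trans h _; lra.
have -> : 4 ^+ n.+1 * (2 * k) = 2 * (Gam / 2 ^+ b).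
  rewrite /k QR; field.
  by rewrite !expf_neq0 ?pnatr_eq0.
pose d := (1 + eps) ^+ 2.
have d0 : 0 < d by rewrite exprn_gt0 // addr_gt0.
have Gb : Gam / 2 ^+ b <= eps * del / (12 * d).
  have d12 : 0 < 12 * d by rewrite mulr_gt0.
  rewrite ler_pdivrMr ?exprn_gt0 // mulrAC ler_pdivlMr //.
  by move: b_large; rewrite ler_pdivrMr ?mulr_gt0 // -/d; lra.
have len_ge : m%:R * 2 ^+ b <= ((M.+1 - 2 * r)%N%:R : R).
  rewrite -natrX -natrM ler_nat; move: room; lia.
have len0 : 0 < ((M.+1 - 2 * r)%N%:R : R) by rewrite ltr0n subn_gt0.
have mlen : del * (m%:R / (M.+1 - 2 * r)%N%:R) <= eps * del / (12 * d).
  apply: (le_trans _ Gb); apply: le_trans (_ : del * (2 ^+ b)^-1 <= _).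
    by rewrite ler_pM2l // ler_pdivrMr // mulrC ler_pdivlMr ?exprn_gt0.
  by rewrite ler_wpM2r ?invr_ge0 ?exprn_ge0 // del_le_Gam.
have -> : del / (2 * (1 + eps) ^+ 2) = del / 2 / d by rewrite invfM mulrA.
apply: (le_trans _ (lerB c_ge (lexx _))).
rewrite mulrBr.
(* The three losses, one for the uncovered set and two for the errors, are each
   at most [eps * del / (12 * d)], where [d = (1 + eps) ^ 2]. *)
have key : del / 2 / d + 3 * (eps * del / (12 * d)) <= del * (1 / 2).
  have -> : del / 2 / d + 3 * (eps * del / (12 * d)) = del * (1 / 2 + eps / 4) / d.
    by field; rewrite gt_eqF.
  rewrite ler_pdivrMr // -mulrA ler_pM2l // /d.
  have -> : (1 + eps) ^+ 2 = 1 + 2 * eps + eps ^+ 2 by ring.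
  by have := sqr_ge0 eps; move: eps_gt0; lra.
lra.
Qed.

End CoefficientFactorization.

(** * From Lebesgue measure to the finite model *)

Definition dyadic_of n (K : interval n) : dyadic :=
  Tagged (fun j => 'I_(2 ^ j)) (tagged K).

Lemma dyadic_of_inj n : injective (@dyadic_of n).
Proof.
move=> [k i] [l j] eqd.
have kl : k = l by apply: val_inj; exact: (congr1 level eqd).
subst l; congr existT; apply: val_inj.
exact: (congr1 (fun I : dyadic => nat_of_ord (tagged I)) eqd).
Qed.

Lemma dyadic_of_surj n (I : dyadic) : (level I <= n)%N ->
  exists K : interval n, dyadic_of K = I.
Proof.
case: I => k i; rewrite /level /= -ltnS => kn.
by exists (existT (fun j : 'I_n.+1 => 'I_(2 ^ j)) (Ordinal kn) i).
Qed.

Section Geometry.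
Local Open Scope classical_set_scope.
Context (R : realType).
Implicit Types (b : nat -> bool) (u : R).

Lemma cell_coarser P l b u : (l <= P)%N -> @cell R P (num b P) u ->
  @cell R l (num b l) u.
Proof.
elim: P => [|P IHP]; first by rewrite leqn0 => /eqP ->.
rewrite leq_eqVlt => /predU1P[-> //|]; rewrite ltnS => lP /= uc.
apply: IHP => //; apply/cell_halve.
by move: uc; case: (b P) => /=; rewrite ?add1n ?add0n; [right|left].
Qed.

Lemma enumerates_num P :
  enumerates P (fun p : point P => num (bits p) P).
Proof.
split; last exact: card_point.
  move=> p q /eq_num eqn; apply/ffunP => i; rewrite -!bits_ord.
  exact: eqn.
by move=> p; apply: num_lt.
Qed.

Definition in_point P (p : point P) u : Prop := @cell R P (num (bits p) P) u.

Lemma haarE (I : dyadic) u : haar (Some I) u =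
  \1_(@cell R (level I).+1 (tagged I).*2) u -
  \1_(@cell R (level I).+1 (tagged I).*2.+1) u.
Proof. by rewrite -left_halfE -right_halfE. Qed.

Lemma haar_value k (i : 'I_(2 ^ k)) P (p : point P) u : (k < P)%N ->
  in_point p u ->
  haar (Some (Tagged (fun j => 'I_(2 ^ j)) i)) u =
  (num (bits p) k == i)%:R * sg R (bits p k).
Proof.
move=> kP up; have uk : @cell R k.+1 (bits p k + (num (bits p) k).*2)%N u := cell_coarser kP up.
rewrite haarE /level /= !indicE.
move: uk; move: (num (bits p) k) (bits p k) => x e uk.
have in_cell y : (u \in @cell R k.+1 y) = (e + x.*2 == y)%N.
  apply/idP/eqP => [/set_mem uy|<-]; first exact: cell_uniq uk uy.
  exact: mem_set.
have eqE : (x == i) = (x.*2 == (nat_of_ord i).*2) by rewrite (inj_eq double_inj).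
rewrite !in_cell; case: e {uk in_cell} => /=; rewrite ?add1n ?add0n /sg.
  rewrite eqSS -eqE expr1 mulrN1.
  rewrite (_ : (_.+1 == _) = false) ?sub0r //.
  by apply/eqP => /(congr1 odd) /=; rewrite !odd_double.
rewrite -eqE expr0 mulr1.
rewrite (_ : (_ == _.+1) = false) ?subr0 //.
by apply/eqP => /(congr1 odd) /=; rewrite !odd_double.
Qed.

Lemma haar_dyadic_of n (K : interval n) (p : point n.+1) u : in_point p u ->
  haar (Some (dyadic_of K)) u = haar_at R K (bits p).
Proof.
move=> up; rewrite (haar_value _ _ up) ?ltn_ord // /haar_at; congr ((nat_of_bool _)%:R * _).
apply/eqP/eqP => [eqn|/(congr1 (fun K : interval n => nat_of_ord (tagged K))) //].
case: K eqn => k i /= eqn; rewrite /branch /lev /=; congr Tagged.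
exact: val_inj.
Qed.

Lemma haar_out n (K : interval n) u : ~ (`[0, 1[%classic : set R) u ->
  haar (Some (dyadic_of K)) u = 0.
Proof.
move=> uN; rewrite haarE !indicE.
have i_lt := ltn_ord (tagged K).
rewrite !memNset ?subrr // => uc; apply: uN; apply: (cell_unit _ uc).
  by rewrite /level /= expnS mul2n -doubleS leq_double.
by rewrite /level /= expnS mul2n ltn_double.
Qed.

Lemma haar_sum_is_step n (x : interval n -> R) :
  \sum_K x K *: haar (Some (dyadic_of K)) =
  step n.+1 (fun p : point n.+1 => num (bits p) n.+1) (fun p => haar_sum x (bits p)).
Proof.
apply/funext => u; rewrite fct_sumE.
have [/(step_cover (enumerates_num n.+1))[p up]|uN] := pselect ((`[0, 1[%classic : set R) u).
  rewrite (stepE _ (enumerates_num _) up) haar_sumE; apply: eq_bigr => K _.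
  by rewrite -(haar_dyadic_of K up).
rewrite (step_out _ (enumerates_num _) uN) big1 // => K _.
by rewrite -[LHS]/(x K * haar (Some (dyadic_of K)) u) haar_out // mulr0.
Qed.

(** The Rademacher function [r_m] reads the binary digit [m]. *)
Lemma rademacher_value m P (q : point P) u : (m < P)%N -> in_point q u ->
  rademacher m u = sg R (bits q m).
Proof.
move=> mP uq; rewrite /rademacher fct_sumE.
rewrite (bigD1 (Ordinal (num_lt (bits q) m))) // (haar_value _ mP uq) eqxx mul1r.
rewrite big1; [exact: addr0|move=> i iN]; rewrite (haar_value _ mP uq) eq_sym.
by rewrite (_ : (nat_of_ord i == _) = false) ?mul0r //; apply: negbTE.
Qed.

Lemma lebesgue_unit : lebesgue_measure (`[0, 1[%classic : set R) = 1%E.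
Proof. by rewrite lebesgue_measure_itv /= lte_fin ltr01 sube0. Qed.

Lemma iota_lt n (K : interval n) : (iota_index (Some (dyadic_of K)) < 2 ^ n.+1)%N.
Proof.
rewrite /iota_index /dyadic_of /level /=.
apply: leq_trans (_ : 2 ^ (lev K).+1 <= _)%N; last first.
  by rewrite leq_exp2l // ltn_ord.
by rewrite expnS mul2n -addnn ltn_add2l.
Qed.

(** The index of an interval of level [k] lies in [2 ^ k, ..., 2 ^ (k + 1) - 1], so
    the Rademacher functions along a branch are distinct. *)
Lemma iota_lev n (K L : interval n) :
  iota_index (Some (dyadic_of K)) = iota_index (Some (dyadic_of L)) ->
  lev K = lev L.
Proof.
have le (I J : interval n) : (lev I < lev J)%N ->
    iota_index (Some (dyadic_of I)) <> iota_index (Some (dyadic_of J)).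
  move=> IJ; apply/eqP; rewrite neq_ltn; apply/orP; left.
  rewrite /iota_index /dyadic_of /level /=.
  apply: leq_trans (_ : 2 ^ (lev I).+1 <= _)%N.
    by rewrite expnS mul2n -addnn ltn_add2l.
  by apply: leq_trans (leq_addr _ _); rewrite leq_exp2l.
move=> eqi; apply: val_inj => /=.
by case: (ltngtP (lev K) (lev L)) => // /le; rewrite eqi.
Qed.

(** Along a branch the independent Rademacher functions are independent signs,
    and the integral over the unit interval is a mean over digits. *)
Lemma rademacher_integral kind n (x : interval n -> R) (p : point n.+1) u :
  in_point p u ->
  \int[lebesgue_measure]_(v in `[0, 1[)
    `|\sum_K rademacher_family kind (Some (dyadic_of K)) v * x K *
        haar (Some (dyadic_of K)) u| = rmodulus kind x p.
Proof.
move=> up.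
under eq_Rintegral => v _.
  under eq_bigr => K _ do rewrite (haar_dyadic_of K up) /haar_at -mulrA.
  rewrite (eq_bigr (fun K => (rademacher_family kind (Some (dyadic_of K)) v *
    (x K * sg R (bits p (lev K)))) * (branch (lev K) (bits p) == K)%:R)); last first.
    by move=> K _; ring.
  rewrite sum_branch; over.
case: kind => /=.
  pose P := (2 ^ n.+1)%N.
  pose s (k : 'I_n.+1) : 'I_P := Ordinal (iota_lt (branch k (bits p))).
  have s_inj : injective s.
    move=> k l eqs; apply: (@iota_lev _ (branch k (bits p)) (branch l (bits p))).
    exact: (congr1 val eqs).
  pose F (q : point P) : R := `|haar_sum (twist (restr s q) x) (bits p)|.
  transitivity (\int[lebesgue_measure]_(v in `[0, 1[)
      step P (fun q : point P => num (bits q) P) F v).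
    apply: eq_Rintegral => v /set_mem /(step_cover (enumerates_num P))[q vq].
    rewrite (stepE _ (enumerates_num _) vq) /F; congr `|_|; apply: eq_bigr => k _.
    rewrite (rademacher_value (iota_lt (branch k (bits p))) vq).
    by rewrite /twist lev_branch ffunE -[RHS]mulrA -bits_ord.
  rewrite (Rintegral_step _ (enumerates_num P)) /F.
  by rewrite (avg_restr (fun z => `|haar_sum (twist z x) (bits p)|) s_inj).
transitivity (\int[lebesgue_measure]_(v in `[0, 1[) `|haar_sum x (bits p)|).
  apply: eq_Rintegral => v /set_mem /(step_cover (enumerates_num 1))[q vq].
  under eq_bigr => k _ do rewrite (rademacher_value (ltn0Sn 0) vq).
  by rewrite -mulr_sumr normrM normr_sgb mul1r /haar_sum; congr `|_|; apply: eq_bigr => k _; rewrite lev_branch.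
rewrite Rintegral_cst; last exact: measurable_itv.
rewrite -[RHS]mulr1; congr (_ * _); last by rewrite -[RHS]/(fine 1%E) -lebesgue_unit.
rewrite /rmodulus /=; congr `|_|.
by apply: eq_bigr => k _; rewrite /twist ffunE /sg expr0 mul1r.
Qed.

Lemma hardy_norm_sum (Y : haar_hardy_space R) n (x : interval n -> R) :
  hardy_norm Y (\sum_K x K *: haar (Some (dyadic_of K))) =
  hnorm (hardy_base Y) (hardy_kind Y) x.
Proof.
pose ix (K : interval n) : haar_index := Some (dyadic_of K).
have ix_inj : injective ix by move=> K L /Some_inj /dyadic_of_inj.
pose a (I : haar_index) : R := if [pick K | ix K == I] is Some K then x K else 0.
have aE K : a (ix K) = x K.
  rewrite /a; case: pickP => [L /eqP/ix_inj -> //|/(_ K)].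
  by rewrite eqxx.
have := hardy_normE Y (s := map ix (index_enum (interval n))) a.
rewrite (map_inj_uniq ix_inj) index_enum_uniq big_map.
under eq_bigr do rewrite aE.
move=> -> //; rewrite /hnorm -(rinormE _ _ (enumerates_num n.+1)); congr hs_norm.
apply/funext => u.
transitivity (\int[lebesgue_measure]_(v in `[0, 1[)
    `|\sum_K rademacher_family (hardy_kind Y) (ix K) v * x K * haar (ix K) u|).
  apply: eq_Rintegral => v _; rewrite big_map; congr `|_|.
  by apply: eq_bigr => K _; rewrite aE.
have [/(step_cover (enumerates_num n.+1))[p up]|uN] := pselect ((`[0, 1[%classic : set R) u).
  by rewrite (stepE _ (enumerates_num _) up) (rademacher_integral _ _ up).
rewrite (step_out _ (enumerates_num _) uN).
under eq_Rintegral => v _.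
  rewrite big1 ?normr0 => [|K _]; last by rewrite haar_out ?mulr0 //.
  over.
by rewrite Rintegral_cst ?mul0r //; apply: measurable_itv.
Qed.

End Geometry.

(** * Coordinates on the finite-dimensional sections *)

Section Coordinates.
Local Open Scope classical_set_scope.
Context (R : realType) (Y : haar_hardy_space R) (n : nat).
Implicit Types (f g : hsection Y n) (x y : interval n -> R) (K : interval n).

Lemma synth_subproof x :
  \sum_K x K *: haar (Some (dyadic_of K)) \in @haar_spanp R (level_le n).
Proof.
apply: rpred_sum => K _; apply: rpredZ; apply: haar_in_span.
by rewrite /= /level /= -ltnS ltn_ord.
Qed.

Definition synth x : hsection Y n := HSection Y (synth_subproof x).

Definition sample (p : point n.+1) : R := (num (bits p) n.+1)%:R / 2 ^+ n.+1.

Lemma sample_in p : in_point p (sample p).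
Proof.
rewrite /in_point cellE /sample mulfVK ?expf_neq0 ?pnatr_eq0 //.
by rewrite lexx ltr_nat ltnSn.
Qed.

Definition coords f : interval n -> R := coef (fun p => hsval f (sample p)).

Lemma synthE x (p : point n.+1) u : in_point p u -> hsval (synth x) u = haar_sum x (bits p).
Proof.
by move=> up; rewrite /= haar_sum_is_step (stepE _ (enumerates_num _) up).
Qed.

Lemma synthK x : coords (synth x) = x.
Proof.
rewrite -[RHS]coef_haar_sum; congr coef; apply/funext => p.
exact/synthE/sample_in.
Qed.

Lemma coordsK f : synth (coords f) = f.
Proof.
suff [x xf] : exists x, synth x = f by rewrite -xf synthK.
case: f => f fP; have /set_mem[l lP fE] := fP.
pose x K : R := \sum_(p <- l) p.1 * (p.2 == Some (dyadic_of K))%:R.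
exists x; apply: val_inj => /=; rewrite fE; apply/esym.
rewrite /x; under [RHS]eq_bigr do rewrite scaler_suml.
rewrite exchange_big /= big_seq [RHS]big_seq; apply: eq_bigr => -[c [I|]] /= /(allP lP) //= In.
have [K0 <-] := dyadic_of_surj In.
rewrite (bigD1 K0) //= eqxx mulr1 big1 ?addr0 // => K KK0.
rewrite (_ : (Some _ == _) = false) ?mulr0 ?scale0r //.
by apply/eqP => /Some_inj /dyadic_of_inj eqK; rewrite eqK eqxx in KK0.
Qed.

Lemma hsvalD f g : hsval (f + g) = hsval f + hsval g.
Proof. exact: (raddfD (val : hsection Y n -> R -> R)). Qed.

Lemma hsvalZ c f : hsval (c *: f) = c *: hsval f.
Proof. by have := linearZ_LR (val : hsection Y n -> R -> R) c f. Qed.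

Lemma coords_linear c f g :
  coords (c *: f + g) = fun K => c * coords f K + coords g K.
Proof.
apply/funext => K; rewrite /coords /coef hsvalD hsvalZ [c * (_ * _)]mulrCA -mulrDr.
congr (_ * _); rewrite -avgZ -avgD; apply: eq_avg => p.
by rewrite /GRing.scale /= mulrDl mulrA.
Qed.

Lemma coords0 : coords 0 = fun=> 0.
Proof.
have := coords_linear (-1) 0 0; rewrite scaler0 addr0 => c0.
by apply/funext => K; have := congr1 (@^~ K) c0; rewrite /=; lra.
Qed.

Lemma coordsZ c f : coords (c *: f) = fun K => c * coords f K.
Proof.
rewrite -[c *: f]addr0 coords_linear coords0.
by apply/funext => K; rewrite addr0.
Qed.

Lemma coordsD f g : coords (f + g) = fun K => coords f K + coords g K.
Proof.
rewrite -[f]scale1r coords_linear scale1r.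
by apply/funext => K; rewrite mul1r.
Qed.

Lemma synth_linear c x y :
  synth (fun K => c * x K + y K) = c *: synth x + synth y.
Proof.
rewrite -[RHS]coordsK; congr synth.
by rewrite coords_linear !synthK.
Qed.

Lemma synth_sum x : synth x = \sum_K x K *: synth (delta R K).
Proof.
apply: val_inj.
rewrite (raddf_sum (val : hsection Y n -> R -> R)) /=; apply: eq_bigr => K _.
rewrite -[RHS]/(hsval (x K *: synth (delta R K))) hsvalZ; congr (_ *: _).
rewrite /= (bigD1 K) //= /delta eqxx scale1r big1 ?addr0 // => L /negPf ->.
by rewrite scale0r.
Qed.

Lemma norm_synth x : hardy_norm Y (synth x) = hnorm (hardy_base Y) (hardy_kind Y) x.
Proof. exact: hardy_norm_sum. Qed.

Lemma norm_coords f : hardy_norm Y f = hnorm (hardy_base Y) (hardy_kind Y) (coords f).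
Proof. by rewrite -norm_synth coordsK. Qed.

Lemma synth_delta K (Kn : (level (dyadic_of K) <= n)%N) :
  synth (delta R K) = hsection_haar Y Kn.
Proof.
apply: val_inj => /=; rewrite (bigD1 K) //= /delta eqxx scale1r big1 ?addr0 //.
by move=> L /negPf ->; rewrite scale0r.
Qed.

Lemma inner_haar K f :
  inner (haar (Some (dyadic_of K))) f = 2^-1 ^+ lev K * coords f K.
Proof.
rewrite -avg_haar_sum_at -(Rintegral_step _ (enumerates_num n.+1)).
apply: eq_Rintegral => u /set_mem /(step_cover (enumerates_num n.+1))[p up].
rewrite (stepE _ (enumerates_num _) up) (haar_dyadic_of K up) mulrC.
by rewrite -{1}(coordsK f) (synthE _ up).
Qed.

End Coordinates.

Section MatrixOf.
Context (R : realType) (Y : haar_hardy_space R) (M : nat) (Gam del : R).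
Context (T : {linear hsection Y M -> hsection Y M}).
Hypothesis Gam_ge0 : 0 <= Gam.
Hypothesis T_bounded : (opnorm T <= Gam%:E)%E.
Hypothesis T_diag : large_diagonal del T.

Let X := hardy_base Y.
Let kind := hardy_kind Y.

Definition matrix_of (K L : interval M) : R := coords (T (synth Y (delta R L))) K.

Lemma mxact_matrix_of x : mxact matrix_of x = coords (T (synth Y x)).
Proof.
rewrite [in RHS](synth_sum Y x) linear_sum /=.
have coords_sum (r : seq (interval M)) (F : interval M -> hsection Y M) K :
    coords (\sum_(L <- r) F L) K = \sum_(L <- r) coords (F L) K.
  elim: r => [|L r IHr]; first by rewrite !big_nil coords0.
  by rewrite !big_cons coordsD IHr.
apply/funext => K; rewrite coords_sum; apply: eq_bigr => L _.
by rewrite linearZ /= coordsZ mulrC.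
Qed.

Lemma opnorm_le (f : hsection Y M) : hardy_norm Y f <= 1 -> hardy_norm Y (T f) <= Gam.
Proof.
move=> f1; rewrite -lee_fin; apply: le_trans T_bounded.
by apply: ereal_sup_ubound; exists f.
Qed.

(** The bound on the unit ball extends by homogeneity. A series of norm zero is
    treated by scaling it up without bound. *)
Lemma matrix_of_bounded x : hnorm X kind (mxact matrix_of x) <= Gam * hnorm X kind x.
Proof.
rewrite mxact_matrix_of -!norm_coords -!norm_synth.
set f := synth Y x.
have homog c g : hardy_norm Y (c *: g : hsection Y M) = `|c| * hardy_norm Y g.
  by rewrite !norm_coords -hnormZ coordsZ.
have f0 : 0 <= hardy_norm Y f by rewrite norm_coords hnorm_ge0.
have [fz|fnz] := eqVneq (hardy_norm Y f) 0.
  have big c : 0 < c -> c * hardy_norm Y (T f) <= Gam.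
    move=> c0; rewrite -[c]gtr0_norm // -homog -linearZ; apply: opnorm_le.
    by rewrite homog fz mulr0.
  rewrite fz mulr0 leNgt; apply/negP => Tf.
  have c0 : 0 < (Gam + 1) / hardy_norm Y (T f) by rewrite divr_gt0 // ltr_wpDl.
  by have := big _ c0; rewrite mulfVK ?gt_eqF // gerDl ler10.
have fp : 0 < hardy_norm Y f by rewrite lt_neqAle eq_sym fnz.
have := @opnorm_le ((hardy_norm Y f)^-1 *: f).
rewrite linearZ !homog ger0_norm ?invr_ge0 // mulVf // lexx => /(_ isT).
by rewrite mulrC ler_pdivrMr.
Qed.

Lemma matrix_of_diag K : del <= `|matrix_of K K|.
Proof.
have Kn : (level (dyadic_of K) <= M)%N by rewrite /level /= -ltnS ltn_ord.
have := T_diag Kn; rewrite -synth_delta inner_haar normrM.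
by rewrite ger0_norm ?exprn_ge0 // /dyadic_length exprVn mulrC ler_pM2l.
Qed.

End MatrixOf.

Section Inverse.
Context (R : realType) (n : nat) (U : (interval n -> R) -> (interval n -> R)).
Hypothesis U_linear : forall a x y,
  U (fun K => a * x K + y K) = fun K => a * U x K + U y K.
Hypothesis U_inj : forall x, U x = (fun=> 0) -> x = (fun=> 0).

Let vec (x : interval n -> R) : 'rV[R]_(#|interval n|) := \row_i x (enum_val i).
Let unvec (v : 'rV[R]_(#|interval n|)) : interval n -> R := fun K => v 0 (enum_rank K).

Let vecK x : unvec (vec x) = x.
Proof. by apply/funext => K; rewrite /unvec mxE enum_rankK. Qed.

Let unvecK v : vec (unvec v) = v.
Proof. by apply/rowP => i; rewrite mxE /unvec enum_valK. Qed.

Let U0 : U (fun=> 0) = fun=> 0.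
Proof.
have := U_linear (-1) (fun=> 0) (fun=> 0).
rewrite (_ : (fun K : interval n => -1 * 0 + 0 : R) = fun=> 0); last first.
  by apply/funext => K; rewrite mulr0 addr0.
by move=> U0; apply/funext => K; have := congr1 (@^~ K) U0; rewrite /=; lra.
Qed.

Let U_sum (r : seq (interval n)) (x : interval n -> R) :
  U (fun K => \sum_(L <- r) x L * delta R L K) =
  fun K => \sum_(L <- r) x L * U (delta R L) K.
Proof.
elim: r => [|L r IHr].
  by under eq_fun do rewrite big_nil; rewrite U0; apply/funext => K; rewrite big_nil.
under eq_fun do rewrite big_cons.
rewrite U_linear; apply/funext => K.
by rewrite big_cons IHr.
Qed.

Let A : 'M[R]_(#|interval n|) := \matrix_(i, j) U (delta R (enum_val i)) (enum_val j).

Let vec_U x : vec (U x) = vec x *m A.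
Proof.
apply/rowP => j; rewrite !mxE.
have -> : U x = fun K => \sum_L x L * U (delta R L) K.
  rewrite -U_sum; congr U; apply/funext => K.
  rewrite (bigD1 K) //= /delta eqxx mulr1 big1 ?addr0 // => L.
  by rewrite eq_sym => /negPf ->; rewrite mulr0.
rewrite (reindex (@enum_val (interval n) predT)) /=; last first.
  exact/onW_bij/enum_val_bij.
by apply: eq_bigr => i _; rewrite !mxE.
Qed.

(** The inverse is read off the matrix of [U]. *)
Lemma linear_inverse : exists V : (interval n -> R) -> (interval n -> R),
  [/\ forall a x y, V (fun K => a * x K + y K) = fun K => a * V x K + V y K,
      forall x, V (U x) = x & forall x, U (V x) = x].
Proof.
have Aunit : A \in unitmx.
  rewrite -row_free_unit; apply: inj_row_free => v vA.
  rewrite -[v]unvecK; have -> : unvec v = fun=> 0.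
    apply: U_inj; rewrite -[LHS]vecK vec_U unvecK vA.
    by apply/funext => K; rewrite /unvec mxE.
  by apply/rowP => i; rewrite !mxE.
exists (fun y => unvec (vec y *m invmx A)); split.
- move=> a x y.
  have -> : vec (fun K => a * x K + y K) = a *: vec x + vec y.
    by apply/rowP => i; rewrite !mxE.
  by apply/funext => K; rewrite /unvec mulmxDl -scalemxAl !mxE.
- by move=> x; rewrite vec_U mulmxK // vecK.
- by move=> x; rewrite -[LHS]vecK vec_U unvecK mulmxKV // vecK.
Qed.

End Inverse.

(** The coefficient at [K] is a bounded functional of the series. *)
Lemma hnorm_eq0 (R : realType) (X : haar_system_space R) kind n
  (x : interval n -> R) : hnorm X kind x <= 0 -> x = fun=> 0.
Proof.
move=> x0; apply/funext => K; apply/eqP; rewrite -normr_le0.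
have anti : antichain 0 (pred1 K).
  by split=> // b i j /eqP <- /eqP /(congr1 (@lev n)); rewrite !lev_branch.
have fl : flat ([ffun=> false] : point 0) (delta R K).
  apply: (flat_antichain anti) => L; rewrite /delta normr_nat /=.
  by rewrite eq_sym.
have := flat_dual_le X kind x fl; rewrite (bigD1 K) //= big1 ?addr0.
  rewrite /delta eqxx mul1r normrM => /le_trans/(_ x0).
  by rewrite pmulr_rle0 // normr_gt0 expf_neq0 // invr_neq0 ?pnatr_eq0.
by move=> L /negPf LK; rewrite /delta LK mul0r mulr0.
Qed.

Lemma linear_of (R : pzRingType) (U V : lmodType R) (g : U -> V) :
  linear g -> exists F : {linear U -> V}, F =1 g.
Proof.
move=> gl; pose m := GRing.isLinear.Build R U V *:%R g gl.
pose F : {linear U -> V} := HB.pack g m.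
by exists F.
Qed.

(** * The factorization *)

(** Nonnegativity is needed to multiply bounds in the extended reals. *)
Lemma opnorm_bounds (R : realType) (Y : haar_hardy_space R) (k m : nat)
    (F : {linear hsection Y k -> hsection Y m}) (C : R) :
  0 <= C -> (forall f : hsection Y k, hardy_norm Y (F f) <= C * hardy_norm Y f) ->
  (0%E <= opnorm F)%E /\ (opnorm F <= C%:E)%E.
Proof.
move=> C0 FC; split.
  have norm0 j : hardy_norm Y (0 : hsection Y j) = 0.
    by rewrite norm_coords coords0 hnorm0.
  apply: ereal_sup_ubound; exists (0 : hsection Y k).
    by rewrite /mkset norm0.
  by rewrite linear0 norm0.
apply: ge_ereal_sup => _ [f f1 <-]; rewrite lee_fin.
by apply: le_trans (FC f) _; rewrite -[leRHS]mulr1 ler_wpM2l.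
Qed.

Section Conclusion.
Context (R : realType) (Y : haar_hardy_space R) (M n b : nat) (Gam del eps : R).
Context (T : {linear hsection Y M -> hsection Y M}).
Hypothesis Gam_gt0 : 0 < Gam.
Hypothesis del_gt0 : 0 < del.
Hypothesis eps_gt0 : 0 < eps.
Hypothesis T_bounded : (opnorm T <= Gam%:E)%E.
Hypothesis T_diag : large_diagonal del T.

Let t_bounded := matrix_of_bounded (ltW Gam_gt0) T_bounded.
Let t_diag := matrix_of_diag T_diag.

Lemma diagonal_le_norm : del <= Gam.
Proof. exact: (del_le_Gam Gam_gt0 t_bounded t_diag). Qed.

(** The inverse [V] of the compressed operator [U] completes the factorization;
    its norm is at most the inverse of the lower bound for [U]. *)
Lemma identity_factors :
  12 * (1 + eps) ^+ 2 * Gam / (eps * del) <= 2 ^+ b ->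
  (2 ^ (2 * b + 4 * n + 10) <= M)%N ->
  factors_through (idfun : {linear hsection Y n -> hsection Y n}) T
    (2 * (1 + eps) ^+ 2 / del).
Proof.
move=> b_large M_large.
have [Bc [Ac [Blin Alin Ble Ale below]]] :=
  coef_factorization Gam_gt0 del_gt0 eps_gt0 t_bounded t_diag b_large M_large.
set X := hardy_base Y in Ble Ale below; set kind := hardy_kind Y in Ble Ale below.
pose U x := Ac (mxact (matrix_of T) (Bc x)).
set c := del / _ in below.
have c0 : 0 < c by rewrite divr_gt0 // mulr_gt0 // exprn_gt0 // addr_gt0.
have U_linear a x y : U (fun K => a * x K + y K) = fun K => a * U x K + U y K.
  rewrite /U Blin -Alin; congr Ac; apply/funext => K.
  rewrite /mxact mulr_sumr -big_split; apply: eq_bigr => L _ /=; ring.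
have U_inj x : U x = (fun=> 0) -> x = (fun=> 0).
  move=> Ux; apply: (@hnorm_eq0 _ X kind); rewrite -(pmulr_rle0 _ c0).
  by apply: le_trans (below x) _; rewrite -/(U x) Ux hnorm0.
have [V [Vlin VU UV]] := linear_inverse U_linear U_inj.
have Vle y : hnorm X kind (V y) <= c^-1 * hnorm X kind y.
  by rewrite mulrC ler_pdivlMr // mulrC -[in leRHS](UV y); apply: below.
have [B BE] : exists B : {linear hsection Y n -> hsection Y M},
    B =1 fun f => synth Y (Bc (coords f)).
  apply: linear_of => a f g.
  by rewrite coords_linear Blin synth_linear.
have [A AE] : exists A : {linear hsection Y M -> hsection Y n},
    A =1 fun g => synth Y (V (Ac (coords g))).
  apply: linear_of => a f g.
  by rewrite coords_linear Alin Vlin synth_linear.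
exists B, A; split; last first.
  move=> f; rewrite AE BE -mxact_matrix_of -/(U (coords f)) VU.
  by rewrite coordsK.
have [B0 B1] : (0%E <= opnorm B)%E /\ (opnorm B <= 1%:E)%E.
  apply: opnorm_bounds => // f.
  by rewrite BE norm_synth mul1r norm_coords; apply: Ble.
have [A0 A1] : (0%E <= opnorm A)%E /\ (opnorm A <= (c^-1)%:E)%E.
  apply: opnorm_bounds => [|g]; first by rewrite invr_ge0 ltW.
  rewrite AE norm_synth norm_coords; apply: le_trans (Vle _) _.
  by rewrite ler_wpM2l ?invr_ge0 ?(ltW c0).
apply: le_trans (lee_pmul A0 B0 A1 B1) _.
by rewrite mule1 lee_fin /c invf_div.
Qed.

End Conclusion.

Section Numerics.
Context (R : realType) (Gam del eps : R) (n : nat) (N : int).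
Hypothesis Gam_gt0 : 0 < Gam.
Hypothesis del_gt0 : 0 < del.
Hypothesis eps_gt0 : 0 < eps.
Hypothesis del_le : del <= Gam.

Let q : R := 12 * (1 + eps) ^+ 2 * Gam / (eps * del).

Let ratioE : 2 * (1 + eps) * Gam / (Defs.eta eps * del) = q.
Proof.
have e1 : 1 + eps != 0 by rewrite gt_eqF // addr_gt0.
rewrite /q /Defs.eta; field.
by rewrite e1 !gt_eqF.
Qed.

Let q_gt1 : 1 < q.
Proof.
rewrite /q ltr_pdivlMr ?mulr_gt0 // mul1r.
apply: lt_le_trans (_ : 12 * (1 + eps) ^+ 2 * del <= _); last first.
  by rewrite ler_wpM2l ?mulr_ge0 ?exprn_ge0 ?addr_ge0 ?(ltW eps_gt0).
rewrite ltr_pM2r //.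
have -> : (1 + eps) ^+ 2 = 1 + 2 * eps + eps ^+ 2 by ring.
by have := sqr_ge0 eps; move: eps_gt0; lra.
Qed.

(** Here [2 ^ (b - 1) <= q], so the logarithmic term alone is at least
    [4 (b - 1)], and the ceiling is at least one. *)
Lemma Nmin_large :
  (N = Nmin (2 * (1 + eps) * Gam) del eps n \/
   exists2 K : R, 1 <= K & N = NminK K (2 * (1 + eps) * Gam) del eps n) ->
  exists2 b : nat, q <= 2 ^+ b & ((2 * b + 4 * n + 10)%N%:Z <= N).
Proof.
have ln2 : 0 < ln (2 : R) by rewrite ln_gt0 // ltr1n.
have log_gt0 : 0 < log2 q by rewrite divr_gt0 // ln_gt0.
have [l lE] : exists l : nat, Num.floor (log2 q) = l%:Z.
  have : 0 <= Num.floor (log2 q) by rewrite floor_ge0 ltW.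
  by case: (Num.floor _) => // l _; exists l.
have /andP[l_le l_gt] := floor_itv (log2 q).
rewrite lE in l_le l_gt.
have q_le : q <= 2 ^+ l.+1.
  have q0 : 0 < q := lt_trans ltr01 q_gt1.
  have -> : (q <= 2 ^+ l.+1) = (ln q <= ln (2 ^+ l.+1)).
    by rewrite ler_ln ?posrE ?exprn_gt0.
  rewrite lnXn // -[_ *+ l.+1]mulr_natl.
  by rewrite -ler_pdivrMr // -/(log2 q) ltW // -natr1; move: l_gt; rewrite intrD.
have floor4 : (4 * l)%N%:Z <= Num.floor (4 * log2 q).
  rewrite floor_ge_int; move: l_le; rewrite -!pmulrn natrM; lra.
have ceil_ge1 x : 0 < x -> 1 <= Num.ceil (x : R) by rewrite -gtz0_ge1 ceil_gt0.
move=> NE; exists l.+1 => //; move: NE floor4.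
rewrite /Nmin /NminK -ratioE; set F := Num.floor _ => NE F4.
have : (42 * n%:Z + 42 + F <= N).
  case: NE => [->|[K K1 ->]].
    have /ceil_ge1 : 0 < 2 * (1 + eps) * Gam / (Defs.eta eps * del).
      by rewrite ratioE (lt_trans ltr01 q_gt1).
    set C := Num.ceil _; nia.
  have /ceil_ge1 : 0 < K * (2 * (1 + eps) * Gam) / (Defs.eta eps * del).
    rewrite -[K * _ / _]mulrA ratioE mulr_gt0 ?(lt_trans ltr01 q_gt1) //.
    exact: lt_le_trans ltr01 K1.
  set C := Num.ceil _; nia.
lia.
Qed.

End Numerics.

Theorem corollary1p4 (R : realType) (Y : haar_hardy_space R)
    (Gamma delta eps : R) (n Nt : nat) (N : int) :
  0 < Gamma -> 0 < delta -> 0 < eps ->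
  (N = Nmin (2 * (1 + eps) * Gamma) delta eps n \/
   exists K : R, [/\ 1 <= K, haar_unconditional Y K &
     N = NminK K (2 * (1 + eps) * Gamma) delta eps n]) ->
  2 * N%:~R * (Num.ceil (N%:~R / eps + 1 : R))%:~R * (2 : R) ^ N <= Nt%:R ->
  forall T : {linear hsection Y Nt -> hsection Y Nt},
    (opnorm T <= Gamma%:E)%E ->
    large_diagonal delta T ->
    factors_through (idfun : {linear hsection Y n -> hsection Y n}) T
      (2 * (1 + eps) ^+ 2 / delta).
Proof.
move=> Gamma0 delta0 eps0 NE Nt_large T T_bounded T_diag.
have delta_le := diagonal_le_norm Gamma0 T_bounded T_diag.
have [|b b_large N_large] := @Nmin_large R Gamma delta eps n N Gamma0 delta0 eps0 delta_le.
  by case: NE => [->|[K [K1 _ ->]]]; [left|right; exists K].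
apply: (identity_factors Gamma0 delta0 eps0 T_bounded T_diag b_large).
case: N N_large Nt_large {NE} => // k; rewrite lez_nat => k_large.
rewrite -exprnP -pmulrn => Nt_large.
apply: leq_trans (_ : 2 ^ k <= _)%N; first by rewrite leq_exp2l.
rewrite -(ler_nat R) natrX; apply: le_trans Nt_large.
have k1 : 1 <= (k%:R : R) by rewrite ler1n; lia.
have c1 : 1 <= ((Num.ceil (k%:R / eps + 1 : R))%:~R : R).
  rewrite (ler_int R 1) -gtz0_ge1 ceil_gt0 ltr_wpDl //.
  by rewrite divr_ge0 // ltW.
by rewrite ler_peMl ?exprn_ge0 // mulr_ege1 // mulr_ege1 // ler1n.
Qed.
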